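(* Let $k\ge 1$ be an integer and $0<a<b<\infty$. Then $Z_k:=Z_k([-b,-a],[a,b])$ satisfies \[ \frac{4\rho^{-2k}}{(1+\rho^{-4k})^4}\le Z_k\le \frac{4\rho^{-2k}}{(1+\rho^{-4k})^2}\le 4\rho^{-2k},\qquad \rho=\exp\left(\frac{\pi^2}{2\mu(a/b)}\right), \] where $\mu$ is the Gr\''otzsch ring function.
   Context: For an integer $k\ge 0$, $\mathcal{R}_{k,k}$ is the set of irreducible rational functions $p(x)/q(x)$ with $p,q$ complex polynomials of degree at most $k$. For closed disjoint sets $E,F\subset\mathbb{C}$ the Zolotarev number is \[ Z_k(E,F):=\inf_{r\in\mathcal{R}_{k,k}}\frac{\sup_{z\in E}|r(z)|}{\inf_{z\in F}|r(z)|}, \] where $|r(z)|=\infty$ at poles of $r$, and only $r$ with $\sup_{z\in E}|r(z)|<\infty$ and $\inf_{z\in F}|r(z)|>0$ need be considered. The Gr\''otzsch ring function is $\mu(\lambda)=\frac{\pi}{2}\,K(\sqrt{1-\lambda^2})/K(\lambda)$ for $0<\lambda<1$, where $K(\lambda)=\int_0^1 \frac{dt}{\sqrt{(1-t^2)(1-\lambda^2t^2)}}$ is the complete elliptic integral of the first kind. *)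

(* Defs.v *)
From HB Require Import structures.
From mathcomp Require Import all_boot all_order all_algebra complex.
From mathcomp Require Import all_classical all_reals all_analysis.

Set Implicit Arguments.
Unset Strict Implicit.
Unset Printing Implicit Defensive.

Import Order.TTheory GRing.Theory Num.Theory.
Import numFieldNormedType.Exports.

Local Open Scope classical_set_scope.
Local Open Scope ring_scope.

(* The pair (p, q) stands for the fraction p / q; recall size = degree + 1. *)
Definition ratfun_kk (R : realType) (k : nat) (p q : {poly R[i]}) : Prop :=
  [/\ (size p <= k.+1)%N, (size q <= k.+1)%N, q != 0 & coprimep p q].

(* When p and q are coprime, the poles of p / q in C are the roots of q. *)
Definition ratfun_abs (R : realType) (p q : {poly R[i]}) (z : R[i]) : \bar R :=
  if root q z then +oo%E else (complex.Re `|p.[z] / q.[z]|)%:E.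

Definition ratfun_sup (R : realType) (p q : {poly R[i]}) (E : set R[i]) :
  \bar R := ereal_sup (ratfun_abs p q @` E).

Definition ratfun_inf (R : realType) (p q : {poly R[i]}) (F : set R[i]) :
  \bar R := ereal_inf (ratfun_abs p q @` F).

(* The infimum over F may be +oo (if every point of F is a pole); the library's
   extended inverse then gives the quotient 0. *)
Definition zolotarev (R : realType) (k : nat) (E F : set R[i]) : \bar R :=
  ereal_inf [set y : \bar R | exists p q : {poly R[i]},
    [/\ ratfun_kk k p q,
        (ratfun_sup p q E < +oo)%E,
        (0 < ratfun_inf p q F)%E &
        y = (ratfun_sup p q E / ratfun_inf p q F)%E]].

Definition cinterval (R : realType) (a b : R) : set R[i] :=
  [set (real_complex R x) | x in `[a, b]].

(* The integrand is unbounded near t = 1; its junk value 0 at t = 1 does not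
   affect the Lebesgue integral. *)
Definition ellipticK (R : realType) (l : R) : R :=
  \int[@lebesgue_measure R]_(t in `[0, 1])
    (Num.sqrt ((1 - t ^+ 2) * (1 - l ^+ 2 * t ^+ 2)))^-1.

(* Only meaningful for 0 < l < 1. *)
Definition grotzsch_mu (R : realType) (l : R) : R :=
  pi / 2 * (ellipticK (Num.sqrt (1 - l ^+ 2)) / ellipticK l).

(* Main.v *)
From HB Require Import structures.
Require Import Defs.
From mathcomp Require Import all_boot all_order all_algebra complex.
From mathcomp Require Import all_classical all_reals all_analysis.
From mathcomp Require Import measurable_realfun zify ring lra.

Set Implicit Arguments.
Unset Strict Implicit.
Unset Printing Implicit Defensive.

Import Order.TTheory GRing.Theory Num.Theory.
Import numFieldNormedType.Exports.

Local Open Scope classical_set_scope.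
Local Open Scope ring_scope.

(** Scaling reduces everything to the sets [-1, -l] and [l, 1] with l = a / b.
    Three facts then give the result: an explicit extremal function, the
    transformation of moduli that it performs, and sharp bounds of a modulus
    by its nome.

    Extremal function.  Let S be the elliptic sine of a suitable modulus, with
    quarter period T, and let x(u) = (1 - S(u)^2) / (1 + S(u)^2), which
    decreases from 1 to l on [0, T].  Let c_0 > ... > c_(k-1) be the values of
    x at the odd multiples of T / 2k, and let g be the product of the factors
    (c_j - x) / (c_j + x).  The addition theorem gives
        (x(u) - x(v)) / (x(u) + x(v)) = - S(u + v) S(u - v),
    so g(x(u))^2 is the product of 2k equally spaced translates of S^2, hence
    has period T / k and is even.  Therefore |g| takes its maximum M over
    [l, 1] at k + 1 points 1 = t_0 > c_0 > t_1 > ... > t_k = l, and the inner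
    t_i are critical points (equioscillation_nodes).

    Optimality.  As g(-x) = 1 / g(x), the function 1 / g is at most M on
    [-1, -l] and at least 1 / M on [l, 1], so that Z_k <= M^2.  Suppose that
    p / q had a ratio below M^2.  After a normalization and a small
    perturbation, |p|^2 P^2 - Q^2 |q|^2, where g = P / Q, is a real polynomial
    of degree at most 4k on the real line which alternates in sign along the
    4k + 2 points +-t_i, +-c_j: this is impossible
    (equioscillation_optimal).  Hence Z_k = M^2.

    Transformation.  Write Z = M^2 and f = M g.  Counting zeros determines
    Z - g^2 and g' up to constants, and these combine to
        f'(x)^2 |(1 - x^2) (x^2 - l^2)| = C^2 |(1 - f^2) (f^2 - Z^2)|.
    So f carries one elliptic weight to C times another.  It maps each of the k
    intervals [t_(i+1), t_i] monotonically onto [-Z, Z], and [-l, l] onto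
    [Z, 1].  With K' denoting K at the complementary modulus, this says
    C K'(l) = 2 k K(Z) and K'(Z) = 2 C K(l) (ellipticK_transform).  In terms of
    mu it reads mu(Z) = k pi^2 / mu(l), that is exp(- mu(Z)) = rho^(-2k).

    Bounds.  It remains to show 4 y / (1 + y^2)^4 <= z <= 4 y / (1 + y^2)^2 for
    y = exp(- mu(z)).  The transformation with k = 1 yields a map z -> z' with
    mu(z') = 4 mu(z), which is a pair of Landen transformations.  If a bound
    failed at z by a factor B > 1, it would fail by B^4 at z', and by B^(4^n)
    at the n-th iterate z_n <= z^(4^n).  As z_n tends to 0, this contradicts
    - (1 - z) ln z <= mu(z) <= (2 ln 2 - ln z) / (1 - 2 z)
    (le_nome_upper, ge_nome_lower). *)

(** * Derivatives of real functions *)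

Section derivatives.
Context {R : realType}.
Implicit Types (f g : R -> R) (t x y : R).

Lemma is_derive_continuous f x (l : R) : is_derive x 1 f l -> {for x, continuous f}.
Proof. by move=> [fx _]; exact/differentiable_continuous/derivable1_diffP. Qed.

Lemma is_derive0_cst f x y : (forall t, is_derive t 1 f 0) -> f x = f y.
Proof. by move=> f0; exact: (@is_derive_0_is_cst R). Qed.

(** Computed derivatives come in the shape that the differentiation rules
    produce; this replaces that shape by the wanted one, the equation being
    left as a goal. *)
Lemma is_derive_eq1 f x d d' : is_derive x 1 f d -> d = d' -> is_derive x 1 f d'.
Proof. by move=> ? <-. Qed.

Lemma is_derive_mul f g x df dg :
  is_derive x 1 f df -> is_derive x 1 g dg ->
  is_derive x 1 (fun x => f x * g x) (df * g x + f x * dg).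
Proof.
move=> hf hg; have H := is_deriveM hf hg.
apply: (is_derive_eq1 H); rewrite /GRing.scale/=; ring.
Qed.

Lemma is_derive_chain f g x df dg :
  is_derive x 1 g dg -> is_derive (g x) 1 f df ->
  is_derive x 1 (fun x => f (g x)) (df * dg).
Proof. by move=> hg hf; exact: (@is_derive1_comp R f g). Qed.

Lemma is_derive_div f g x df dg :
  is_derive x 1 f df -> is_derive x 1 g dg -> g x != 0 ->
  is_derive x 1 (fun x => f x / g x) ((df * g x - f x * dg) / g x ^+ 2).
Proof.
move=> hf hg g0; have H := is_derive_mul hf (is_deriveV g0 hg).
apply: (is_derive_eq1 H); rewrite /GRing.scale/=; field; exact: g0.
Qed.

Lemma is_derive_sym0 f (a d : R) :
  (forall s, f (a + s) = f (a - s)) -> is_derive a 1 f d -> d = 0.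
Proof.
move=> fa df.
have dp : is_derive (0:R) (1:R) (fun s => a + s) 1.
  have H := is_deriveD (is_derive_cst a (0:R) (1:R)) (is_derive_id (0:R) (1:R)).
  by apply: (is_derive_eq1 H); rewrite add0r.
have dm : is_derive (0:R) (1:R) (fun s => a - s) (-1).
  have H := is_deriveB (is_derive_cst a (0:R) (1:R)) (is_derive_id (0:R) (1:R)).
  by apply: (is_derive_eq1 H); rewrite sub0r.
have df1 : is_derive (a + 0) 1 f d by rewrite addr0.
have df2 : is_derive (a - 0) 1 f d by rewrite subr0.
have [_ E1] := is_derive_chain dp df1.
have [_ E2] := is_derive_chain dm df2.
have fE : (fun s => f (a + s)) = (fun s => f (a - s)) by exact/funext.
by rewrite fE E2 in E1; lra.
Qed.

End derivatives.

(** * Monotonicity and change of variables on open intervals *)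

Section calculus.
Context {R : realType}.
Implicit Types (f df g : R -> R) (a b : R).
Local Notation mu := (@lebesgue_measure R).

Lemma pos_derive_lt f df a b :
  (forall x, a <= x <= b -> {for x, continuous f}) ->
  (forall x, a < x < b -> is_derive x 1 f (df x)) ->
  (forall x, a < x < b -> 0 < df x) ->
  forall x y, a <= x -> x < y -> y <= b -> f x < f y.
Proof.
move=> cf dfE df0 x y ax xy yb.
have [w|w|w] := @MVT R f df x y xy.
- rewrite in_itv/= => /andP[xw wy]; apply: dfE.
  by rewrite (le_lt_trans ax xw) (lt_le_trans wy yb).
- apply: continuous_in_subspaceT => z; rewrite inE/= in_itv/= => /andP[xz zy].
  by apply: cf; rewrite (le_trans ax xz) (le_trans zy yb).
rewrite in_itv/= => /andP[xw wy] E.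
rewrite -subr_gt0 E mulr_gt0 ?subr_gt0// df0//.
by rewrite (le_lt_trans ax xw) (lt_le_trans wy yb).
Qed.

Lemma neg_derive_lt f df a b :
  (forall x, a <= x <= b -> {for x, continuous f}) ->
  (forall x, a < x < b -> is_derive x 1 f (df x)) ->
  (forall x, a < x < b -> df x < 0) ->
  forall x y, a <= x -> x < y -> y <= b -> f y < f x.
Proof.
move=> cf dfE df0 x y ax xy yb; rewrite -ltrN2.
have cNf z : a <= z <= b -> {for z, continuous (- f)}.
  by move=> /cf; exact: continuousN.
have dNf z : a < z < b -> is_derive z 1 (- f) ((- df) z).
  by move=> /dfE ?; exact: is_deriveN.
have dNf0 z : a < z < b -> 0 < (- df) z.
  by move=> /df0; rewrite opprfctE oppr_gt0.
exact: (pos_derive_lt cNf dNf dNf0).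
Qed.

Lemma itv_oo_measurable_fun g a b :
  (forall y, a < y < b -> {for y, continuous g}) ->
  measurable_fun `]a, b[ (EFin \o g).
Proof.
move=> cg; apply/measurable_EFinP.
apply: subspace_continuous_measurable_fun => //.
apply: continuous_in_subspaceT => z; rewrite inE/= in_itv/= => /cg; exact.
Qed.

(** Elliptic integrands blow up at the ends of their intervals, so an integral
    over an open interval is recovered from segments that exhaust it, by
    monotone convergence. *)
Lemma cvg_integral_itv_oo g (a_ b_ : nat -> R) a b :
  (forall y, a < y < b -> {for y, continuous g}) ->
  (forall y, a < y < b -> 0 <= g y) ->
  (forall n, a < a_ n) -> (forall n, b_ n < b) ->
  (forall n, a_ n.+1 <= a_ n) -> (forall n, b_ n <= b_ n.+1) ->
  (forall y, a < y < b -> exists n, a_ n <= y <= b_ n) ->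
  (\int[mu]_(y in `[a_ n, b_ n]) (g y)%:E @[n --> \oo] -->
    \int[mu]_(y in `]a, b[) (g y)%:E)%E.
Proof.
move=> cg g0 aa bb da ib ex.
have sub n : `[a_ n, b_ n] `<=` `]a, b[.
  move=> y /=; rewrite !in_itv/= => /andP[ay yb].
  by rewrite (lt_le_trans (aa n) ay) (le_lt_trans yb (bb n)).
rewrite (_ : `]a, b[%classic = \bigcup_n `[a_ n, b_ n]%classic); last first.
  rewrite eqEsubset; split; last by apply: bigcup_sub => n _; exact: sub.
  by move=> y /=; rewrite in_itv/= => /ex[n ny]; exists n => //=; rewrite in_itv.
apply: ge0_nondecreasing_set_cvg_integral => //.
- apply/nondecreasing_seqP => n; rewrite subsetEset => y /=.
  rewrite !in_itv/= => /andP[ay yb].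
  by rewrite (le_trans (da n) ay) (le_trans yb (ib n)).
- move=> n; apply: (measurable_funS _ (sub n)) => //.
  exact: itv_oo_measurable_fun.
- move=> n y /sub/=; rewrite in_itv/= lee_fin; exact: g0.
Qed.

Let shrink_bounds a b : a < b -> exists a_ b_ : nat -> R,
  [/\ forall n, [/\ a < a_ n, a_ n < b_ n & b_ n < b],
    forall n, a_ n.+1 <= a_ n, forall n, b_ n <= b_ n.+1 &
    forall y, a < y < b -> exists n, a_ n <= y <= b_ n].
Proof.
move=> ab; pose e n : R := (b - a) / (n%:R + 3).
have ba : 0 < b - a by rewrite subr_gt0.
have n3 n : 0 < n%:R + 3 :> R by rewrite ltr_wpDl.
have e0 n : 0 < e n by rewrite divr_gt0.
have de n : e n.+1 <= e n.
  by rewrite /e ler_pM2l// lef_pV2 ?posrE// lerD2r ler_nat.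
have e3 n : 3 * e n <= b - a.
  rewrite mulrC -ler_pdivlMr// /e ler_pM2l// lef_pV2 ?posrE//.
  by rewrite lerDr.
exists (fun n => a + e n), (fun n => b - e n); split.
- move=> n; have := e0 n; have := e3 n; move: (e n) => E h1 h2.
  by split; lra.
- by move=> n; rewrite lerD2l.
- by move=> n; rewrite lerD2l lerN2.
move=> y /andP[ay yb].
pose d := Num.min (y - a) (b - y).
have d0 : 0 < d by rewrite /d lt_min !subr_gt0 ay.
have [dy1 dy2] : d <= y - a /\ d <= b - y.
  by rewrite /d; split; rewrite ge_min lexx ?orbT.
exists (Num.trunc ((b - a) / d)).
set n := Num.trunc _.
have en : e n <= d.
  rewrite /e ler_pdivrMr// -ler_pdivrMl// mulrC.
  apply: (le_trans (ltW (truncnS_gt _))); rewrite -/n -natr1 lerD2l.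
  lra.
by move: (e n) en => E h; apply/andP; split; lra.
Qed.

Section closed_subst.
Variables (f df g : R -> R) (a b a' b' : R).
Hypotheses (aa' : a < a') (ab' : a' < b') (bb' : b' < b).
Hypothesis dfE : forall x, a < x < b -> is_derive x 1 f (df x).
Hypothesis cdf : forall x, a < x < b -> {for x, continuous df}.

Let in_ab x : a' <= x <= b' -> a < x < b.
Proof.
by move=> /andP[ax xb]; rewrite (lt_le_trans aa' ax) (le_lt_trans xb bb').
Qed.

Let cf x : a < x < b -> {for x, continuous f}.
Proof.
move=> /dfE[fx _].
exact/differentiable_continuous/derivable1_diffP.
Qed.

Let derE x : a < x < b -> (derive1 f) x = df x.
Proof. by move=> /dfE[_]; rewrite derive1E. Qed.

Let near_derE x : a < x < b -> \forall y \near x, df y = (derive1 f) y.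
Proof.
move=> xab; have /near_in_itvoo : x \in `]a, b[ by rewrite in_itv.
by apply: filterS => y; rewrite in_itv/= => /derE.
Qed.

Let cder x : a < x < b -> {for x, continuous (derive1 f)}.
Proof.
move=> xab; rewrite /prop_for /continuous_at derE//.
apply: cvg_trans (cdf xab); apply: near_eq_cvg; exact: near_derE.
Qed.

Let fcc : derivable_oo_LRcontinuous f a' b'.
Proof.
have [a1 b1] : a < a' < b /\ a < b' < b.
  by split; apply: in_ab; rewrite lexx ltW.
split.
- move=> x; rewrite in_itv/= => /andP[ax xb].
  by have [|] := @dfE x => //; apply: in_ab; rewrite !ltW.
- by apply: cvg_at_right_filter; exact: cf.
- by apply: cvg_at_left_filter; exact: cf.
Qed.

Let cder_oo : {in `]a', b'[, continuous (derive1 f)}.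
Proof.
move=> x; rewrite in_itv/= => /andP[ax xb].
by apply: cder; apply: in_ab; rewrite !ltW.
Qed.

Let cder_a : cvg ((derive1 f) x @[x --> a'^'+]).
Proof.
apply/cvg_ex; exists ((derive1 f) a'); apply: cvg_at_right_filter.
by apply: cder; apply: in_ab; rewrite lexx ltW.
Qed.

Let cder_b : cvg ((derive1 f) x @[x --> b'^'-]).
Proof.
apply/cvg_ex; exists ((derive1 f) b'); apply: cvg_at_left_filter.
by apply: cder; apply: in_ab; rewrite lexx ltW.
Qed.

Lemma integral_subst_cc_incr :
  (forall x, a < x < b -> 0 < df x) ->
  (forall y, f a' <= y <= f b' -> {for y, continuous g}) ->
  (\int[mu]_(y in `[f a', f b']) (g y)%:E =
   \int[mu]_(x in `[a', b']) (g (f x) * df x)%:E)%E.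
Proof.
move=> df0 cg; rewrite integration_by_substitution_increasing ?ltW//.
- apply: eq_integral => x; rewrite inE/= in_itv/= => xab.
  by rewrite -derE//; exact: in_ab.
- move=> x y; rewrite !in_itv/= => /andP[ax xb] /andP[ay yb] xy.
  have ltin z : a' < z < b' -> a < z < b.
    by move=> /andP[az zb]; apply: in_ab; rewrite !ltW.
  exact: (pos_derive_lt (fun z zab => cf (in_ab zab))
    (fun z zab => dfE (ltin z zab)) (fun z zab => df0 _ (ltin z zab))).
- by apply: continuous_in_subspaceT => z; rewrite inE/= in_itv/= => /cg.
Qed.

Lemma integral_subst_cc_decr :
  (forall x, a < x < b -> df x < 0) ->
  (forall y, f b' <= y <= f a' -> {for y, continuous g}) ->
  (\int[mu]_(y in `[f b', f a']) (g y)%:E =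
   \int[mu]_(x in `[a', b']) (g (f x) * - df x)%:E)%E.
Proof.
move=> df0 cg; rewrite integration_by_substitution_decreasing ?ltW//.
- apply: eq_integral => x; rewrite inE/= in_itv/= => xab.
  by rewrite -derE//; exact: in_ab.
- move=> y x; rewrite !in_itv/= => /andP[ay yb] /andP[ax xb] xy.
  have ltin z : a' < z < b' -> a < z < b.
    by move=> /andP[az zb]; apply: in_ab; rewrite !ltW.
  exact: (neg_derive_lt (fun z zab => cf (in_ab zab))
    (fun z zab => dfE (ltin z zab)) (fun z zab => df0 _ (ltin z zab))).
- by apply: continuous_in_subspaceT => z; rewrite inE/= in_itv/= => /cg.
Qed.

End closed_subst.

Section open_subst.
Variables (f df g : R -> R) (a b : R).
Hypothesis ab : a < b.
Hypothesis cf : forall x, a <= x <= b -> {for x, continuous f}.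
Hypothesis dfE : forall x, a < x < b -> is_derive x 1 f (df x).
Hypothesis cdf : forall x, a < x < b -> {for x, continuous df}.

Let wcf : {within `[a, b], continuous f}.
Proof. by apply: continuous_in_subspaceT => x; rewrite inE/= in_itv/= => /cf. Qed.

Let cgf (c d : R) : (forall x, a < x < b -> c < f x < d) ->
  (forall y, c < y < d -> {for y, continuous g}) ->
  forall x, a < x < b -> {for x, continuous (fun x => g (f x))}.
Proof.
move=> fcd cg x xab; apply: continuous_comp; last by apply: cg; exact: fcd.
by apply: cf; case/andP: xab => ? ?; rewrite !ltW.
Qed.

(** Both sides are limits of the substitution rule on inner segments;
    nonnegativity makes these limits exist, possibly infinite, so that g may
    blow up at the ends. *)
Lemma ge0_integral_subst_incr :
  (forall x, a < x < b -> 0 < df x) ->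
  (forall y, f a < y < f b -> {for y, continuous g}) ->
  (forall y, f a < y < f b -> 0 <= g y) ->
  (\int[mu]_(y in `]f a, f b[) (g y)%:E =
   \int[mu]_(x in `]a, b[) (g (f x) * df x)%:E)%E.
Proof.
move=> df0 cg g0.
have finc := pos_derive_lt cf dfE df0.
have fab x : a < x < b -> f a < f x < f b.
  by move=> /andP[ax xb]; rewrite !finc// ltW.
have finc_le x y : a <= x -> x <= y -> y <= b -> f x <= f y.
  move=> ax; rewrite le_eqVlt => /predU1P[->//|xy] yb.
  by rewrite ltW// finc.
have [a_ [b_ [lab da ib ex]]] := shrink_bounds ab.
have /= cvr := @cvg_integral_itv_oo (fun x => g (f x) * df x) a_ b_ a b.
have /= cvl := @cvg_integral_itv_oo g (f \o a_) (f \o b_) (f a) (f b) cg g0.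
apply: (@cvg_unique _ _ (\int[mu]_(y in `[f (a_ n), f (b_ n)]) (g y)%:E @[n --> \oo])%E).
- exact: ereal_hausdorff.
- apply: cvl.
  + by move=> n; have [h1 h2 h3] := lab n; rewrite finc// ltW// (lt_trans h2).
  + by move=> n; have [h1 h2 h3] := lab n; rewrite finc// ltW// (lt_trans h1).
  + move=> n; have [h1 h2 h3] := lab n; have [? ? ?] := lab n.+1.
    by apply: finc_le => //; rewrite ltW// (lt_trans h2).
  + move=> n; have [h1 h2 h3] := lab n; have [? ? ?] := lab n.+1.
    by apply: finc_le => //; rewrite ltW// (lt_trans h1).
  + move=> y /andP[fy yf].
    have [|x] := @IVT R f a b y (ltW ab) wcf.
      by rewrite ge_min le_max (ltW fy) (ltW yf) orbT.
    rewrite in_itv/= => /andP[ax xb] fx.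
    have /ex[n /andP[an bn]] : a < x < b.
      rewrite !lt_neqAle ax xb !andbT; apply/andP; split; apply/eqP => E.
        by move: fy; rewrite -fx E ltxx.
      by move: yf; rewrite -fx E ltxx.
    exists n; have [*] := lab n; rewrite -fx.
    by rewrite !finc_le// ltW.
- rewrite (_ : (fun n => _) = (fun n => \int[mu]_(x in `[a_ n, b_ n]) (g (f x) * df x)%:E)%E).
    apply: cvr => //.
    + by move=> x xab; apply: continuousM; [exact: (cgf fab cg)|exact: cdf].
    + by move=> x xab; rewrite mulr_ge0//; [apply/g0/fab|apply/ltW/df0].
    + by move=> n; have [] := lab n.
    + by move=> n; have [] := lab n.
  apply/funext => n; have [h1 h2 h3] := lab n.
  apply: (@integral_subst_cc_incr f df g a b) => //.
  move=> y /andP[h4 h5]; apply: cg; apply/andP; split.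
    by apply: lt_le_trans h4; rewrite finc// ltW// (lt_trans h2).
  by apply: (le_lt_trans h5); rewrite finc// ltW// (lt_trans h1).
Qed.

Lemma ge0_integral_subst_decr :
  (forall x, a < x < b -> df x < 0) ->
  (forall y, f b < y < f a -> {for y, continuous g}) ->
  (forall y, f b < y < f a -> 0 <= g y) ->
  (\int[mu]_(y in `]f b, f a[) (g y)%:E =
   \int[mu]_(x in `]a, b[) (g (f x) * - df x)%:E)%E.
Proof.
move=> df0 cg g0.
have fdec := neg_derive_lt cf dfE df0.
have fab x : a < x < b -> f b < f x < f a.
  by move=> /andP[ax xb]; rewrite !fdec// ltW.
have fdec_le x y : a <= x -> x <= y -> y <= b -> f y <= f x.
  move=> ax; rewrite le_eqVlt => /predU1P[->//|xy] yb.
  by rewrite ltW// fdec.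
have [a_ [b_ [lab da ib ex]]] := shrink_bounds ab.
have /= cvr := @cvg_integral_itv_oo (fun x => g (f x) * - df x) a_ b_ a b.
have /= cvl := @cvg_integral_itv_oo g (f \o b_) (f \o a_) (f b) (f a) cg g0.
apply: (@cvg_unique _ _ (\int[mu]_(y in `[f (b_ n), f (a_ n)]) (g y)%:E @[n --> \oo])%E).
- exact: ereal_hausdorff.
- apply: cvl.
  + by move=> n; have [h1 h2 h3] := lab n; rewrite fdec// ltW// (lt_trans h1).
  + by move=> n; have [h1 h2 h3] := lab n; rewrite fdec// ltW// (lt_trans h2).
  + move=> n; have [h1 h2 h3] := lab n; have [? ? ?] := lab n.+1.
    by apply: fdec_le => //; rewrite ltW// (lt_trans h1).
  + move=> n; have [h1 h2 h3] := lab n; have [? ? ?] := lab n.+1.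
    by apply: fdec_le => //; rewrite ltW// (lt_trans h2).
  + move=> y /andP[fy yf].
    have [|x] := @IVT R f a b y (ltW ab) wcf.
      by rewrite ge_min le_max (ltW fy) (ltW yf) orbT.
    rewrite in_itv/= => /andP[ax xb] fx.
    have /ex[n /andP[an bn]] : a < x < b.
      rewrite !lt_neqAle ax xb !andbT; apply/andP; split; apply/eqP => E.
        by move: yf; rewrite -fx E ltxx.
      by move: fy; rewrite -fx E ltxx.
    exists n; have [*] := lab n; rewrite -fx.
    by rewrite !fdec_le// ltW.
- rewrite (_ : (fun n => _) = (fun n => \int[mu]_(x in `[a_ n, b_ n]) (g (f x) * - df x)%:E)%E).
    apply: cvr => //.
    + move=> x xab; apply: continuousM; [exact: (cgf fab cg)|].
      by apply: continuousN; exact: cdf.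
    + by move=> x xab; rewrite mulr_ge0//; [apply/g0/fab|rewrite oppr_ge0; apply/ltW/df0].
    + by move=> n; have [] := lab n.
    + by move=> n; have [] := lab n.
  apply/funext => n; have [h1 h2 h3] := lab n.
  apply: (@integral_subst_cc_decr f df g a b) => //.
  move=> y /andP[h4 h5]; apply: cg; apply/andP; split.
    by apply: lt_le_trans h4; rewrite fdec// ltW// (lt_trans h1).
  by apply: (le_lt_trans h5); rewrite fdec// ltW// (lt_trans h2).
Qed.

End open_subst.

End calculus.

(** * Elliptic weights and their transformation *)

Section elliptic_integrals.
Context {R : realType}.
Implicit Types (f df : R -> R) (a b c l x y z : R).
Local Notation mu := (@lebesgue_measure R).

Definition ellq l x : R := (1 - x ^+ 2) * (x ^+ 2 - l ^+ 2).
(** The absolute value lets one weight serve both complete integrals: over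
    ]0, l[ it gives K(l), over ]l, 1[ it gives K(sqrt(1 - l^2)). *)
Definition ellw l x : R := (Num.sqrt `|ellq l x|)^-1.
Definition ellJ l a b : \bar R := (\int[mu]_(x in `]a, b[) (ellw l x)%:E)%E.

Lemma ellw_ge0 l x : 0 <= ellw l x.
Proof. by rewrite invr_ge0 sqrtr_ge0. Qed.

Lemma ellq_continuous l : continuous (ellq l).
Proof.
move=> x; rewrite /ellq; apply: cvgM; apply: cvgB; try exact: cvg_cst;
  exact: exprn_continuous.
Qed.

Lemma ellw_continuous l x : ellq l x != 0 -> {for x, continuous (ellw l)}.
Proof.
move=> q0; apply: continuousV; first by rewrite sqrtr_eq0 -ltNge normr_gt0.
apply: continuous_comp; last exact: sqrt_continuous.
by apply: continuous_comp; [exact: ellq_continuous|exact: norm_continuous].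
Qed.

Lemma ellq_neq0_in l x : 0 < l -> -l < x < l -> l < 1 -> ellq l x != 0.
Proof.
move=> l0 /andP[lx xl] l1; rewrite mulf_neq0//.
  by rewrite subr_eq0 eq_sym neq_lt; apply/orP; left; nra.
by rewrite subr_eq0 neq_lt; apply/orP; left; nra.
Qed.

Lemma ellq_neq0_out l x : 0 < l -> l < x < 1 -> ellq l x != 0.
Proof.
move=> l0 /andP[lx x1]; rewrite mulf_neq0//.
  by rewrite subr_eq0 eq_sym neq_lt; apply/orP; left; nra.
by rewrite subr_eq0 eq_sym neq_lt; apply/orP; left; nra.
Qed.

Lemma ellw_measurable l a b : (forall x, a < x < b -> ellq l x != 0) ->
  measurable_fun `]a, b[ (EFin \o ellw l).
Proof.
move=> q0; apply: itv_oo_measurable_fun => x /q0; exact: ellw_continuous.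
Qed.

Lemma ellJ_ge0 l a b : (0 <= ellJ l a b)%E.
Proof. by apply: integral_ge0 => x _; rewrite lee_fin ellw_ge0. Qed.

Lemma ell_scale (c u q1 q2 : R) : 0 < c -> 0 < q1 -> 0 < q2 -> 0 < u ->
  u ^+ 2 * q1 = c ^+ 2 * q2 -> (Num.sqrt q2)^-1 * u = c * (Num.sqrt q1)^-1.
Proof.
move=> c0 q10 q20 u0 /(congr1 Num.sqrt).
rewrite sqrtrM ?sqr_ge0// sqrtr_sqr (sqrtrM q2 (sqr_ge0 c)) sqrtr_sqr !gtr0_norm// => E.
have s1 : Num.sqrt q1 != 0 by rewrite gt_eqF// sqrtr_gt0.
have s2 : Num.sqrt q2 != 0 by rewrite gt_eqF// sqrtr_gt0.
by apply/eqP; rewrite mulrC eqr_div// E.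
Qed.

(** The relation between the derivative of f and the two quartics says that f
    pulls the weight of modulus z back to c times the weight of modulus l, so
    this is a change of variables. *)
Lemma ellJ_subst_incr f df l z a b c : 0 < c -> a < b ->
  (forall x, a <= x <= b -> {for x, continuous f}) ->
  (forall x, a < x < b -> is_derive x 1 f (df x)) ->
  (forall x, a < x < b -> {for x, continuous df}) ->
  (forall x, a < x < b -> 0 < df x) ->
  (forall x, a < x < b -> ellq l x != 0) ->
  (forall y, f a < y < f b -> ellq z y != 0) ->
  (forall x, a < x < b ->
    df x ^+ 2 * `|ellq l x| = c ^+ 2 * `|ellq z (f x)|) ->
  ellJ z (f a) (f b) = (c%:E * ellJ l a b)%E.
Proof.
move=> c0 ab cf dfE cdf df0 ql qz E.
have fab x : a < x < b -> f a < f x < f b.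
  have finc := pos_derive_lt cf dfE df0.
  by move=> /andP[ax xb]; rewrite !finc// ltW.
rewrite /ellJ (ge0_integral_subst_incr ab cf dfE cdf df0); first last.
- by move=> y _; exact: ellw_ge0.
- by move=> y /qz; exact: ellw_continuous.
rewrite -ge0_integralZl//; last 3 first.
- exact: ellw_measurable.
- by move=> x _; rewrite lee_fin ellw_ge0.
- by rewrite lee_fin ltW.
apply: eq_integral => x; rewrite inE/= in_itv/= => xab; rewrite -EFinM.
congr (_%:E); apply: ell_scale => //; rewrite ?normr_gt0; [exact: ql| |exact: df0|exact: E].
by apply: qz; exact: fab.
Qed.

Lemma ellJ_subst_decr f df l z a b c : 0 < c -> a < b ->
  (forall x, a <= x <= b -> {for x, continuous f}) ->
  (forall x, a < x < b -> is_derive x 1 f (df x)) ->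
  (forall x, a < x < b -> {for x, continuous df}) ->
  (forall x, a < x < b -> df x < 0) ->
  (forall x, a < x < b -> ellq l x != 0) ->
  (forall y, f b < y < f a -> ellq z y != 0) ->
  (forall x, a < x < b ->
    df x ^+ 2 * `|ellq l x| = c ^+ 2 * `|ellq z (f x)|) ->
  ellJ z (f b) (f a) = (c%:E * ellJ l a b)%E.
Proof.
move=> c0 ab cf dfE cdf df0 ql qz E.
have fab x : a < x < b -> f b < f x < f a.
  have fdec := neg_derive_lt cf dfE df0.
  by move=> /andP[ax xb]; rewrite !fdec// ltW.
rewrite /ellJ (ge0_integral_subst_decr ab cf dfE cdf df0); first last.
- by move=> y _; exact: ellw_ge0.
- by move=> y /qz; exact: ellw_continuous.
rewrite -ge0_integralZl//; last 3 first.
- exact: ellw_measurable.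
- by move=> x _; rewrite lee_fin ellw_ge0.
- by rewrite lee_fin ltW.
apply: eq_integral => x; rewrite inE/= in_itv/= => xab; rewrite -EFinM.
congr (_%:E); apply: ell_scale => //; rewrite ?normr_gt0 ?oppr_gt0 ?sqrrN;
  [exact: ql| |exact: df0|exact: E].
by apply: qz; exact: fab.
Qed.

Lemma ellJ_split l a b c : a < b -> b < c ->
  (forall x, a < x < b -> ellq l x != 0) ->
  (forall x, b < x < c -> ellq l x != 0) ->
  ellJ l a c = (ellJ l a b + ellJ l b c)%E.
Proof.
move=> ab bc q1 q2; rewrite /ellJ.
rewrite (_ : `]a, c[%classic = `]a, b]%classic `|` `]b, c[%classic); last first.
  by rewrite -itv_bndbnd_setU// bnd_simp ltW.
rewrite ge0_integral_setU//=.
- congr (_ + _)%E; rewrite integral_itv_bndoo//; exact: ellw_measurable.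
- apply/measurable_funU => //; split; last exact: ellw_measurable.
  by apply/emeasurable_fun_itv_bndo_bndcP; exact: ellw_measurable.
- by move=> x _; rewrite lee_fin ellw_ge0.
- apply/disj_setPS => x [/=]; rewrite !in_itv/= => /andP[_ xb] /andP[bx _].
  by move: (lt_le_trans bx xb); rewrite ltxx.
Qed.

End elliptic_integrals.

(** * Complete elliptic integrals *)

Section complete_integral.
Context {R : realType}.
Implicit Types (l t x y : R).
Local Notation mu := (@lebesgue_measure R).

Definition ellk l t : R := (Num.sqrt ((1 - t ^+ 2) * (1 - l ^+ 2 * t ^+ 2)))^-1.

Lemma ellk_gt0 l t : 0 < l < 1 -> 0 <= t < 1 ->
  0 < (1 - t ^+ 2) * (1 - l ^+ 2 * t ^+ 2).
Proof.
move=> /andP[l0 l1] /andP[t0 t1].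
have t2 : t ^+ 2 < 1 by rewrite expr_lt1.
have l2 : l ^+ 2 < 1 by rewrite expr_lt1// ltW.
rewrite mulr_gt0 ?subr_gt0//.
by rewrite (le_lt_trans _ l2)// ler_piMr ?sqr_ge0// ltW.
Qed.

Lemma ellk_continuous l t : 0 < l < 1 -> 0 <= t < 1 ->
  {for t, continuous (ellk l)}.
Proof.
move=> l01 t01; apply: continuousV.
  by rewrite sqrtr_eq0 -ltNge ellk_gt0.
apply: continuous_comp; last exact: sqrt_continuous.
apply: cvgM; apply: cvgB; try exact: cvg_cst; first exact: exprn_continuous.
by apply: cvgM; [exact: cvg_cst|exact: exprn_continuous].
Qed.

Lemma ellk_ge0 l t : 0 <= ellk l t.
Proof. by rewrite invr_ge0 sqrtr_ge0. Qed.

Lemma one_sub_sin2_ge l t : 0 < l < 1 ->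
  0 < 1 - l ^+ 2 <= 1 - l ^+ 2 * sin t ^+ 2.
Proof.
move=> /andP[l0 l1]; apply/andP; split; first by rewrite subr_gt0 expr_lt1// ltW.
rewrite lerD2l lerN2.
by rewrite ler_piMr ?sqr_ge0// sin2cos2 lerBlDr lerDl sqr_ge0.
Qed.

(** The substitution t = sin x removes the singularity at t = 1, which makes
    both finiteness and two-sided bounds evident. *)
Lemma ellk_trig l : 0 < l < 1 ->
  (\int[mu]_(t in `]0%R, 1%R[) (ellk l t)%:E =
   \int[mu]_(t in `]0%R, (pi / 2)%R[) ((Num.sqrt (1 - l ^+ 2 * sin t ^+ 2))^-1)%:E)%E.
Proof.
move=> l01.
have pi20 : 0 < pi / 2 :> R by rewrite divr_gt0// pi_gt0.
have cos0 (x : R) : 0 < x < pi / 2 -> 0 < cos x.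
  by move=> /andP[x0 x1]; rewrite cos_gt0_pihalf// x1 andbT (lt_trans _ x0)// oppr_lt0.
have H := @ge0_integral_subst_incr R sin cos (ellk l) 0 (pi / 2) pi20.
rewrite sin0 sin_pihalf in H; rewrite H.
- apply: eq_integral => x; rewrite inE/= in_itv/= => x0; congr (_%:E).
  have c0 := cos0 _ x0.
  have r0 : 0 <= 1 - l ^+ 2 * sin x ^+ 2.
    by have /andP[/ltW] := one_sub_sin2_ge x l01; exact: le_trans.
  rewrite /ellk -cos2sin2 sqrtrM ?sqr_ge0// sqrtr_sqr gtr0_norm// invfM mulrC.
  by rewrite mulrA mulfV ?mul1r// gt_eqF.
- by move=> x _; exact: continuous_sin.
- by move=> x _; exact: continuous_cos.
- exact: cos0.
- by move=> y /andP[y0 y1]; apply: ellk_continuous => //; rewrite ltW.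
- by move=> y _; exact: ellk_ge0.
Qed.

Lemma integral_cst_oo (a b c : R) : a <= b ->
  (\int[mu]_(x in `]a, b[) c%:E = (c * (b - a))%:E)%E.
Proof.
move=> ab; rewrite integral_cst//= lebesgue_measure_itv/= lte_fin EFinM.
by case: ltP => // ba; rewrite (_ : b - a = 0)//; apply/eqP; rewrite subr_eq0 eq_le ab ba.
Qed.

Lemma ellk_bounds l : 0 < l < 1 ->
  ((pi / 2)%:E <= \int[mu]_(t in `]0%R, 1%R[) (ellk l t)%:E <=
   (pi / 2 / Num.sqrt (1 - l ^+ 2))%:E)%E.
Proof.
move=> l01; rewrite ellk_trig//.
have pi20 : 0 <= pi / 2 :> R by rewrite divr_ge0// pi_ge0.
have l2 : 0 < 1 - l ^+ 2.
  by have /andP[] := one_sub_sin2_ge 0 l01.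
have l2s t : 0 < 1 - l ^+ 2 * sin t ^+ 2.
  by have /andP[] := one_sub_sin2_ge t l01; exact: lt_le_trans.
have m : measurable_fun `]0, (pi / 2)[
    (EFin \o (fun t : R => (Num.sqrt (1 - l ^+ 2 * sin t ^+ 2))^-1)).
  apply: itv_oo_measurable_fun => t _; apply: continuousV.
    by rewrite sqrtr_eq0 -ltNge.
  apply: continuous_comp; last exact: sqrt_continuous.
  apply: cvgB; first exact: cvg_cst.
  apply: cvgM; first exact: cvg_cst.
  by apply: (@continuous_comp _ _ _ sin (fun x => x ^+ 2)); [exact: continuous_sin|exact: exprn_continuous].
apply/andP; split.
  rewrite -[X in (X%:E <= _)%E]mul1r -[X in (_ * X)%R]subr0 -integral_cst_oo//.
  apply: ge0_le_integral => //=.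
  move=> x _; rewrite lee_fin invf_ge1 ?sqrtr_gt0//.
  rewrite -[leRHS]sqrtr1 ler_wsqrtr// lerBlDr lerDl.
  by rewrite mulr_ge0 ?sqr_ge0.
rewrite (_ : pi / 2 / _ = (Num.sqrt (1 - l ^+ 2))^-1 * (pi / 2 - 0)); last first.
  by rewrite subr0 mulrC.
rewrite -integral_cst_oo//.
apply: ge0_le_integral => //=.
move=> x _; rewrite lee_fin lef_pV2 ?posrE ?sqrtr_gt0//.
by rewrite ler_wsqrtr//; have /andP[] := one_sub_sin2_ge x l01.
Qed.

Lemma ellipticKE l : 0 < l < 1 ->
  (ellipticK l)%:E = (\int[mu]_(t in `]0%R, 1%R[) (ellk l t)%:E)%E.
Proof.
move=> l01; have /andP[h1 h2] := ellk_bounds l01.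
rewrite /ellipticK /Rintegral integral_itv_bndoo; last first.
  apply: itv_oo_measurable_fun => t /andP[t0 t1].
  by apply: ellk_continuous => //; rewrite ltW.
rewrite fineK// ge0_fin_numE; first exact: le_lt_trans h2 (ltry _).
by apply: le_trans h1; rewrite lee_fin divr_ge0// pi_ge0.
Qed.

Lemma ellipticK_bounds l : 0 < l < 1 ->
  pi / 2 <= ellipticK l <= pi / 2 / Num.sqrt (1 - l ^+ 2).
Proof. by move=> l01; rewrite -2!lee_fin ellipticKE// ellk_bounds. Qed.

Lemma ellipticK_gt0 l : 0 < l < 1 -> 0 < ellipticK l.
Proof.
by move=> /ellipticK_bounds/andP[+ _]; apply: lt_le_trans; rewrite divr_gt0// pi_gt0.
Qed.

(** The substitution t = x / l. *)
Lemma ellJ_ellipticK l : 0 < l < 1 -> ellJ l 0 l = (ellipticK l)%:E.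
Proof.
move=> l01; have /andP[l0 l1] := l01; rewrite ellipticKE//.
have H := @ge0_integral_subst_incr R (fun x => l^-1 * x) (fun=> l^-1) (ellk l) 0 l l0.
rewrite mulr0 mulVf ?gt_eqF// in H.
have dfE (x : R) : 0 < x < l -> is_derive x 1 (fun x : R => l^-1 * x) l^-1.
  by move=> _; apply: is_derive_eq; rewrite /GRing.scale/= mulr1.
rewrite (H _ dfE).
- apply: eq_integral => x; rewrite inE/= in_itv/= => /andP[x0 xl]; congr (_%:E).
  rewrite /ellw /ellk -[in RHS](gtr0_norm l0) -(sqrtr_sqr l) -invfM -sqrtrM.
    congr (Num.sqrt _)^-1; rewrite /ellq normrM (_ : `|1 - x ^+ 2| = 1 - x ^+ 2); last first.
      by rewrite ger0_norm// subr_ge0 expr_le1// ltW// (lt_trans xl).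
    rewrite (_ : `|x ^+ 2 - l ^+ 2| = l ^+ 2 - x ^+ 2); last first.
      by rewrite distrC ger0_norm// subr_ge0 ler_pXn2r ?nnegrE ?ltW.
    by rewrite sqrtr_sqr gtr0_norm//; field; rewrite gt_eqF.
  rewrite sqrtr_sqr gtr0_norm// ltW// ellk_gt0// mulrC.
  rewrite ltr_pdivrMr// mul1r xl andbT divr_ge0// ltW//.
- by move=> x _; apply: cvgM; [exact: cvg_cst|exact: cvg_id].
- by move=> x _; exact: cvg_cst.
- by move=> x _; rewrite invr_gt0.
- by move=> y /andP[y0 y1]; apply: ellk_continuous => //; rewrite ltW.
- by move=> y _; exact: ellk_ge0.
Qed.

Lemma compl_modulus l : 0 < l < 1 -> 0 < Num.sqrt (1 - l ^+ 2) < 1 /\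
  Num.sqrt (1 - l ^+ 2) ^+ 2 = 1 - l ^+ 2.
Proof.
move=> /andP[l0 l1].
have l2 : 0 < 1 - l ^+ 2 by rewrite subr_gt0 expr_lt1// ltW.
rewrite sqr_sqrtr ?ltW//; split=> //; rewrite sqrtr_gt0 l2/=.
by rewrite -[ltRHS]sqrtr1 ltr_sqrt// ltrBlDr ltrDl exprn_gt0.
Qed.

(** The substitution t = sqrt(1 - x^2) / sqrt(1 - l^2), which exchanges the
    two ends. *)
Lemma ellJ_ellipticK' l : 0 < l < 1 ->
  ellJ l l 1 = (ellipticK (Num.sqrt (1 - l ^+ 2)))%:E.
Proof.
move=> l01; have /andP[l0 l1] := l01.
have [m01 m2] := compl_modulus l01; have /andP[m0 m1] := m01.
rewrite ellipticKE//; set m := Num.sqrt _ in m01 m0 m1 m2 *.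
pose f x := m^-1 * Num.sqrt (1 - x ^+ 2).
pose df x := - (m^-1 * (x / Num.sqrt (1 - x ^+ 2))).
have r0 x : l < x < 1 -> 0 < 1 - x ^+ 2.
  by move=> /andP[lx x1]; rewrite subr_gt0 expr_lt1// ltW// (lt_trans l0).
have H := @ge0_integral_subst_decr R f df (ellk m) l 1 l1.
have f1 : f 1 = 0 by rewrite /f expr1n subrr sqrtr0 mulr0.
rewrite f1 in H.
rewrite (_ : f l = 1) in H; last by rewrite /f -/m mulVf// gt_eqF.
have csq x : {for x, continuous (fun x : R => 1 - x ^+ 2)}.
  by apply: cvgB; [exact: cvg_cst|exact: exprn_continuous].
have dfE x : l < x < 1 -> is_derive x 1 f (df x).
  move=> /r0 r; rewrite /f.
  have ds : is_derive x 1 (fun x : R => 1 - x ^+ 2) (- (2 * x)).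
    by apply: is_derive_eq; rewrite /GRing.scale/=; ring.
  have dss := @is_derive1_comp R Num.sqrt _ x _ _ (is_derive1_sqrt r) ds.
  have dsz := @is_deriveZ R R^o R^o _ m^-1 x 1 _ dss.
  apply: (@is_derive_eq R R^o R^o _ _ _ _ _ dsz); rewrite /GRing.scale/= /df.
  by field; apply/andP; split; rewrite gt_eqF// sqrtr_gt0.
rewrite (H _ dfE).
- apply: eq_integral => x; rewrite inE/= in_itv/= => lx; congr (_%:E).
  have r := r0 _ lx; have /andP[xl x1] := lx.
  have x0 : 0 < x by exact: lt_trans xl.
  have xx : 0 < x ^+ 2 - l ^+ 2 by rewrite subr_gt0 ltr_pXn2r ?nnegrE ?ltW.
  rewrite /df opprK /ellk /ellw.
  have -> : (1 - f x ^+ 2) * (1 - m ^+ 2 * f x ^+ 2) = (m^-1 * x)^+2 * (x ^+ 2 - l ^+ 2).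
    rewrite /f !exprMn sqr_sqrtr ?ltW// !exprVn m2; field.
    by rewrite -m2 expf_neq0// gt_eqF.
  have mx : 0 < m^-1 * x by rewrite mulr_gt0 ?invr_gt0.
  rewrite sqrtrM ?sqr_ge0// sqrtr_sqr (gtr0_norm mx) /ellq.
  rewrite (gtr0_norm (mulr_gt0 r xx)).
  rewrite (sqrtrM _ (ltW r)).
  by field; rewrite !(gt_eqF m0, gt_eqF x0) !gt_eqF ?sqrtr_gt0.
- move=> x _; apply: cvgM; first exact: cvg_cst.
  by apply: continuous_comp; [exact: csq|exact: sqrt_continuous].
- move=> x /r0 r; apply: continuousN; apply: cvgM; first exact: cvg_cst.
  apply: cvgM; first exact: cvg_id.
  apply: cvgV; first by rewrite gt_eqF// sqrtr_gt0.
  by apply: continuous_comp; [exact: csq|exact: sqrt_continuous].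
- move=> x lx; rewrite oppr_lt0 mulr_gt0 ?invr_gt0// divr_gt0 ?sqrtr_gt0 ?r0//.
  by case/andP: lx => + _; exact: lt_trans.
- by move=> y /andP[y0 y1]; apply: ellk_continuous => //; rewrite ltW.
- by move=> y _; exact: ellk_ge0.
Qed.

End complete_integral.

(** * The elliptic amplitude *)

Section amplitude.
Context {R : realType}.
Implicit Types (f F : R -> R) (t u v x y : R).
Local Notation mu := (@lebesgue_measure R).

(** The integrals from -n are primitives on ]-n, +oo[ only. Normalized to
    vanish at 0 they agree on common domains, so they glue to a primitive on
    the whole line. *)
Lemma continuous_primitive f : continuous f ->
  exists F, forall x, is_derive x 1 F (f x).
Proof.
move=> cf.
have intf (a b : R) : mu.-integrable `[a, b] (EFin \o f).
  apply: continuous_compact_integrable; first exact: segment_compact.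
  exact: continuous_subspaceT.
pose I a x := (\int[mu]_(t in `[a, x]) f t)%R.
have dI a x : a < x -> is_derive x 1 (I a) (f x).
  move=> ax; have xx : x < x + 1 by rewrite ltrDl.
  have [d1 d2] := @continuous_FTC1_closed R f a x _ xx (intf _ _) ax (cf x).
  by apply: DeriveDef; [exact: d1|rewrite -derive1E; exact: d2].
pose P n x := I (- n%:R) x - I (- n%:R) 0.
have dP n x : - n%:R < x -> is_derive x 1 (P n) (f x).
  move=> nx; have dIx := dI _ _ nx.
  by apply: is_derive_eq; rewrite subr0.
have PP n k x : (0 < k <= n)%N -> - k%:R < x -> P n x = P k x.
  move=> /andP[k0 kn] kx.
  have kn' : - n%:R <= - k%:R :> R by rewrite lerN2 ler_nat.
  have k00 : - k%:R < 0 :> R by rewrite oppr_lt0 ltr0n.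
  have chasles y : - k%:R < y -> I (- n%:R) y = I (- n%:R) (- k%:R) + I (- k%:R) y.
    move=> ky; rewrite /I.
    have := @Rintegral_itvB R f (BLeft (- n%:R)) (BRight y) (- k%:R).
    rewrite Rintegral_itv_obnd_cbnd; last first.
      apply: (integrableS _ _ _ (intf (- k%:R) y)) => // z /=.
      by rewrite !in_itv/= => /andP[/ltW -> ->].
    move=> /(_ (intf _ _)) H; rewrite -H; first by ring.
      by rewrite bnd_simp.
    by rewrite bnd_simp ltW.
  by rewrite /P (chasles x kx) (chasles 0 k00) opprD addrACA subrr add0r.
pose F x := P (Num.trunc `|x|).+1 x.
exists F => x.
pose n := (Num.trunc `|x|).+1.
have xn : `|x| < n%:R by exact: truncnS_gt.
have near_eq : \forall y \near x, P n y = F y.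
  have : \forall y \near x, `|y| < n%:R.
    have := @norm_continuous _ R x => /cvgr_lt; apply; exact: xn.
  apply: filterS => y yn; rewrite /F; apply: PP.
    by rewrite /= -[(_ < n)%N]/(_ <= n.-1)%N truncn_le_nat.
  by rewrite ltrNl (le_lt_trans (ler_norm _))// normrN truncnS_gt.
apply: near_eq_is_derive near_eq _; apply: dP.
by rewrite ltrNl (le_lt_trans (ler_norm _))// normrN.
Qed.

(** The amplitude is the inverse of the incomplete integral G of the first
    kind. The derivative of G is even and pi-periodic, so that G is odd and
    G(x + pi) = G(x) + G(pi); both properties pass to the inverse. *)
Lemma elliptic_amplitude (k : R) : 0 < k < 1 ->
  exists (am : R -> R) T, [/\ 0 < T, am 0 = 0, am T = pi / 2,
    forall t, is_derive t 1 am (Num.sqrt (1 - k ^+ 2 * sin (am t) ^+ 2)) &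
    (forall t, am (- t) = - am t) /\ (forall t, am (t + 2 * T) = am t + pi)].
Proof.
move=> k01.
pose D x := Num.sqrt (1 - k ^+ 2 * sin x ^+ 2).
have D2 x : 0 < 1 - k ^+ 2 * sin x ^+ 2 <= 1.
  apply/andP; split; last by rewrite lerBlDr lerDl mulr_ge0 ?sqr_ge0.
  case/andP: k01 => k0 k1; rewrite (@lt_le_trans _ _ (1 - k ^+ 2))//.
    by rewrite subr_gt0 expr_lt1// ltW.
  by rewrite lerD2l lerN2 ler_piMr ?sqr_ge0// sin2cos2 lerBlDr lerDl.
have D0 x : 0 < D x by rewrite sqrtr_gt0; have /andP[] := D2 x.
have D1 x : D x <= 1.
  by rewrite -[leRHS]sqrtr1 ler_wsqrtr//; have /andP[] := D2 x.
have cDV : continuous (fun x => (D x)^-1).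
  move=> x; apply: cvgV; first by rewrite gt_eqF.
  apply: continuous_comp; last exact: sqrt_continuous.
  apply: cvgB; first exact: cvg_cst.
  apply: cvgM; first exact: cvg_cst.
  apply: (@continuous_comp _ _ _ sin (fun x => x ^+ 2)).
    exact: continuous_sin.
  exact: exprn_continuous.
have [F dF] := continuous_primitive cDV.
pose G x := F x - F 0.
have dG x : is_derive x 1 G (D x)^-1.
  have := dF x => dFx; have H := is_deriveB dFx (is_derive_cst (F 0) x 1).
  by rewrite subr0 in H.
have cG x : {for x, continuous G} by exact: is_derive_continuous (dG x).
have G0 : G 0 = 0 by rewrite /G subrr.
have Ginc x y : x < y -> y - x <= G y - G x.
  move=> xy; have [z|z _ ->] := @MVT R G (fun x => (D x)^-1) x y xy (fun z _ => dG z).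
  - by apply: continuous_subspaceT => w; exact: cG.
  - by rewrite ler_peMl ?subr_ge0 ?(ltW xy)// invf_ge1.
have Glt x y : x < y -> G x < G y.
  by move=> xy; rewrite -subr_gt0 (lt_le_trans _ (Ginc _ _ xy))// subr_gt0.
have Ginj : injective G.
  by move=> x y E; case: (ltgtP x y) => // /Glt; rewrite E ltxx.
have Gsurj t : exists x, G x = t.
  pose A := `|t| + 1.
  have A0 : 0 < A by rewrite ltr_wpDl.
  have := @IVT R G (- A) A t; case.
  - by rewrite (le_trans _ (ltW A0))// oppr_le0 ltW.
  - by apply: continuous_subspaceT => w; exact: cG.
  - have h1 := Ginc _ _ A0; rewrite G0 !subr0 in h1.
    have NA0 : - A < 0 by rewrite oppr_lt0.
    have h2 := Ginc _ _ NA0; rewrite G0 !sub0r opprK in h2.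
    have tA : `|t| <= A by rewrite /A lerDl.
    rewrite ge_min le_max; apply/andP; split; apply/orP; [left|right].
      by rewrite lerNr in h2; rewrite (le_trans h2)// lerNl (le_trans (ler_norm _))// normrN.
    by rewrite (le_trans (ler_norm _))// (le_trans tA).
  - by move=> x _ E; exists x.
pose am t := sval (cid (Gsurj t)).
have amK t : G (am t) = t by rewrite /am; case: cid.
have GK x : am (G x) = x by apply: Ginj; rewrite amK.
have dam t : is_derive t 1 am (D (am t)).
  have H := @is_derive_inverse R G am (D (am t))^-1 (am t).
  rewrite amK invrK in H; apply: H => //.
  - by exists 1 => //= x _; exact: GK.
  - by exists 1 => //= x _; exact: cG.
  - by rewrite gt_eqF// invr_gt0.
have Godd x : G (- x) = - G x.
  apply/eqP; rewrite -addr_eq0; apply/eqP.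
  have <- : G (- 0) + G 0 = 0 by rewrite oppr0 G0 addr0.
  apply: (@is_derive0_cst R (fun x => G (- x) + G x)) => y.
  have dN : is_derive y 1 (fun y : R => - y) (-1).
    by have := is_deriveN (is_derive_id y (1:R)).
  have dGN := @is_derive1_comp R G _ y _ _ (dG (- y)) dN.
  have H := is_deriveD dGN (dG y).
  have E : (D (- y))^-1 * -1 + (D y)^-1 = 0.
    by rewrite /D sinN sqrrN mulrN1 addNr.
  by rewrite E in H.
have Gper x : G (x + pi) = G x + G pi.
  apply/eqP; rewrite [eqbRHS]addrC -subr_eq; apply/eqP.
  transitivity (G (0 + pi) - G 0); last by rewrite G0 subr0 add0r.
  apply: (@is_derive0_cst R (fun x => G (x + pi) - G x)) => y.
  have dN : is_derive y 1 (fun y : R => y + pi) 1.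
    have H := is_deriveD (is_derive_id y (1:R)) (is_derive_cst (pi : R) y (1:R)).
    by rewrite addr0 in H.
  have dGN := @is_derive1_comp R G _ y _ _ (dG (y + pi)) dN.
  have H := is_deriveB dGN (dG y).
  have E : (D (y + pi))^-1 * 1 - (D y)^-1 = 0.
    by rewrite /D sinDpi sqrrN mulr1 subrr.
  by rewrite E in H.
have G2 : G pi = 2 * G (pi / 2).
  have := Gper (- (pi / 2)); rewrite Godd.
  have -> : - (pi / 2) + pi = pi / 2 :> R by field.
  by move=> E; rewrite mulr_natl mulr2n {1}E addrAC addNr add0r.
exists am, (G (pi / 2)); split.
- by rewrite -G0 Glt// divr_gt0// pi_gt0.
- by rewrite -[in LHS]G0 GK.
- exact: GK.
- exact: dam.
- split=> t; apply: Ginj; rewrite amK.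
  + by rewrite Godd amK.
  + by rewrite -G2 Gper amK.
Qed.

End amplitude.

(** * The elliptic sine and its addition theorem *)

Section sine.
Context {R : realType}.
Implicit Types (t u v x y : R).

(** With am the amplitude of modulus m^2, take S = m sin(am). The factor m
    makes the quartic C^2 = (m^2 - S^2) (1 - m^2 S^2) palindromic, which puts
    the addition theorem in its symmetric form. *)
Lemma elliptic_sine_ode (m : R) : 0 < m < 1 ->
  exists (S C : R -> R) T, [/\ 0 < T, S 0 = 0 /\ C 0 = m, S T = m,
    [/\ forall t, is_derive t 1 S (C t),
     forall t, is_derive t 1 C (- (1 + m ^+ 4) * S t + 2 * m ^+ 2 * S t ^+ 3),
     forall t, C t ^+ 2 = (m ^+ 2 - S t ^+ 2) * (1 - m ^+ 2 * S t ^+ 2),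
     forall t, S t ^+ 2 <= m ^+ 2 & forall t, 0 < t < T -> 0 < C t] &
    [/\ forall t, S (- t) = - S t, forall t, C (- t) = C t &
     forall t, S (t + 2 * T) = - S t]].
Proof.
move=> /andP[m0 m1].
have k01 : 0 < m ^+ 2 < 1 by rewrite exprn_gt0//= expr_lt1// ltW.
have [am [T [T0 am0 amT dam [amN amT2]]]] := elliptic_amplitude k01.
pose D t := Num.sqrt (1 - (m ^+ 2) ^+ 2 * sin (am t) ^+ 2).
have r0 t : 0 < 1 - (m ^+ 2) ^+ 2 * sin (am t) ^+ 2.
  have /andP[h1 h2] := one_sub_sin2_ge (am t) k01; exact: lt_le_trans h2.
have D0 t : 0 < D t by rewrite sqrtr_gt0.
have D2 t : D t ^+ 2 = 1 - m ^+ 4 * sin (am t) ^+ 2.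
  by rewrite sqr_sqrtr ?ltW// -exprM.
pose S t := m * sin (am t); pose C t := m * (cos (am t) * D t).
have dsin t : is_derive t 1 (fun t => sin (am t)) (cos (am t) * D t).
  exact: is_derive_chain (dam t) (is_derive_sin _).
have dcos t : is_derive t 1 (fun t => cos (am t)) (- sin (am t) * D t).
  exact: is_derive_chain (dam t) (is_derive_cos _).
have dr t : is_derive t 1 (fun t => 1 - (m ^+ 2) ^+ 2 * sin (am t) ^+ 2)
    (- (m ^+ 4 * (2 * sin (am t) * cos (am t) * D t))).
  have H := is_deriveB (is_derive_cst (1 : R) t (1 : R))
    (is_derive_mul (is_derive_cst ((m ^+ 2) ^+ 2) t (1 : R))
                   (is_derive_mul (dsin t) (dsin t))).
  apply: (is_derive_eq1 H); rewrite /=; ring.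
have dD t : is_derive t 1 D (- (m ^+ 4 * (sin (am t) * cos (am t)))).
  have H := is_derive_chain (dr t) (is_derive1_sqrt (r0 t)).
  by apply: (is_derive_eq1 H); rewrite -/(D t); field; rewrite gt_eqF.
have dS t : is_derive t 1 S (C t).
  have H := is_derive_mul (is_derive_cst m t (1 : R)) (dsin t).
  by apply: (is_derive_eq1 H); rewrite mul0r add0r.
have CS t : C t ^+ 2 = (m ^+ 2 - S t ^+ 2) * (1 - m ^+ 2 * S t ^+ 2).
  by rewrite /C /S !exprMn D2 cos2sin2; ring.
have S2 t : S t ^+ 2 <= m ^+ 2.
  by rewrite /S exprMn ler_piMr ?sqr_ge0// sin2cos2 lerBlDr lerDl sqr_ge0.
have aminc x y : x < y -> am x < am y.
  move=> xy; apply: (@pos_derive_lt R am D x y) => //.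
  - by move=> z _; exact: is_derive_continuous (dam z).
exists S, C, T; split => //.
- by split; rewrite /S /C /D am0 sin0 ?mulr0// cos0 expr0n/= mulr0 subr0 sqrtr1 !mulr1.
- by rewrite /S amT sin_pihalf mulr1.
- split => //.
  + move=> t; have H := is_derive_mul (is_derive_cst m t (1 : R)) (is_derive_mul (dcos t) (dD t)).
    apply: (is_derive_eq1 H); rewrite /= mul0r add0r /S.
    transitivity (m * (- sin (am t) * D t ^+ 2 - m ^+ 4 * sin (am t) * cos (am t) ^+ 2)).
      by ring.
    by rewrite D2 cos2sin2; ring.
  + move=> t /andP[t0 tT]; rewrite /C !mulr_gt0// cos_gt0_pihalf//.
    rewrite -amT aminc// andbT amT (lt_trans _ (aminc _ _ t0))// am0 oppr_lt0.
    by rewrite divr_gt0// pi_gt0.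
- split=> t.
  + by rewrite /S amN sinN mulrN.
  + by rewrite /C /D amN sinN cosN sqrrN.
  + by rewrite /S amT2 sinDpi mulrN.
Qed.

(** The argument of Euler: along the line u + v = c the right-hand side has
    derivative zero by the differential equations, and at u = 0 it equals
    m S(c). *)
Lemma elliptic_sine_add (m : R) (S C : R -> R) : 0 < m < 1 ->
  S 0 = 0 -> C 0 = m ->
  (forall t, is_derive t 1 S (C t)) ->
  (forall t, is_derive t 1 C (- (1 + m ^+ 4) * S t + 2 * m ^+ 2 * S t ^+ 3)) ->
  (forall t, C t ^+ 2 = (m ^+ 2 - S t ^+ 2) * (1 - m ^+ 2 * S t ^+ 2)) ->
  (forall t, S t ^+ 2 <= m ^+ 2) ->
  forall u v, m * S (u + v) = (S u * C v + S v * C u) / (1 - S u ^+ 2 * S v ^+ 2).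
Proof.
move=> /andP[m0 m1] S0 C0 dS dC CS S2 u v.
have E0 x y : 0 < 1 - S x ^+ 2 * S y ^+ 2.
  rewrite subr_gt0 (le_lt_trans (ler_pM _ _ (S2 x) (S2 y))) ?sqr_ge0//.
  by rewrite mulr_ilt1 ?sqr_ge0// expr_lt1// ltW.
pose c := u + v.
pose A x := (S x * C (c - x) + S (c - x) * C x) / (1 - S x ^+ 2 * S (c - x) ^+ 2).
have -> : m * S (u + v) = A 0.
  by rewrite /A S0 C0 subr0 expr0n/= !mul0r subr0 divr1 add0r mulrC.
have <- : A u = (S u * C v + S v * C u) / (1 - S u ^+ 2 * S v ^+ 2).
  by rewrite /A /c addrAC subrr add0r.
apply: is_derive0_cst => x.
have dc : is_derive x 1 (fun x => c - x) (-1).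
  have H := is_deriveB (is_derive_cst c x (1:R)) (is_derive_id x (1:R)).
  by apply: (is_derive_eq1 H); rewrite sub0r.
have dS' := is_derive_chain dc (dS (c - x)).
have dC' := is_derive_chain dc (dC (c - x)).
have dN := is_deriveD (is_derive_mul (dS x) dC') (is_derive_mul dS' (dC x)).
have dE := is_deriveB (is_derive_cst (1:R) x (1:R))
  (is_derive_mul (is_derive_mul (dS x) (dS x)) (is_derive_mul dS' dS')).
have H := is_derive_div dN dE (lt0r_neq0 (E0 x (c - x))).
apply: (is_derive_eq1 H).
have := CS x; have := CS (c - x).
have := lt0r_neq0 (E0 x (c - x)).
rewrite !fctE /=.
move: (S x) (C x) (S (c - x)) (C (c - x)) => s k s' k' e0 k'2 k2.
apply/eqP; rewrite mulf_eq0; apply/orP; left; apply/eqP.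
transitivity (2 * s * s' * (s' ^+ 2 * k ^+ 2 - s ^+ 2 * k' ^+ 2 + m ^+ 2 * (s ^+ 2 - s' ^+ 2) * (1 - s ^+ 2 * s' ^+ 2))).
  by ring.
by rewrite k2 k'2; ring.
Qed.

(** Multiplying the addition formulas for v and -v eliminates C, and only S
    remains in the product S(u + v) S(u - v). *)
Lemma elliptic_sine (m : R) : 0 < m < 1 ->
  exists (S C : R -> R) T, [/\ 0 < T, S 0 = 0, S T = m,
    [/\ forall t, is_derive t 1 S (C t),
     forall t, 0 < t < T -> 0 < C t & forall t, S t ^+ 2 <= m ^+ 2] &
    [/\ forall t, S (- t) = - S t, forall t, S (t + 2 * T) = - S t &
     forall u v, S (u + v) * S (u - v) =
       (S u ^+ 2 - S v ^+ 2) / (1 - S u ^+ 2 * S v ^+ 2)]].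
Proof.
move=> m01; have [S [C [T [T0 [S0 C0] ST [dS dC CS S2 Cpos] [SN CN ST2]]]]] := elliptic_sine_ode m01.
have add := elliptic_sine_add m01 S0 C0 dS dC CS S2.
have /andP[m0 m1] := m01.
have E0 x y : 0 < 1 - S x ^+ 2 * S y ^+ 2.
  rewrite subr_gt0 (le_lt_trans (ler_pM _ _ (S2 x) (S2 y))) ?sqr_ge0//.
  by rewrite mulr_ilt1 ?sqr_ge0// expr_lt1// ltW.
exists S, C, T; split => //; split => //.
move=> u v.
have e0 := lt0r_neq0 (E0 u v).
have : (m * S (u + v)) * (m * S (u - v)) =
    m ^+ 2 * ((S u ^+ 2 - S v ^+ 2) / (1 - S u ^+ 2 * S v ^+ 2)).
  rewrite !add SN CN sqrrN.
  transitivity ((S u ^+ 2 * C v ^+ 2 - S v ^+ 2 * C u ^+ 2) / (1 - S u ^+ 2 * S v ^+ 2) ^+ 2).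
    by field; rewrite exprMn.
  by rewrite !CS; field; rewrite exprMn.
move=> E; apply: (mulfI (lt0r_neq0 (exprn_gt0 2 m0))); rewrite -E; ring.
Qed.

End sine.

(** * Equioscillating rational functions *)

Section nodes.
Context {R : realType}.
Implicit Types (t u v x y s : R).

(** This turns periodicity of the factors into periodicity of a product of
    equally spaced translates. *)
Lemma cyclic_prod_shift (f : nat -> R) n : f n.+1 = f 0%N ->
  \prod_(0 <= i < n.+1) f i.+1 = \prod_(0 <= i < n.+1) f i.
Proof. by move=> fn; rewrite big_nat_recr//= fn big_nat_recl// mulrC. Qed.

Lemma prod_fold (f : nat -> R) k :
  \prod_(0 <= i < k) (f i * f (k + k - i.+1)%N) = \prod_(0 <= i < k + k) f i.
Proof.
rewrite big_split/= [RHS](big_cat_nat _ (leq_addr k k))//=; congr (_ * _).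
rewrite [RHS](big_addn 0 _ k) addnK [RHS]big_nat_rev/= add0n.
apply: eq_big_nat => i /= ik; congr f; lia.
Qed.

Definition zeros_poly k (c : nat -> R) : {poly R} := \prod_(0 <= j < k) ((c j)%:P - 'X).
Definition poles_poly k (c : nat -> R) : {poly R} := \prod_(0 <= j < k) ((c j)%:P + 'X).
(** The numerator of the derivative of p / q. *)
Definition wronskian (p q : {poly R}) : {poly R} := (p^`() * q - p * q^`())%R.

Lemma horner_zeros_poly k c x : (zeros_poly k c).[x] = \prod_(0 <= j < k) (c j - x).
Proof. by rewrite /zeros_poly horner_prod; apply: eq_bigr => j _; rewrite !hornerE. Qed.

Lemma horner_poles_poly k c x : (poles_poly k c).[x] = \prod_(0 <= j < k) (c j + x).
Proof. by rewrite /poles_poly horner_prod; apply: eq_bigr => j _; rewrite !hornerE. Qed.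

Lemma poles_polyE k c x : (poles_poly k c).[x] = (zeros_poly k c).[- x].
Proof.
by rewrite horner_zeros_poly horner_poles_poly; apply: eq_bigr => j _; rewrite opprK.
Qed.

(** The values of the fraction at the nodes are recorded through their
    squares, and extremality at the inner nodes through critical points. No
    signs are needed, because the sign changes follow from the interlacing of
    the c i with the t i. *)
Record equioscillation (l : R) (k : nat) (c t : nat -> R) (M : R) : Prop :=
  Equioscillation {
    eqo_l : 0 < l;
    eqo_k : (0 < k)%N;
    eqo_t0 : t 0%N = 1;
    eqo_tk : t k = l;
    eqo_M : 0 < M < 1;
    eqo_ct : forall i, (i < k)%N -> t i.+1 < c i < t i;
    eqo_values : forall i, (i <= k)%N ->
      (zeros_poly k c).[t i] ^+ 2 = M ^+ 2 * (poles_poly k c).[t i] ^+ 2;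
    eqo_wronskian : forall i, (0 < i < k)%N ->
      root (wronskian (zeros_poly k c) (poles_poly k c)) (t i) }.

(** The modulus m is chosen so that x = (1 - S^2) / (1 + S^2) equals l at the
    quarter period T. By the addition theorem the square Hf of the fraction,
    as a function of u, is a product of 2k translates of S^2 spaced by T / k,
    so it has period 2d = T / k and is even. It is thus symmetric about every
    multiple of 2d; these correspond to the nodes, which therefore carry equal
    values and critical points. *)
Lemma equioscillation_nodes (l : R) (k : nat) : 0 < l < 1 -> (0 < k)%N ->
  exists (c t : nat -> R) (M : R), equioscillation l k c t M.
Proof.
move=> /andP[l0 l1] k0.
have reflect_node j : (j < k)%N ->
    (k + k - j.+1).*2.+1%:R = 2 * (k + k)%:R - j.*2.+1%:R :> R.
  by move=> jk; apply/eqP; rewrite eq_sym subr_eq -natrM -natrD eqr_nat; apply/eqP; lia.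
have node_lt i : (i < k)%N -> [/\ (i.*2 < i.*2.+1)%N, (i.*2.+1 < i.+1.*2)%N,
    (i.*2.+1 <= k + k)%N & (i.+1.*2 <= k + k)%N].
  by move=> ik; split; lia.
have node_in i : (0 < i < k)%N -> (0 < i.*2 < k + k)%N by lia.
have l1p : 0 < 1 + l by rewrite addr_gt0.
have q0 : 0 < (1 - l) / (1 + l) by rewrite divr_gt0// subr_gt0.
pose m := Num.sqrt ((1 - l) / (1 + l)).
have m2 : m ^+ 2 = (1 - l) / (1 + l) by rewrite sqr_sqrtr// ltW.
have m01 : 0 < m < 1.
  rewrite sqrtr_gt0 q0/= -[ltRHS]sqrtr1 ltr_sqrt// ltr_pdivrMr// mul1r.
  by rewrite ltrD2l; lra.
have [S [C [T [T0 S0 ST [dS C0 S2] [SN ST2 SS]]]]] := elliptic_sine m01.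
pose x u := (1 - S u ^+ 2) / (1 + S u ^+ 2).
have e0 u : 0 < 1 + S u ^+ 2 by rewrite ltr_wpDr ?sqr_ge0.
have xl u : l <= x u.
  rewrite /x ler_pdivlMr//; have := S2 u; rewrite m2 ler_pdivlMr//.
  by move: (S u ^+ 2) => b; lra.
have x_gt0 u : 0 < x u by rewrite (lt_le_trans l0).
have x0 : x 0 = 1 by rewrite /x S0 expr0n/= subr0 addr0 divr1.
have xT : x T = l by rewrite /x ST m2; field; rewrite gt_eqF//=; lra.
have xN u : x (- u) = x u by rewrite /x SN sqrrN.
pose dx u := - (4 * S u * C u) / (1 + S u ^+ 2) ^+ 2.
have dxE u : is_derive u 1 x (dx u).
  have d2 := is_derive_mul (dS u) (dS u).
  have dn := is_deriveB (is_derive_cst (1:R) u (1:R)) d2.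
  have dd := is_deriveD (is_derive_cst (1:R) u (1:R)) d2.
  have H := is_derive_div dn dd.
  have H' := H (lt0r_neq0 (e0 u)).
  by apply: (is_derive_eq1 H'); rewrite /dx !fctE; field; rewrite gt_eqF.
have Spos u : 0 < u < T -> 0 < S u.
  move=> /andP[u0 uT]; rewrite -S0.
  apply: (@pos_derive_lt R S C 0 T) => //; last exact: ltW.
  by move=> z _; exact: is_derive_continuous (dS z).
have dx0 u : 0 < u < T -> dx u < 0.
  move=> uT; rewrite /dx mulNr oppr_lt0 divr_gt0 ?exprn_gt0//.
  by rewrite !mulr_gt0 ?Spos ?C0.
have xdec u v : 0 <= u -> u < v -> v <= T -> x v < x u.
  apply: (@neg_derive_lt R x dx 0 T) => //.
  by move=> z _; exact: is_derive_continuous (dxE z).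
pose d := T / (k + k)%:R.
have kk0 : 0 < (k + k)%:R :> R by rewrite ltr0n addn_gt0 k0.
have d0 : 0 < d by rewrite divr_gt0.
have dT : (k + k)%:R * d = T by rewrite mulrC divfK// gt_eqF.
pose t i := x (i.*2%:R * d); pose c i := x (i.*2.+1%:R * d).
have c0 j : 0 < c j by exact: x_gt0.
pose Hf u := (zeros_poly k c).[x u] ^+ 2 / (poles_poly k c).[x u] ^+ 2.
have den0 u : 0 < (poles_poly k c).[x u].
  by rewrite horner_poles_poly prodr_gt0// => j _; rewrite addr_gt0.
pose B u := S u ^+ 2.
have BT u : B (u + 2 * T) = B u by rewrite /B ST2 sqrrN.
have xx u v : ((x v - x u) / (x v + x u)) ^+ 2 = B (u + v) * B (u - v).
  rewrite /B -exprMn SS; congr (_ ^+ 2).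
  have e1 := e0 u; have e2 := e0 v.
  have : 0 < (x v + x u) * ((1 + S u ^+ 2) * (1 + S v ^+ 2)).
    by rewrite !mulr_gt0// addr_gt0.
  rewrite /x; move: (S u ^+ 2) (S v ^+ 2) e1 e2 => a b a0 b0.
  have -> : ((1 - b) / (1 + b) + (1 - a) / (1 + a)) * ((1 + a) * (1 + b)) = 2 * (1 - a * b).
    by field; rewrite !gt_eqF.
  rewrite pmulr_rgt0// => ab0.
  have -> : (1 - b) / (1 + b) - (1 - a) / (1 + a) = 2 * (a - b) / ((1 + a) * (1 + b)).
    by field; rewrite !gt_eqF.
  have -> : (1 - b) / (1 + b) + (1 - a) / (1 + a) = 2 * (1 - a * b) / ((1 + a) * (1 + b)).
    by field; rewrite !gt_eqF.
  by field; rewrite !gt_eqF.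
have HE u : Hf u = \prod_(0 <= i < k + k) B (u + i.*2.+1%:R * d).
  rewrite -(prod_fold (fun i => B (u + i.*2.+1%:R * d))).
  rewrite /Hf horner_zeros_poly horner_poles_poly -expr_div_n -prodf_div -prodrXl.
  apply: eq_big_nat => j /= jk; rewrite xx; congr (_ * _).
  (* Shifting by the period 2T turns the translation by -(2j + 1) d into the
     odd multiple of d with index 2k - 1 - j. *)
  rewrite -[LHS]BT; congr B; rewrite -dT.
  have -> := reflect_node j jk.
  by ring.
have HN u : Hf (- u) = Hf u by rewrite /Hf xN.
have Hper u : Hf (u + 2 * d) = Hf u.
  rewrite !HE; case: (k + k)%N dT kk0 => [|n dT _]; first by rewrite ltxx.
  rewrite -[RHS](cyclic_prod_shift (f := fun i => B (u + i.*2.+1%:R * d))).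
    apply: eq_bigr => i _; congr B.
    rewrite doubleS -!natr1; ring.
  rewrite -[RHS]BT; congr B; rewrite -dT doubleS double0 -!natr1 -mul2n natrM. ring.
have Hpern i u : Hf (u + i.*2%:R * d) = Hf u.
  elim: i => [|i IH]; first by rewrite mul0r addr0.
  by rewrite -[RHS]IH -[RHS]Hper; congr Hf; rewrite doubleS -!natr1; ring.
(* Up to sign, M is the value of the fraction at x = 1; each of its factors
   lies strictly between 0 and 1. *)
pose M := \prod_(0 <= j < k) ((1 - c j) / (1 + c j)).
have c1 j : (j < k)%N -> c j < 1.
  move=> jk; rewrite -x0; apply: xdec => //; first by rewrite mulr_gt0.
  by have [_ _ h _] := node_lt _ jk; rewrite -dT ler_pM2r// ler_nat.
have H0 : Hf 0 = M ^+ 2.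
  rewrite /Hf x0 horner_zeros_poly horner_poles_poly -expr_div_n -prodf_div -!prodrXl.
  apply: eq_bigr => j _; rewrite !expr_div_n -sqrrN opprB; congr (_ / _ ^+ 2).
  by rewrite addrC.
have M01 : 0 < M < 1.
  have fM j : (j < k)%N -> 0 < (1 - c j) / (1 + c j) < 1.
    move=> jk; have h0 := c0 j; have h1 := c1 j jk.
    by rewrite divr_gt0 ?subr_gt0 ?addr_gt0//= ltr_pdivrMr ?addr_gt0// mul1r; lra.
  apply/andP; split.
    by rewrite /M big_nat prodr_gt0// => j /andP[_ /fM/andP[]].
  have := @ltr_prod_nat R (fun j => (1 - c j) / (1 + c j)) (fun=> 1) k 0 k0.
  by rewrite big1_eq; apply => j /andP[_ /fM/andP[/ltW -> ->]].
exists c, t, M; split => //.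
- by rewrite /t mul0r x0.
- by rewrite /t -addnn dT xT.
- move=> i /node_lt[h1 h2 h3 h4]; rewrite /t /c; apply/andP; split; apply: xdec.
  + by rewrite mulr_ge0// ltW.
  + by rewrite ltr_pM2r// ltr_nat.
  + by rewrite -dT ler_pM2r// ler_nat.
  + by rewrite mulr_ge0// ltW.
  + by rewrite ltr_pM2r// ltr_nat.
  + by rewrite -dT ler_pM2r// ler_nat.
- move=> i ik; have := Hpern i 0; rewrite H0 add0r /Hf -/(t i) => <-.
  by rewrite divfK// expf_neq0// lt0r_neq0//; exact: den0.
move=> i ik.
have ti : 0 < i.*2%:R * d < T.
  by have /andP[h1 h2] := node_in _ ik; rewrite mulr_gt0 ?ltr0n//= -dT ltr_pM2r// ltr_nat.
have dp := is_derive_chain (dxE (i.*2%:R * d)) (is_derive_poly (zeros_poly k c) _).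
have dq := is_derive_chain (dxE (i.*2%:R * d)) (is_derive_poly (poles_poly k c) _).
have dpq := is_derive_div (is_derive_mul dp dp) (is_derive_mul dq dq).
have /dpq : (poles_poly k c).[x (i.*2%:R * d)] * (poles_poly k c).[x (i.*2%:R * d)] != 0.
  by rewrite mulf_neq0// gt_eqF.
move=> /(is_derive_sym0 _) ; rewrite -/(t i).
have : forall s, Hf (i.*2%:R * d + s) = Hf (i.*2%:R * d - s).
  by move=> s; rewrite (addrC _ s) Hpern (addrC _ (- s)) Hpern HN.
move=> hs /(_ hs) /eqP.
have gq := den0 (i.*2%:R * d); rewrite -/(t i) in gq.
rewrite mulf_eq0 invr_eq0 expf_eq0/= mulf_eq0 !(gt_eqF gq) !orbF.
have gp : (zeros_poly k c).[t i] != 0.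
  have := Hpern i 0; rewrite H0 add0r /Hf -/(t i) => E.
  apply/eqP => E0; move: E; rewrite E0 expr0n mul0r => /esym/eqP.
  by case/andP: M01 => M0 _; rewrite expf_eq0/= gt_eqF.
move=> E; rewrite /root /wronskian !hornerE.
have dxt : dx (i.*2%:R * d) != 0 by rewrite lt_eqF// dx0.
have qt : (poles_poly k c).[t i] != 0 by rewrite gt_eqF.
rewrite -(mulrI_eq0 _ (mulfI dxt)) -(mulrI_eq0 _ (mulfI gp)) -(mulrI_eq0 _ (mulfI qt)).
rewrite -(mulrI_eq0 _ (@mulfI R 2 _)) ?pnatr_eq0// -(eqP E); apply/eqP.
rewrite -/(t i); ring.
Qed.

End nodes.

(** * Counting zeros of the extremal function *)

Section poly_facts.
Context {R : realType}.
Implicit Types (p q : {poly R}) (x z : R).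

Lemma double_root_dvdp p z : root p z -> root p^`() z -> ('X - z%:P) ^+ 2 %| p.
Proof.
move=> /factor_theorem[q ->]; rewrite derivM derivXsubC mulr1 => qz.
have /factor_theorem[r ->] : root q z.
  by move: qz; rewrite !rootE !hornerE subrr mulr0 add0r.
by rewrite -mulrA -expr2 dvdp_mull.
Qed.

Lemma double_roots_factor (rs : seq R) p : uniq rs ->
  (forall z, z \in rs -> root p z /\ root p^`() z) ->
  exists q, p = q * (\prod_(z <- rs) ('X - z%:P)) ^+ 2.
Proof.
elim: rs p => [|z rs IH] p /=; first by exists p; rewrite big_nil expr1n mulr1.
move=> /andP[zrs urs] pz.
have [pz0 pz1] := pz z (mem_head _ _).
have /dvdpP[q pE] := double_root_dvdp pz0 pz1.
have [|r qE] := IH q urs.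
  move=> y yrs; have [] := pz y; first by rewrite in_cons yrs orbT.
  have yz : y - z != 0 by rewrite subr_eq0; apply: contraNneq zrs => <-.
  rewrite pE expr2 !derivM derivXsubC !rootE !hornerE !mulf_eq0 !(negPf yz) !orbF.
  move=> /eqP qy; rewrite qy mul0r addr0 !mulf_eq0 !(negPf yz) !orbF.
  by rewrite eqxx.
by exists r; rewrite pE qE big_cons; ring.
Qed.

Lemma poly_const_sign p (a b : R) : (forall x, a < x < b -> p.[x] != 0) ->
  (forall x, a < x < b -> 0 < p.[x]) \/ (forall x, a < x < b -> p.[x] < 0).
Proof.
move=> p0.
have between x y z : a < x < b -> a < y < b -> x <= z <= y -> a < z < b.
  by move=> /andP[ax _] /andP[_ yb] /andP[xz zy]; rewrite (lt_le_trans ax) ?(le_lt_trans zy).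
have same x y : a < x < b -> a < y < b -> 0 < p.[x] -> 0 < p.[y].
  move=> xab yab px; case: (ltgtP 0 p.[y]) => // [py|/esym/eqP]; last by rewrite (negPf (p0 _ yab)).
  have [xy|/ltW yx] := leP x y.
    have [|z zxy] := @poly_ivt R (- p) x y xy.
      by rewrite !hornerN oppr_le0 oppr_ge0 !ltW.
    by rewrite rootN rootE (negPf (p0 _ (between _ _ _ xab yab zxy))).
  have [|z zxy] := @poly_ivt R p y x yx; first by rewrite !ltW.
  by rewrite rootE (negPf (p0 _ (between _ _ _ yab xab zxy))).
have [[x [xab px]]|np] := pselect (exists x, a < x < b /\ 0 < p.[x]).
  by left=> y yab; exact: (same x).
right=> y yab; case: (ltgtP 0 p.[y]) => // [py|/esym/eqP]; last by rewrite (negPf (p0 _ yab)).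
by case: np; exists y.
Qed.

Lemma size_zeros_poly k (c : nat -> R) : size (zeros_poly k c) = k.+1.
Proof.
rewrite /zeros_poly size_prod_seq.
  rewrite size_iota subn0 (eq_bigr (fun=> 2%N)); last first.
    by move=> j _; rewrite -opprB size_polyN size_XsubC.
  rewrite big_const_seq count_predT size_iota subn0 iter_addn_0; lia.
by move=> j _; rewrite -opprB oppr_eq0 polyXsubC_eq0.
Qed.

Lemma size_poles_poly k (c : nat -> R) : size (poles_poly k c) = k.+1.
Proof.
rewrite /poles_poly size_prod_seq.
  rewrite size_iota subn0 (eq_bigr (fun=> 2%N)); last first.
    by move=> j _; rewrite addrC -[c j]opprK polyCN size_XsubC.
  rewrite big_const_seq count_predT size_iota subn0 iter_addn_0; lia.
by move=> j _; rewrite addrC -[c j]opprK polyCN polyXsubC_eq0.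
Qed.

Lemma zeros_poly_eq0 k (c : nat -> R) i : (i < k)%N -> (zeros_poly k c).[c i] = 0.
Proof.
move=> ik; rewrite horner_zeros_poly big_mkord (bigD1 (Ordinal ik))//=.
by rewrite subrr mul0r.
Qed.

End poly_facts.

Section factorization.
Context {R : realType}.
Variables (l : R) (k : nat) (c t : nat -> R) (M : R).
Hypothesis E : equioscillation l k c t M.
Let l0 := eqo_l E.
Let k0 := eqo_k E.
Let t0 := eqo_t0 E.
Let tk := eqo_tk E.
Let M01 := eqo_M E.
Let ct := eqo_ct E.
Local Notation P := (zeros_poly k c).
Local Notation Q := (poles_poly k c).
Local Notation W := (wronskian P Q).
Let Pt := eqo_values E.
Let Wt := eqo_wronskian E.

Lemma node_decr i j : (i < j <= k)%N -> t j < t i.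
Proof.
elim: j => // j IH /andP[]; rewrite ltnS leq_eqVlt => /predU1P[<-|ij] jk.
  by have /andP[h1 h2] := ct jk; exact: lt_trans h2.
have /andP[h1 h2] := ct jk.
by rewrite (lt_trans h1)// (lt_trans h2)// IH// ij ltnW.
Qed.

Lemma node_ge i : (i <= k)%N -> l <= t i.
Proof.
rewrite leq_eqVlt => /predU1P[->|ik]; first by rewrite tk.
by rewrite -tk ltW// node_decr// ik leqnn.
Qed.

Lemma node_gt i : (i < k)%N -> l < t i.
Proof. by move=> ik; rewrite -tk node_decr// ik leqnn. Qed.

Lemma node_le1 i : (i <= k)%N -> t i <= 1.
Proof.
case: i => [|i] ik; first by rewrite t0.
by rewrite -t0 ltW// node_decr.
Qed.

Lemma node_lt1 i : (0 < i <= k)%N -> t i < 1.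
Proof. by move=> ik; rewrite -t0 node_decr. Qed.

Lemma zero_in i : (i < k)%N -> l < c i < 1.
Proof.
move=> ik; have /andP[h1 h2] := ct ik.
by rewrite (le_lt_trans (node_ge ik) h1) (lt_le_trans h2)// node_le1// ltnW.
Qed.

Lemma zero_gt0 i : (i < k)%N -> 0 < c i.
Proof. by move=> /zero_in/andP[+ _]; exact: lt_trans. Qed.

Lemma poles_gt0 x : - l <= x -> 0 < Q.[x].
Proof.
move=> xl; rewrite horner_poles_poly big_nat prodr_gt0// => j /andP[_ /zero_in/andP[lc _]].
by rewrite -ltrBlDr sub0r (le_lt_trans _ lc)// lerNl.
Qed.

Lemma zeros_gt0 x : x <= l -> 0 < P.[x].
Proof. by move=> xl; rewrite -[x]opprK -poles_polyE poles_gt0// lerN2. Qed.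

(** The difference of M^2 and the square of the fraction, with denominators
    cleared. *)
Definition dev : {poly R} := (M ^+ 2) *: Q ^+ 2 - P ^+ 2.

Lemma horner_dev x : dev.[x] = M ^+ 2 * Q.[x] ^+ 2 - P.[x] ^+ 2.
Proof. by rewrite /dev !hornerE. Qed.

Lemma horner_devN x : dev.[- x] = M ^+ 2 * P.[x] ^+ 2 - Q.[x] ^+ 2.
Proof. by rewrite horner_dev -poles_polyE poles_polyE opprK. Qed.

Let rs := [seq t i | i <- iota 1 k.-1].

Let mem_rs z : reflect (exists2 i, (0 < i < k)%N & z = t i) (z \in rs).
Proof.
apply: (iffP mapP) => -[i ik ->]; exists i => //; first by move: ik; rewrite mem_iota; lia.
by rewrite mem_iota; lia.
Qed.

Let uniq_rs : uniq rs.
Proof.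
rewrite map_inj_in_uniq ?iota_uniq// => i j.
rewrite !mem_iota => ik jk tij.
by case: (ltngtP i j) => // ij; [have := @node_decr i j|have := @node_decr j i];
  rewrite tij ltxx => /(_ _)/negP; rewrite ij /=; lia.
Qed.

Let size_rs : size rs = k.-1.
Proof. by rewrite size_map size_iota. Qed.

Let dev_root i : (i <= k)%N -> root dev (t i).
Proof. by move=> ik; rewrite rootE horner_dev Pt// subrr. Qed.

Let dev_deriv_root i : (0 < i < k)%N -> root dev^`() (t i).
Proof.
move=> ik; have /andP[_ /ltnW ik'] := ik.
have q0 : Q.[t i] != 0.
  by rewrite gt_eqF// poles_gt0// (le_trans _ (node_ge ik'))// lerNl (le_trans _ (ltW l0))// oppr_le0 ltW.
have := Wt ik; rewrite !rootE /wronskian !(hornerD, hornerN, hornerM).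
have -> : dev^`() = M ^+ 2 *: (Q^`() * Q + Q * Q^`()) - (P^`() * P + P * P^`()).
  by rewrite /dev !expr2 derivB derivZ !derivM.
rewrite !(hornerD, hornerN, hornerZ, hornerM); have := Pt ik'.
move: (P.[_]) (Q.[_]) q0 (P^`().[_]) (Q^`().[_]) => p q q0 p' q' PQ.
rewrite subr_eq0 => /eqP E1; apply/eqP; apply: (mulIf q0); rewrite mul0r.
transitivity (2 * ((M ^+ 2 * q ^+ 2) * q' - p * (p' * q))); first by ring.
by rewrite -PQ E1; ring.
Qed.

Let DW : {poly R} := \prod_(z <- rs) ('X - z%:P).

Let horner_DW x : DW.[x] = \prod_(z <- rs) (x - z).
Proof. by rewrite horner_prod; apply: eq_bigr => z _; rewrite !hornerE. Qed.

(** A polynomial of degree at most 2k with simple zeros at 1 and l and double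
    zeros at the k - 1 inner nodes is known up to a constant. The constant is
    negative because the polynomial is positive at the zero c 0 of the
    fraction. *)
Lemma dev_factor : exists2 a : R, a < 0 &
  forall x, dev.[x] = a * ((x - 1) * (x - l) * (\prod_(z <- rs) (x - z)) ^+ 2).
Proof.
have [|q devE] := @double_roots_factor R rs dev uniq_rs.
  by move=> z /mem_rs[i ik ->]; split; [apply: dev_root; lia|exact: dev_deriv_root].
have DWn0 z : z = 1 \/ z = l -> DW.[z] != 0.
  move=> hz; rewrite horner_DW prodf_seq_neq0; apply/allP => y /mem_rs[i ik ->] /=.
  rewrite subr_eq0; case: hz => ->; first by rewrite gt_eqF// node_lt1//; lia.
  by rewrite lt_eqF// node_gt//; lia.
have qroot z : z = 1 \/ z = l -> root dev z -> root q z.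
  by move=> hz; rewrite devE !rootE hornerM horner_exp mulf_eq0 expf_eq0/= -/DW (negPf (DWn0 _ hz)) orbF.
have l1 : l < 1 by rewrite -tk node_lt1// k0 leqnn.
have /factor_theorem[q1 qE] : root q 1 by apply: qroot; [left|rewrite -t0 dev_root].
have /factor_theorem[r q1E] : root q1 l.
  have : root q l by apply: qroot; [right|rewrite -tk dev_root].
  by rewrite qE !rootE !hornerE mulf_eq0 subr_eq0 (lt_eqF l1) orbF.
have c0 := zero_in k0; have /andP[c0l c01] := c0.
have devc : 0 < dev.[c 0%N].
  rewrite horner_dev (zeros_poly_eq0 c k0) expr0n/= subr0.
  case/andP: M01 => M0 _; rewrite mulr_gt0 ?exprn_gt0// poles_gt0// (le_trans _ (ltW c0l))//.
  by rewrite lerNl (le_trans _ (ltW l0))// oppr_le0 ltW.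
have dev0 : dev != 0 by apply: contraTneq devc => ->; rewrite horner0 ltxx.
have sdev : (size dev <= k + k + 1)%N.
  rewrite (leq_trans (size_polyD _ _))// geq_max size_polyN.
  rewrite (leq_trans (size_scale_leq _ _)) ?(leq_trans (size_poly_exp_leq _ _)) ?size_zeros_poly ?size_poles_poly//; lia.
have sr : (size r <= 1)%N.
  move: dev0 sdev; rewrite devE qE q1E => dev0.
  have DWs : size (DW ^+ 2) = k.-1.*2.+1.
    rewrite -(prednK (n := size _)) ?size_exp; last by rewrite lt0n size_poly_eq0 expf_neq0// monic_neq0// monic_prod_XsubC.
    by rewrite size_prod_XsubC size_rs muln2.
  rewrite -/DW size_Mmonic ?monic_exp ?monic_prod_XsubC//; last first.
    by apply: contraNneq dev0 => ->; rewrite mul0r.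
  rewrite DWs size_Mmonic ?monicXsubC//; last first.
    by apply: contraNneq dev0 => ->; rewrite !mul0r.
  rewrite size_Mmonic ?monicXsubC//; last first.
    by apply: contraNneq dev0 => ->; rewrite !mul0r.
  have sX (z : R) : size ('X - z%:P) = 2%N by rewrite size_XsubC.
  rewrite !sX; move: (size r) => s; clear -k0; lia.
have rE x : r.[x] = r`_0 by rewrite {1}(size1_polyC sr) hornerC.
have rdevE x : dev.[x] = r`_0 * ((x - 1) * (x - l) * (\prod_(z <- rs) (x - z)) ^+ 2).
  rewrite devE hornerM horner_exp qE q1E !hornerM rE !hornerXsubC -/DW horner_DW; ring.
exists r`_0 => //; rewrite ltNge; apply/negP => r0.
move: devc; rewrite rdevE ltNge => /negP; apply.
rewrite mulr_ge0_le0// mulr_le0_ge0 ?sqr_ge0//.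
by rewrite mulr_le0_ge0// ?subr_le0 ?subr_ge0 ltW.
Qed.

Lemma poles_polyNX : Q = P \Po (- 'X).
Proof.
rewrite /zeros_poly rmorph_prod /=; apply: eq_bigr => j _.
by rewrite comp_polyB comp_polyC comp_polyX opprK.
Qed.

(** The substitution x -> -x exchanges P and Q, and the sign from this
    exchange cancels the one from differentiation. *)
Lemma wronskian_even x : W.[- x] = W.[x].
Proof.
rewrite /wronskian !(hornerD, hornerN, hornerM).
have dQ y : Q^`().[y] = - P^`().[- y].
  by rewrite poles_polyNX deriv_comp derivN derivX !hornerE horner_comp !hornerE mulrN1.
by rewrite !dQ !poles_polyE opprK; ring.
Qed.

(** Otherwise the fraction would be constant on [0, c 0], although it is 1 at
    0 and 0 at c 0. *)
Lemma wronskian_neq0 : W != 0.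
Proof.
apply/eqP => W0.
have /andP[c0l c01] := zero_in k0.
have c00 : 0 < c 0%N by exact: lt_trans c0l.
have Qn0 x : 0 <= x -> Q.[x] != 0.
  by move=> x0; rewrite gt_eqF// poles_gt0// (le_trans _ x0)// oppr_le0 ltW.
have dg (x : R) : 0 <= x -> is_derive x 1 (fun x => P.[x] / Q.[x]) 0.
  move=> x0; have H := is_derive_div (is_derive_poly P x) (is_derive_poly Q x) (Qn0 x x0).
  apply: (is_derive_eq1 H); move: (congr1 (horner^~ x) W0).
  by rewrite /wronskian horner0 !(hornerD, hornerN, hornerM) => ->; rewrite mul0r.
have dgi (x : R) : x \in `]0, c 0%N[ -> is_derive x 1 (fun x => P.[x] / Q.[x]) 0.
  by rewrite in_itv/= => /andP[/ltW x0 _]; exact: dg.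
have cg : {within `[0, c 0%N], continuous (fun x => P.[x] / Q.[x])}.
  apply: continuous_in_subspaceT => y; rewrite inE/= in_itv/= => /andP[y0 _].
  exact: is_derive_continuous (dg _ y0).
have [x _] := @MVT R _ _ 0 (c 0%N) c00 dgi cg.
rewrite mul0r (zeros_poly_eq0 c k0) mul0r sub0r => /eqP; rewrite oppr_eq0.
rewrite poles_polyE oppr0 divff ?oner_eq0// gt_eqF// zeros_gt0//; exact: ltW.
Qed.

(** The inner nodes and their opposites are 2k - 2 zeros, while the degree is
    at most 2k - 1; the possible remaining linear factor is constant by
    evenness. *)
Lemma wronskian_factor : exists2 a : R, a != 0 &
  forall x, W.[x] = a * \prod_(z <- rs) ((x - z) * (x + z)).
Proof.
pose rs2 := rs ++ [seq - z | z <- rs].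
have rs_gt0 z : z \in rs -> 0 < z.
  by move=> /mem_rs[i /andP[_ ik] ->]; exact: lt_trans (node_gt ik).
have ars2 : all (root W) rs2.
  rewrite all_cat (all_map -%R); apply/andP; split; apply/allP => z /mem_rs[i ik ->] /=.
    exact: Wt.
  by rewrite rootE wronskian_even -rootE Wt.
have urs2 : uniq rs2.
  rewrite cat_uniq uniq_rs map_inj_uniq ?uniq_rs ?andbT/=; last exact: oppr_inj.
  apply/hasPn => _ /mapP[z zrs ->]; apply/negP => /rs_gt0.
  by rewrite oppr_gt0 ltNge ltW// rs_gt0.
have /dvdpP[r WE] : \prod_(z <- rs2) ('X - z%:P) %| W.
  by apply: uniq_roots_dvdp => //; rewrite uniq_rootsE.
have D2E x : (\prod_(z <- rs2) ('X - z%:P)).[x] = \prod_(z <- rs) ((x - z) * (x + z)).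
  rewrite horner_prod big_cat (big_map -%R) big_split/=; congr (_ * _);
  by apply: eq_bigr => z _; rewrite !hornerE ?opprK.
have sW : (size W <= k + k)%N.
  rewrite /wronskian (leq_trans (size_polyD _ _))// geq_max size_polyN; apply/andP; split;
    rewrite (leq_trans (size_polyMleq _ _))//.
    have := lt_size_deriv (p := P); rewrite -size_poly_gt0 size_zeros_poly size_poles_poly => /(_ isT); lia.
  have := lt_size_deriv (p := Q); rewrite -size_poly_gt0 size_zeros_poly size_poles_poly => /(_ isT); move: (size _) => s; clear -k0; lia.
have rn0 : r != 0 by apply: contraNneq wronskian_neq0 => r0; rewrite WE r0 mul0r.
have sr : (size r <= 2)%N.
  move: sW; rewrite WE size_Mmonic ?monic_prod_XsubC// size_prod_XsubC.
  by rewrite size_cat (size_map -%R) size_rs; move: (size r) => s; clear -k0; lia.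
have rE x : r.[x] = r`_0 + r`_1 * x.
  rewrite (horner_coef_wide _ sr) !big_ord_recl big_ord0 /= expr0 expr1; ring.
have D21 : (\prod_(z <- rs2) ('X - z%:P)).[1] != 0.
  rewrite D2E prodf_seq_neq0; apply/allP => z zrs /=.
  rewrite mulf_neq0//; last by rewrite gt_eqF// addr_gt0// rs_gt0.
  by have /mem_rs[i ik ->] := zrs; rewrite subr_eq0 gt_eqF// node_lt1//; lia.
have r1 : r`_1 = 0.
  have := wronskian_even 1; rewrite WE !hornerM.
  have -> : (\prod_(z <- rs2) ('X - z%:P)).[-1] = (\prod_(z <- rs2) ('X - z%:P)).[1].
    by rewrite !D2E; apply: eq_bigr => z _; ring.
  by move=> /(mulIf D21); rewrite !rE => ?; lra.
exists r`_0.
  by apply: contraNneq rn0 => r0; apply/eqP/polyP => -[|[|i]];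
    rewrite coef0 ?r0 ?r1// nth_default// (leq_trans sr).
by move=> x; rewrite WE hornerM D2E rE r1 mul0r addr0.
Qed.

Lemma wronskian_eq0 x : W.[x] = 0 -> exists2 i, (0 < i < k)%N & x = t i \/ x = - t i.
Proof.
have [a a0 ->] := wronskian_factor => /eqP.
rewrite mulf_eq0 (negPf a0)/= prodf_seq_eq0 => /hasP[z /mem_rs[i ik zE] /=].
rewrite mulf_eq0 => /orP[|].
  by rewrite subr_eq0 => /eqP ->; exists i => //; left.
by rewrite addr_eq0 => /eqP ->; exists i => //; right; rewrite zE.
Qed.

(** Both sides are constant multiples of (x^2 - 1) (x^2 - l^2) times the
    product of the (x^2 - t_i^2)^2 over the inner nodes. *)
Lemma equioscillation_identity : exists2 C : R, 0 < C & forall x,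
  W.[x] ^+ 2 * ((x ^+ 2 - 1) * (x ^+ 2 - l ^+ 2)) = C ^+ 2 * (dev.[x] * dev.[- x]).
Proof.
have [a a0 devE] := dev_factor; have [b b0 WE] := wronskian_factor.
exists `|b / a|; first by rewrite normr_gt0 mulf_neq0// invr_neq0// lt_eqF.
move=> x; rewrite real_normK ?num_real// !devE WE.
rewrite big_split/=.
have -> : (\prod_(z <- rs) (- x - z)) ^+ 2 = (\prod_(z <- rs) (x + z)) ^+ 2.
  by rewrite -!prodrXl; apply: eq_bigr => z _; ring.
by field; rewrite lt_eqF.
Qed.

Lemma dev_ge0 x : l <= x <= 1 -> 0 <= dev.[x].
Proof.
move=> /andP[lx x1]; have [a a0 ->] := dev_factor.
rewrite nmulr_rge0// mulr_le0_ge0 ?sqr_ge0// mulr_le0_ge0// ?subr_le0 ?subr_ge0//.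
Qed.

End factorization.

(** * The transformation of moduli *)

Section symmetric_integrals.
Context {R : realType}.
Implicit Types (z l : R).

Lemma ellJ_flip z : 0 < z < 1 -> ellJ z (- z) z = (2%:E * ellJ z 0 z)%E.
Proof.
move=> /andP[z0 z1].
have q0 x : - z < x < z -> ellq z x != 0 by move=> xz; exact: ellq_neq0_in.
have Nz0 : - z < 0 by rewrite oppr_lt0.
rewrite (ellJ_split Nz0 z0).
- have -> : ellJ z (- z) 0 = ellJ z 0 z.
    have dN (x : R) : 0 < x < z -> is_derive x 1 (fun x : R => - x) (-1).
      by move=> _; exact: is_deriveN (is_derive_id x (1:R)).
    have H := @ellJ_subst_decr R (fun x => - x) (fun=> -1) z z 0 z 1 ltr01 z0 _ dN.
    rewrite oppr0 in H; rewrite H ?mul1e//.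
    + by move=> x _; exact: continuousN.
    + by move=> x _; exact: cvg_cst.
    + by move=> x /andP[x0 xz]; rewrite q0// xz (lt_trans _ x0).
    + by move=> x /andP[x0 xz]; rewrite q0// x0 (lt_trans xz).
    + by move=> x _; rewrite /ellq !sqrrN.
  by rewrite -{1 2}[ellJ z 0 z]mul1e -ge0_muleDl ?lee_fin// -EFinD.
- by move=> x /andP[x0 xz]; rewrite q0// x0 (lt_trans xz).
- by move=> x /andP[x0 xz]; rewrite q0// xz (lt_trans _ x0).
Qed.

End symmetric_integrals.

Section transformation.
Context {R : realType}.
Variables (l : R) (k : nat) (c t : nat -> R) (M : R).
Hypothesis E : equioscillation l k c t M.
Let l0 := eqo_l E.
Let k0 := eqo_k E.
Let t0 := eqo_t0 E.
Let tk := eqo_tk E.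
Let M01 := eqo_M E.
Local Notation P := (zeros_poly k c).
Local Notation Q := (poles_poly k c).
Local Notation W := (wronskian P Q).
Let Pt := eqo_values E.

Let l1 : l < 1. Proof. by rewrite -tk (node_lt1 E)// k0 leqnn. Qed.
Let l01 : 0 < l < 1. Proof. by rewrite l0 l1. Qed.
Let Z := M ^+ 2.
Let Z01 : 0 < Z < 1.
Proof. by case/andP: M01 => M0 M1; rewrite exprn_gt0//= expr_lt1// ltW. Qed.
Let f x := M * (P.[x] / Q.[x]).
Let df x := M * (W.[x] / Q.[x] ^+ 2).

Let Q0 x : - l <= x -> 0 < Q.[x].
Proof. exact: (poles_gt0 E). Qed.

Let dfE x : - l <= x -> is_derive x 1 f (df x).
Proof.
move=> xl; have q0 := lt0r_neq0 (Q0 xl).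
have H := is_derive_div (is_derive_poly P x) (is_derive_poly Q x) q0.
have H2 := is_derive_mul (is_derive_cst M x (1:R)) H.
apply: (is_derive_eq1 H2); rewrite mul0r add0r /df.
by rewrite /wronskian !(hornerD, hornerN, hornerM).
Qed.

Let cdf x : - l <= x -> {for x, continuous df}.
Proof.
move=> xl; apply: cvgM; first exact: cvg_cst.
apply: cvgM; first exact: continuous_horner.
apply: cvgV; first by rewrite expf_neq0// gt_eqF// Q0.
rewrite expr2; apply: cvgM; exact: continuous_horner.
Qed.

(** This is equioscillation_identity divided by Q^4 and rewritten for
    f = M P / Q: the two values of dev supply the factors f^2 - Z^2 and 1 -
    f^2. *)
Lemma transformation_scale : exists2 C : R, 0 < C & forall x, - l <= x ->
  df x ^+ 2 * `|ellq l x| = C ^+ 2 * `|ellq Z (f x)|.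
Proof.
have [C C0 CE] := equioscillation_identity E.
exists C => // x xl; have q0 := lt0r_neq0 (Q0 xl).
rewrite -(ger0_norm (sqr_ge0 (df x))) -(ger0_norm (sqr_ge0 C)) -!normrM.
suff -> : df x ^+ 2 * ellq l x = - (C ^+ 2 * ellq Z (f x)) by rewrite normrN.
have := CE x; rewrite horner_devN horner_dev => devE.
rewrite /df /ellq /f /Z.
transitivity (- (M ^+ 2 / Q.[x] ^+ 4 * (W.[x] ^+ 2 * ((x ^+ 2 - 1) * (x ^+ 2 - l ^+ 2))))).
  by field.
by rewrite devE; field.
Qed.

(** On an interval without critical points f is monotone, and either direction
    of monotonicity leads to the same relation of integrals. *)
Lemma ellJ_transform (C a b : R) : 0 < C ->
  (forall x, - l <= x -> df x ^+ 2 * `|ellq l x| = C ^+ 2 * `|ellq Z (f x)|) ->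
  - l <= a -> a < b ->
  (forall x, a < x < b -> W.[x] != 0) -> (forall x, a < x < b -> ellq l x != 0) ->
  (f a < f b /\ ((forall y, f a < y < f b -> ellq Z y != 0) ->
     ellJ Z (f a) (f b) = (C%:E * ellJ l a b)%E)) \/
  (f b < f a /\ ((forall y, f b < y < f a -> ellq Z y != 0) ->
     ellJ Z (f b) (f a) = (C%:E * ellJ l a b)%E)).
Proof.
move=> C0 CE la ab W0 ql.
have in_l x : a <= x <= b -> - l <= x by move=> /andP[ax _]; exact: le_trans ax.
have in_l' x : a < x < b -> - l <= x by move=> /andP[ax _]; rewrite (le_trans la)// ltW.
have cf x : a <= x <= b -> {for x, continuous f}.
  by move=> /in_l xl; exact: is_derive_continuous (dfE xl).
have [Wp|Wn] := poly_const_sign W0; [left|right].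
- have df0 x : a < x < b -> 0 < df x.
    move=> xab; case/andP: M01 => M0 _.
    by rewrite mulr_gt0// divr_gt0 ?Wp// exprn_gt0// Q0// in_l'.
  split; first exact: (pos_derive_lt cf (fun x xab => dfE (in_l' _ xab)) df0).
  move=> qZ; apply: (ellJ_subst_incr C0 ab cf (fun x xab => dfE (in_l' _ xab))) => //.
  + by move=> x /in_l' /cdf.
  + by move=> x /in_l' /CE.
- have df0 x : a < x < b -> df x < 0.
    move=> xab; case/andP: M01 => M0 _.
    by rewrite pmulr_rlt0// pmulr_llt0 ?Wn// invr_gt0 exprn_gt0// Q0// in_l'.
  split; first exact: (neg_derive_lt cf (fun x xab => dfE (in_l' _ xab)) df0).
  move=> qZ; apply: (ellJ_subst_decr C0 ab cf (fun x xab => dfE (in_l' _ xab))) => //.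
  + by move=> x /in_l' /cdf.
  + by move=> x /in_l' /CE.
Qed.

Let f_node i : (i <= k)%N -> f (t i) = Z \/ f (t i) = - Z.
Proof.
move=> ik; have tl : - l <= t i.
  by rewrite (le_trans _ (node_ge E ik))// lerNl (le_trans _ (ltW l0))// oppr_le0 ltW.
have q0 := lt0r_neq0 (Q0 tl).
have /eqP : (f (t i)) ^+ 2 = Z ^+ 2.
  by rewrite /f /Z !exprMn exprVn Pt//; field.
by rewrite eqf_sqr => /orP[/eqP|/eqP]; [left|right].
Qed.

(** The values of f at consecutive nodes are Z or -Z, and by strict
    monotonicity in between they are different. *)
Lemma ellJ_between_nodes (C : R) i : 0 < C ->
  (forall x, - l <= x -> df x ^+ 2 * `|ellq l x| = C ^+ 2 * `|ellq Z (f x)|) ->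
  (i < k)%N -> ellJ Z (- Z) Z = (C%:E * ellJ l (t i.+1) (t i))%E.
Proof.
move=> C0 CE ik.
have ab : t i.+1 < t i by apply: (node_decr E); rewrite ltnSn.
have lt1 : l <= t i.+1 by exact: (node_ge E).
have Nl0 : - l < 0 by rewrite oppr_lt0.
have la : - l <= t i.+1 by rewrite (le_trans _ lt1)// ltW// (lt_trans Nl0).
have W0 x : t i.+1 < x < t i -> W.[x] != 0.
  move=> /andP[x1 x2]; apply/eqP.
  move=> /(wronskian_eq0 E)[j /andP[j0 jk] [xE|xE]].
    have [ji|ij] := leqP j i.
      have : t i <= t j.
        move: ji; rewrite leq_eqVlt => /predU1P[->//|ji]; apply/ltW/(node_decr E).
        by rewrite ji ltnW.
      by rewrite -xE leNgt x2.
    have : t j <= t i.+1.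
      move: ij; rewrite leq_eqVlt => /predU1P[->//|ij]; apply/ltW/(node_decr E).
      by rewrite ij ltnW.
    by rewrite -xE leNgt x1.
  have tj : 0 < t j by rewrite (lt_trans l0)// (node_gt E).
  by move: x1; rewrite xE ltNge => /negP; apply; rewrite (le_trans _ lt1)// (le_trans _ (ltW l0))// oppr_le0 ltW.
have ql x : t i.+1 < x < t i -> ellq l x != 0.
  move=> /andP[x1 x2]; apply: ellq_neq0_out => //.
  by rewrite (le_lt_trans lt1)//= (lt_le_trans x2)// (node_le1 E)// ltnW.
have qZ y : - Z < y < Z -> ellq Z y != 0.
  by move=> yZ; case/andP: Z01 => Z0 Z1; exact: ellq_neq0_in.
have Z0 : 0 < Z by case/andP: Z01.
have NZ : (Z < - Z) = false by rewrite lt_gtF// (lt_trans _ Z0)// oppr_lt0.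
have [] := ellJ_transform C0 CE la ab W0 ql;
  by have [-> |->] := f_node ik; have [-> |->] := f_node (ltnW ik); rewrite ?ltxx ?NZ => -[// _ ->].
Qed.

(** On [-l, l] there is no critical point, f(l) = Z because f is positive
    there, and f(-l) = 1 because f(x) f(-x) = M^2. *)
Lemma ellJ_middle (C : R) : 0 < C ->
  (forall x, - l <= x -> df x ^+ 2 * `|ellq l x| = C ^+ 2 * `|ellq Z (f x)|) ->
  ellJ Z Z 1 = (C%:E * ellJ l (- l) l)%E.
Proof.
move=> C0 CE.
have ab : - l < l by rewrite (lt_trans _ l0)// oppr_lt0.
have W0 x : - l < x < l -> W.[x] != 0.
  move=> /andP[x1 x2]; apply/eqP.
  move=> /(wronskian_eq0 E)[j /andP[j0 jk] [xE|xE]];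
    have lj := node_gt E jk.
    by move: x2; rewrite xE ltNge ltW.
  by move: x1; rewrite xE ltrN2 ltNge ltW.
have ql x : - l < x < l -> ellq l x != 0 by move=> xl; exact: ellq_neq0_in.
have Pl : 0 < P.[l] by apply: (zeros_gt0 E).
have Ql : 0 < Q.[l] by apply: Q0; exact: ltW.
have [Z0 Z1] := andP Z01; have [M0 M1] := andP M01.
have fl : f l = Z.
  have fl0 : 0 < f l by rewrite mulr_gt0// divr_gt0.
  have := f_node (leqnn k); rewrite tk => -[//|flE].
  by move: fl0; rewrite flE oppr_gt0 => Z0'; move: (lt_trans Z0' Z0); rewrite ltxx.
have fNl : f (- l) = 1.
  have : M * (P.[l] / Q.[l]) = M ^+ 2 := fl.
  rewrite expr2 => /(mulfI (lt0r_neq0 M0)) flE.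
  rewrite /f poles_polyE opprK -poles_polyE -[Q.[l] / _]invf_div flE divff//.
  by rewrite gt_eqF.
have [] := ellJ_transform C0 CE (lexx _) ab W0 ql; rewrite fl fNl.
  by rewrite lt_gtF// => -[].
by move=> [_ ->]// y; exact: ellq_neq0_out.
Qed.

(** Adding the integrals over the k gaps between nodes gives
    2 k K(Z) = C K(sqrt(1 - l^2)), and the middle interval gives
    K(sqrt(1 - Z^2)) = 2 C K(l); C cancels in the quotient. *)
Lemma ellipticK_transform :
  ellipticK (Num.sqrt (1 - (M ^+ 2) ^+ 2)) / ellipticK (M ^+ 2) =
  4 * k%:R * (ellipticK l / ellipticK (Num.sqrt (1 - l ^+ 2))).
Proof.
have [C C0 CE] := transformation_scale.
have mid := ellJ_middle C0 CE.
rewrite ellJ_flip// ellJ_ellipticK// ellJ_ellipticK'// -!EFinM in mid.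
case: mid => mid.
have sum i : (i <= k)%N -> (C%:E * ellJ l (t i) 1 = (i%:R * (2 * ellipticK Z))%:E)%E.
  elim: i => [|i IH] ik.
    rewrite t0 mul0r /ellJ set_itv_ge ?integral_set0 ?mule0// -leNgt.
    by rewrite bnd_simp.
  case: i IH ik => [|i] IH ik.
    by rewrite -[in ellJ l _ 1]t0 -ellJ_between_nodes// ellJ_flip// ellJ_ellipticK// mul1r EFinM.
  have ik' := ltnW ik.
  rewrite (ellJ_split (b := t i.+1)).
  - rewrite ge0_muleDr ?ellJ_ge0// IH// -ellJ_between_nodes//.
    by rewrite ellJ_flip// ellJ_ellipticK// -!EFinM -EFinD -[in RHS]natr1; congr (_%:E); ring.
  - by apply: (node_decr E); rewrite ltnSn.
  - by apply: (node_lt1 E).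
  - move=> x /andP[x1 x2]; apply: ellq_neq0_out => //.
    by rewrite (le_lt_trans (node_ge E ik))//= (lt_le_trans x2)// (node_le1 E).
  - move=> x /andP[x1 x2]; apply: ellq_neq0_out => //.
    by rewrite (le_lt_trans (node_ge E ik') x1).
have := sum _ (leqnn k); rewrite tk ellJ_ellipticK'// -EFinM => -[tot].
have [m01 _] := compl_modulus l01.
have K1 := ellipticK_gt0 m01; have K2 := ellipticK_gt0 Z01; have K3 := ellipticK_gt0 l01.
rewrite -/Z mid [RHS]mulrA; apply/eqP; rewrite eqr_div ?lt0r_neq0//; apply/eqP.
transitivity (2 * ellipticK l * (C * ellipticK (Num.sqrt (1 - l ^+ 2)))); first by ring.
by rewrite tot; ring.
Qed.

End transformation.

(** * The complementary integral near modulus zero *)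

Section log_bounds.
Context {R : realType}.
Implicit Types (z x y u : R).
Local Notation mu := (@lebesgue_measure R).

Lemma ellq_gt0 z x : 0 < z -> z < x < 1 -> 0 < ellq z x.
Proof.
move=> z0 /andP[zx x1]; have x0 : 0 < x by exact: lt_trans zx.
by rewrite mulr_gt0// subr_gt0 ?expr_lt1 ?ltr_pXn2r ?nnegrE ?ltW.
Qed.

(** On ]z, 1[ the weight exceeds 1 / x, which the substitution x = exp u turns
    into a constant. *)
Lemma ellJ_ge_ln z : 0 < z < 1 -> ((- ln z)%:E <= ellJ z z 1)%E.
Proof.
move=> /andP[z0 z1].
have lz : ln z < 0 by rewrite ln_lt0// z0.
have H := @ge0_integral_subst_incr R expR expR (ellw z) (ln z) 0 lz.
rewrite lnK ?posrE// expR0 in H.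
have zexp (x : R) : ln z < x < 0 -> z < expR x < 1.
  by move=> /andP[zx x0]; rewrite expR_lt1 x0 andbT -[ltLHS]lnK ?posrE// ltr_expR.
have cexp (x : R) : {for x, continuous (@expR R)} by exact: continuous_expR.
rewrite /ellJ H; first last.
- by move=> y _; exact: ellw_ge0.
- by move=> y yz; apply: ellw_continuous; exact: ellq_neq0_out.
- by move=> x _; exact: expR_gt0.
- by move=> x _; exact: cexp.
- by move=> x _; exact: cexp.
rewrite (_ : - ln z = 1 * (0 - ln z)); last by rewrite mul1r sub0r.
rewrite -integral_cst_oo; last exact: ltW.
apply: ge0_le_integral => //=.
- apply: (@itv_oo_measurable_fun R (fun x => ellw z (expR x) * expR x)) => x zx.
  apply: continuousM; last exact: cexp.
  apply: continuous_comp; first exact: cexp.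
  by apply: ellw_continuous; apply: ellq_neq0_out => //; exact: zexp.
move=> x; rewrite inE/= => /zexp zx; rewrite lee_fin.
have e0 := expR_gt0 x; move: (expR x) zx e0 => y zy y0.
have q0 := ellq_gt0 z0 zy.
rewrite /ellw mulrC ler_pdivlMr ?sqrtr_gt0 ?normr_gt0 ?gt_eqF// mul1r.
rewrite -[leRHS](gtr0_norm y0) -(sqrtr_sqr y) ler_wsqrtr// (gtr0_norm q0) /ellq.
have [zy1 y1] := andP zy.
have y2 : y ^+ 2 <= 1 by rewrite expr_le1// ltW.
rewrite (le_trans (ler_piMl _ _)) ?subr_ge0 ?ler_pXn2r ?nnegrE ?ltW//.
  by rewrite ltrBlDr ltrDl exprn_gt0.
by rewrite ltrBlDr ltrDl exprn_gt0.
Qed.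

(** The involution x -> z / x preserves the weight and fixes sqrt z. *)
Lemma ellJ_invol z : 0 < z < 1 -> ellJ z z (Num.sqrt z) = ellJ z (Num.sqrt z) 1.
Proof.
move=> /andP[z0 z1]; have s0 : 0 < Num.sqrt z by rewrite sqrtr_gt0.
have s1 : Num.sqrt z < 1 by rewrite -[ltRHS]sqrtr1 ltr_sqrt.
have zs : z < Num.sqrt z.
  by rewrite -{1}[z]sqr_sqrtr ?ltW// expr2 gtr_pMr.
have dE (x : R) : Num.sqrt z < x < 1 -> is_derive x 1 (fun x => z / x) (- (z / x ^+ 2)).
  move=> /andP[sx _]; have x0 : x != 0 by rewrite gt_eqF// (lt_trans s0).
  have H := is_derive_div (is_derive_cst z x (1:R)) (is_derive_id x (1:R)) x0.
  by apply: (is_derive_eq1 H); rewrite /=; field.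
have pos x : Num.sqrt z <= x -> x != 0.
  by move=> sx; rewrite gt_eqF// (lt_le_trans s0).
have H := @ellJ_subst_decr R (fun x => z / x) (fun x => - (z / x ^+ 2)) z z (Num.sqrt z) 1 1 ltr01 s1 _ dE.
rewrite divr1 (_ : z / Num.sqrt z = Num.sqrt z) in H; last first.
  by rewrite -{1}[z]sqr_sqrtr ?ltW// expr2 mulfK// gt_eqF.
rewrite mul1e in H; apply: H.
- move=> x /andP[/pos x0 _]; apply: cvgM; first exact: cvg_cst.
  by apply: cvgV => //; exact: cvg_id.
- move=> x /andP[/ltW/pos x0 _]; apply: cvgN; apply: cvgM; first exact: cvg_cst.
  by apply: cvgV; [rewrite expf_neq0|exact: exprn_continuous].
- by move=> x /andP[/ltW/pos x0 _]; rewrite oppr_lt0 divr_gt0// exprn_even_gt0.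
- by move=> x /andP[sx x1]; rewrite ellq_neq0_out// x1 (lt_trans zs).
- by move=> x /andP[zx xs]; rewrite ellq_neq0_out// zx (lt_trans xs).
- move=> x /andP[/ltW/pos x0 _]; rewrite expr1n mul1r sqrrN.
  rewrite -(ger0_norm (sqr_ge0 (z / x ^+ 2))) -normrM; congr `|_|.
  by rewrite /ellq; field.
Qed.

(** By ellJ_invol it suffices to treat ]z, sqrt z[, which stays away from the
    singularity at 1. The substitution x = z cosh u turns the weight there
    into 1 / sqrt(1 - x^2), which is at most 1 / sqrt(1 - 2z). *)
Lemma ellJ_le_ln z : 0 < z < 4^-1 ->
  (ellJ z z 1 <= ((2 * ln 2 - ln z) / Num.sqrt (1 - 2 * z))%:E)%E.
Proof.
move=> /andP[z0 z4].
have z1 : z < 1 by rewrite (lt_trans z4)// invf_lt1// ltr1n.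
have s0 : 0 < Num.sqrt z by rewrite sqrtr_gt0.
have s1 : Num.sqrt z < 1 by rewrite -[ltRHS]sqrtr1 ltr_sqrt.
have s2 : Num.sqrt z ^+ 2 = z by rewrite sqr_sqrtr// ltW.
have zs : z < Num.sqrt z.
  by rewrite -{1}s2 expr2 gtr_pMr.
rewrite (ellJ_split zs s1); first last.
- by move=> x /andP[x0 x1]; rewrite ellq_neq0_out// x1 (lt_trans zs).
- by move=> x /andP[x0 x1]; rewrite ellq_neq0_out// x0 (lt_trans x1).
rewrite -ellJ_invol ?z0//.
(* U is slightly larger than the u with z cosh u = sqrt z, and is simpler; 2 U
   is the logarithmic term of the bound. *)
pose U := ln 2 - ln (Num.sqrt z).
have UE : 2 * U = 2 * ln 2 - ln z.
  have -> : ln z = ln (Num.sqrt z) *+ 2 by rewrite -lnXn// s2.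
  by rewrite /U; ring.
have U0 : 0 < U.
  by rewrite subr_gt0 ltr_ln ?posrE// (lt_trans s1)// ltr1n.
have eU : expR U = 2 / Num.sqrt z by rewrite expRB !lnK ?posrE.
pose f u := z * (expR u + expR (- u)) / 2.
pose df u := z * (expR u - expR (- u)) / 2.
have dNexp u : is_derive u 1 (fun u => expR (- u)) (- expR (- u)).
  have dN : is_derive u 1 (fun u : R => - u) (-1) by exact: is_deriveN (is_derive_id u (1:R)).
  have H := is_derive_chain dN (is_derive_expR (- u)).
  by apply: (is_derive_eq1 H); rewrite mulrN1.
have dfE u : is_derive u 1 f (df u).
  have H := is_derive_mul (is_derive_mul (is_derive_cst z u (1:R))
    (is_deriveD (is_derive_expR u) (dNexp u))) (is_derive_cst (2^-1 : R) u (1:R)).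
  by apply: (is_derive_eq1 H); rewrite /df !fctE; ring.
have ddfE u : is_derive u 1 df (f u).
  have H := is_derive_mul (is_derive_mul (is_derive_cst z u (1:R))
    (is_deriveB (is_derive_expR u) (dNexp u))) (is_derive_cst (2^-1 : R) u (1:R)).
  by apply: (is_derive_eq1 H); rewrite /f !fctE; ring.
have cf u : {for u, continuous f} by exact: is_derive_continuous (dfE u).
have cdf u : {for u, continuous df} by exact: is_derive_continuous (ddfE u).
have df0 u : 0 < u -> 0 < df u.
  move=> u0; rewrite divr_gt0// mulr_gt0// subr_gt0 ltr_expR.
  by rewrite (lt_trans _ u0)// oppr_lt0.
have f2 u : f u ^+ 2 - z ^+ 2 = df u ^+ 2.
  have := expRxMexpNx_1 u; rewrite /f /df; move: (expR u) (expR (- u)) => p q pq.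
  transitivity (z ^+ 2 * (p ^+ 2 + q ^+ 2 + 2 * (p * q) - 4 * 1) / 4); first by field.
  by rewrite -{2}pq; field.
have f0 : f 0 = z by rewrite /f oppr0 expR0; field.
have fU : f U = Num.sqrt z * (1 + z / 4).
  rewrite /f expRN eU invf_div; move: (Num.sqrt z) s2 s0 => s <- s_gt0.
  by field; rewrite gt_eqF.
have fU2 : f U ^+ 2 <= 2 * z.
  rewrite fU exprMn s2 mulrC ler_pM2r//.
  by nra.
have sfU : Num.sqrt z < f U by rewrite fU ltr_pMr// ltrDl divr_gt0.
have finc u v : 0 <= u -> u < v -> f u < f v.
  move=> u0 uv; apply: (@pos_derive_lt R f df 0 v) => // w.
  by move=> /andP[w0 _]; exact: df0.
have r0 : 0 < 1 - 2 * z by lra.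
have bound : (ellJ z z (Num.sqrt z) <= (U / Num.sqrt (1 - 2 * z))%:E)%E.
  have fin u : 0 < u < U -> z < f u < 1.
    move=> /andP[u0 uU]; rewrite -{1}f0 finc//=.
    rewrite (lt_le_trans (finc _ _ (ltW u0) uU))//.
    rewrite -(@expr_le1 _ 2)//; first by rewrite (le_trans fU2)//; lra.
    by rewrite (le_trans _ (ltW sfU))// ltW.
  have fU1 : f U <= 1.
    rewrite -(@expr_le1 _ 2)//; first by rewrite (le_trans fU2)//; lra.
    by rewrite (le_trans _ (ltW sfU))// ltW.
  apply: (@le_trans _ _ (ellJ z z (f U))).
    apply: ge0_subset_integral => //=.
    - by apply: ellw_measurable => x /andP[zx xf]; rewrite ellq_neq0_out// zx (lt_le_trans xf).
    - by move=> x _; rewrite lee_fin ellw_ge0.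
    - by move=> x /=; rewrite !in_itv/= => /andP[-> xs]; rewrite (lt_trans xs).
  have H := @ge0_integral_subst_incr R f df (ellw z) 0 U U0.
  rewrite f0 in H; rewrite /ellJ H; first last.
  - by move=> y _; exact: ellw_ge0.
  - by move=> y /andP[y0 y1]; apply: ellw_continuous; rewrite ellq_neq0_out// y0 (lt_le_trans y1).
  - by move=> u /andP[u0 _]; exact: df0.
  - by move=> u _; exact: cdf.
  - by move=> u _; exact: cf.
  rewrite (_ : U / _ = (Num.sqrt (1 - 2 * z))^-1 * (U - 0)); last by rewrite subr0 mulrC.
  rewrite -integral_cst_oo; last exact: ltW.
  have E u : 0 < u < U -> ellw z (f u) * df u = (Num.sqrt (1 - f u ^+ 2))^-1.
    move=> uU; have [u0 _] := andP uU; have [fu0 fu1] := andP (fin u uU).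
    have g0 : 0 < 1 - f u ^+ 2 by rewrite subr_gt0 expr_lt1// ltW// (lt_trans z0).
    have d0 := df0 u u0.
    rewrite /ellw (gtr0_norm (ellq_gt0 z0 (fin u uU))) /ellq f2 (sqrtrM _ (ltW g0)) sqrtr_sqr.
    by rewrite (gtr0_norm d0) invfM mulfVK// gt_eqF.
  apply: ge0_le_integral => //=.
  - move=> u; rewrite in_itv/= => uU; rewrite lee_fin mulr_ge0 ?ellw_ge0//.
    by apply/ltW/df0; case/andP: uU.
  - apply: (@itv_oo_measurable_fun R (fun x => ellw z (f x) * df x)) => x xU.
    apply: continuousM; last exact: cdf.
    apply: continuous_comp; first exact: cf.
    by apply: ellw_continuous; apply: ellq_neq0_out => //; exact: fin.
  move=> u; rewrite inE/= => uU; rewrite lee_fin E//.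
  have [u0 u1] := andP uU; have [fu0 fu1] := andP (fin u uU).
  have g0 : 0 < 1 - f u ^+ 2 by rewrite subr_gt0 expr_lt1// ltW// (lt_trans z0).
  rewrite lef_pV2 ?posrE ?sqrtr_gt0// ler_wsqrtr// lerD2l lerN2.
  have fuU := ltW (finc u U (ltW u0) u1).
  have fu_ge0 : 0 <= f u by rewrite ltW// (lt_trans z0).
  by rewrite (le_trans _ fU2)// ler_pXn2r// nnegrE// (le_trans fu_ge0).
rewrite (le_trans (leeD bound bound))// -EFinD lee_fin -UE.
by rewrite le_eqVlt; apply/orP; left; apply/eqP; ring.
Qed.

End log_bounds.

(** * Bounds of a modulus by its nome *)

Section nome.
Context {R : realType}.
Implicit Types (z x y s : R).

Lemma le_sqrt_of_sqr x y : 0 <= x -> x ^+ 2 <= y -> x <= Num.sqrt y.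
Proof. by move=> x0 xy; rewrite -[leLHS](ger0_norm x0) -sqrtr_sqr ler_wsqrtr. Qed.

Lemma grotzsch_mu_ge z : 0 < z < 1 -> - ln z * (1 - z) <= grotzsch_mu z.
Proof.
move=> z01; have [z0 z1] := andP z01; rewrite /grotzsch_mu.
have K0 := ellipticK_gt0 z01.
have /andP[_ Kle] := ellipticK_bounds z01.
have := ellJ_ge_ln z01; rewrite ellJ_ellipticK'// lee_fin => K'ge.
have r0 : 0 < 1 - z ^+ 2 by rewrite subr_gt0 expr_lt1// ltW.
have sge : 1 - z <= Num.sqrt (1 - z ^+ 2).
  by apply: le_sqrt_of_sqr; [lra|nra].
have lnz : 0 <= - ln z by rewrite oppr_ge0 ltW// ln_lt0.
rewrite mulrA ler_pdivlMr//.
apply: (@le_trans _ _ (- ln z * Num.sqrt (1 - z ^+ 2) * ellipticK z)).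
  by rewrite ler_pM2r// ler_wpM2l.
apply: (@le_trans _ _ (- ln z * (pi / 2))); last by rewrite mulrC ler_wpM2l// divr_ge0// pi_ge0.
by rewrite -mulrA ler_wpM2l// mulrC -ler_pdivlMr// sqrtr_gt0.
Qed.

Lemma grotzsch_mu_le z : 0 < z < 4^-1 ->
  grotzsch_mu z * (1 - 2 * z) <= 2 * ln 2 - ln z.
Proof.
move=> z04; have [z0 z4] := andP z04.
have z1 : z < 1 by rewrite (lt_trans z4)// invf_lt1// ltr1n.
have z01 : 0 < z < 1 by rewrite z0.
have K0 := ellipticK_gt0 z01.
have [m01 _] := compl_modulus z01.
have K'0 := ellipticK_gt0 m01.
have /andP[Kge _] := ellipticK_bounds z01.
have := ellJ_le_ln z04; rewrite ellJ_ellipticK'// lee_fin => K'le.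
have r0 : 0 < 1 - 2 * z by lra.
have sge : 1 - 2 * z <= Num.sqrt (1 - 2 * z).
  by apply: le_sqrt_of_sqr; [lra|nra].
rewrite ler_pdivlMr ?sqrtr_gt0// in K'le.
apply: le_trans K'le.
apply: ler_pM.
- by rewrite /grotzsch_mu mulr_ge0 ?divr_ge0 ?pi_ge0 ?(ltW K0) ?(ltW K'0).
- exact: ltW.
- by rewrite /grotzsch_mu mulrCA -[leRHS]mulr1 ler_pM2l// ler_pdivrMr// mul1r.
- exact: sge.
Qed.

(** The transformation with k = 1, applied to the complementary modulus
    l = sqrt(1 - z^2). The values at the two nodes 1 and l determine c_0 =
    sqrt l and M = (1 - sqrt l) / (1 + sqrt l), and s = M. *)
Lemma quartic_step z : 0 < z < 1 -> exists s, [/\ 0 < s < 1, s <= z ^+ 2,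
  z ^+ 2 = 8 * s * (1 + s ^+ 2) / (1 + s) ^+ 4 &
  grotzsch_mu (s ^+ 2) = 4 * grotzsch_mu z].
Proof.
move=> z01; have [l01 l2] := compl_modulus z01; have [z0 z1] := andP z01.
set l := Num.sqrt _ in l01 l2; have [l0 l1] := andP l01.
have lz : Num.sqrt (1 - l ^+ 2) = z.
  by rewrite l2 opprB addrCA subrr addr0 sqrtr_sqr gtr0_norm.
have [c [t [M E]]] := equioscillation_nodes l01 (ltn0Sn 0).
have K := ellipticK_transform E; rewrite lz mulr1 in K.
have M01 := eqo_M E; have [M0 M1] := andP M01.
have ct := eqo_ct E (ltn0Sn 0); rewrite (eqo_t0 E) (eqo_tk E) in ct.
have [lc c1] := andP ct; set d := c 0%N in lc c1.
have v0 := eqo_values E (leq0n 1); have v1 := eqo_values E (leqnn 1).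
rewrite (eqo_t0 E) horner_zeros_poly horner_poles_poly !big_nat1 in v0.
rewrite (eqo_tk E) horner_zeros_poly horner_poles_poly !big_nat1 in v1.
rewrite -/d in v0 v1.
have d0 : 0 < d by exact: lt_trans lc.
have e0 : 1 - d = M * (1 + d).
  apply/eqP; rewrite -(@eqrXn2 _ 2)//; last 2 first.
    by rewrite subr_ge0 ltW.
    by rewrite mulr_ge0 ?addr_ge0 ?ltW.
  by rewrite exprMn -sqrrN opprB v0 addrC.
have e1 : d - l = M * (d + l).
  apply/eqP; rewrite -(@eqrXn2 _ 2)//; last 2 first.
    by rewrite subr_ge0 ltW.
    by rewrite mulr_ge0 ?addr_ge0 ?ltW.
  by rewrite exprMn v1.
have Mp : 1 + M != 0 by rewrite gt_eqF// addr_gt0.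
have dE : d = (1 - M) / (1 + M) by apply: (mulIf Mp); rewrite divfK//; lra.
have lE : l = ((1 - M) / (1 + M)) ^+ 2.
  by apply: (mulIf Mp); rewrite expr2 mulrA divfK// -dE; nra.
have zE : z ^+ 2 = 8 * M * (1 + M ^+ 2) / (1 + M) ^+ 4.
  have -> : z ^+ 2 = 1 - l ^+ 2 by rewrite l2; ring.
  by rewrite lE; field.
exists M; split => //.
  rewrite zE ler_pdivlMr ?exprn_gt0 ?addr_gt0//.
  rewrite (mulrC 8) -mulrA ler_pM2l//.
  have h1 : (1 + M) ^+ 2 <= 4 by nra.
  have h2 : (1 + M) ^+ 2 <= 2 * (1 + M ^+ 2) by have := sqr_ge0 (1 - M); nra.
  rewrite (_ : (1 + M) ^+ 4 = (1 + M) ^+ 2 * (1 + M) ^+ 2); last by rewrite -exprD.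
  rewrite (_ : 8 * _ = 4 * (2 * (1 + M ^+ 2))); last by ring.
  by apply: ler_pM => //; exact: sqr_ge0.
rewrite /grotzsch_mu K -/l; ring.
Qed.

Definition nome_upper y : R := 4 * y / (1 + y ^+ 2) ^+ 2.
Definition nome_lower y : R := 4 * y / (1 + y ^+ 2) ^+ 4.

(** A Landen step applied to the upper bound at y^2 stays below the upper
    bound at y; with q = y^2 this reduces to
    (1 + q)^2 (1 + q^2) <= (1 + q^2)^2 + 4 q. *)
Lemma landen_upper_key y : 0 < y < 1 ->
  4 * nome_upper (y ^+ 2) <= nome_upper y ^+ 2 * (1 + nome_upper (y ^+ 2)) ^+ 2.
Proof.
move=> /andP[y0 y1]; rewrite /nome_upper.
have y20 : 0 < y ^+ 2 by rewrite exprn_gt0.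
have y21 : y ^+ 2 < 1 by rewrite expr_lt1// ltW.
move: y20 y21; have -> : (4 * y / (1 + y ^+ 2) ^+ 2) ^+ 2 = 16 * y ^+ 2 / (1 + y ^+ 2) ^+ 4.
  by field; rewrite gt_eqF// addr_gt0// exprn_gt0.
move: (y ^+ 2) => q q0 q1.
have q2 : 0 < q ^+ 2 by rewrite exprn_gt0.
have a0 : 0 < 1 + q by rewrite addr_gt0.
have d0 : 0 < 1 + q ^+ 2 by rewrite addr_gt0.
have h : (1 + q) ^+ 2 * (1 + q ^+ 2) <= (1 + q ^+ 2) ^+ 2 + 4 * q.
  rewrite -subr_ge0 (_ : _ - _ = 2 * q * (1 - q ^+ 2)); last by ring.
  by rewrite !mulr_ge0 ?ltW// subr_gt0 expr_lt1// ltW.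
have h2 : ((1 + q) ^+ 2 * (1 + q ^+ 2)) ^+ 2 <= ((1 + q ^+ 2) ^+ 2 + 4 * q) ^+ 2.
  by rewrite ler_pXn2r// nnegrE ?(le_trans _ h)// mulr_ge0 ?exprn_ge0// ltW.
rewrite -subr_ge0.
rewrite (_ : _ - _ = 16 * q / ((1 + q) ^+ 4 * (1 + q ^+ 2) ^+ 4) *
  (((1 + q ^+ 2) ^+ 2 + 4 * q) ^+ 2 - ((1 + q) ^+ 2 * (1 + q ^+ 2)) ^+ 2)).
  by rewrite mulr_ge0 ?subr_ge0// divr_ge0 ?mulr_ge0 ?exprn_ge0// ltW.
by field; rewrite !gt_eqF.
Qed.

(** The opposite comparison for the lower bound; with q = y^2 it reduces to
    (1 + q^2)^4 + 4 q <= (1 + q)^4 (1 + q^2)^2. *)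
Lemma landen_lower_key y : 0 < y < 1 ->
  nome_lower y ^+ 2 * (1 + nome_lower (y ^+ 2)) ^+ 2 <= 4 * nome_lower (y ^+ 2).
Proof.
move=> /andP[y0 y1]; rewrite /nome_lower.
have y20 : 0 < y ^+ 2 by rewrite exprn_gt0.
have y21 : y ^+ 2 < 1 by rewrite expr_lt1// ltW.
move: y20 y21; have -> : (4 * y / (1 + y ^+ 2) ^+ 4) ^+ 2 = 16 * y ^+ 2 / (1 + y ^+ 2) ^+ 8.
  by field; rewrite gt_eqF// addr_gt0// exprn_gt0.
move: (y ^+ 2) => q q0 q1.
have q2 : 0 < q ^+ 2 by rewrite exprn_gt0.
have a0 : 0 < 1 + q by rewrite addr_gt0.
have d0 : 0 < 1 + q ^+ 2 by rewrite addr_gt0.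
have h : (1 + q ^+ 2) ^+ 4 + 4 * q <= (1 + q) ^+ 4 * (1 + q ^+ 2) ^+ 2.
  rewrite -subr_ge0 (_ : _ - _ = 4 * q * ((1 + q ^+ 2) ^+ 3 - 1) + 4 * q ^+ 2 * (1 + q ^+ 2) ^+ 2); last by ring.
  apply: addr_ge0.
    rewrite mulr_ge0//; first by rewrite mulr_ge0// ltW.
    by rewrite subr_ge0 exprn_ege1// lerDl ltW.
  by rewrite mulr_ge0 ?exprn_ge0 ?(ltW d0)// mulr_ge0// ltW.
have h2 : ((1 + q ^+ 2) ^+ 4 + 4 * q) ^+ 2 <= ((1 + q) ^+ 4 * (1 + q ^+ 2) ^+ 2) ^+ 2.
  by rewrite ler_pXn2r// nnegrE ?addr_ge0 ?mulr_ge0 ?exprn_ge0// ltW.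
rewrite -subr_ge0.
rewrite (_ : _ - _ = 16 * q / ((1 + q) ^+ 8 * (1 + q ^+ 2) ^+ 8) *
  (((1 + q) ^+ 4 * (1 + q ^+ 2) ^+ 2) ^+ 2 - ((1 + q ^+ 2) ^+ 4 + 4 * q) ^+ 2)).
  by rewrite mulr_ge0 ?subr_ge0// divr_ge0 ?mulr_ge0 ?exprn_ge0// ltW.
by field; rewrite !gt_eqF.
Qed.

Lemma nome_upper_gt0 y : 0 < y -> 0 < nome_upper y.
Proof.
move=> y0; have d0 : 0 < 1 + y ^+ 2 by rewrite addr_gt0// exprn_gt0.
by rewrite divr_gt0 ?mulr_gt0// exprn_gt0.
Qed.

Lemma nome_lower_gt0 y : 0 < y -> 0 < nome_lower y.
Proof.
move=> y0; have d0 : 0 < 1 + y ^+ 2 by rewrite addr_gt0// exprn_gt0.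
by rewrite divr_gt0 ?mulr_gt0// exprn_gt0.
Qed.

(** The map t -> 4 t / (1 + t)^2 of a Landen step increases only up to t = 1,
    so the case of a bound above 1 is treated apart in landen_upper. *)
Lemma nome_upper_ge1 y : 0 < y < 1 -> 1 < nome_upper (y ^+ 2) -> 1 <= nome_upper y.
Proof.
move=> /andP[y0 y1].
have q0 : 0 < y ^+ 2 by rewrite exprn_gt0.
have q1 : y ^+ 2 <= y by rewrite expr2 ger_pMr// ltW.
have d0 : 0 < 1 + y ^+ 2 ^+ 2 by rewrite addr_gt0// exprn_gt0.
rewrite /nome_upper ltr_pdivlMr ?exprn_gt0// mul1r => h.
rewrite ler_pdivlMr ?exprn_gt0 ?addr_gt0// mul1r.
have h2 : 1 + y ^+ 2 ^+ 2 < 2 * y.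
  rewrite -(@ltr_pXn2r _ 2)// ?nnegrE ?mulr_ge0 ?ltW//.
  by rewrite (lt_le_trans h)// le_eqVlt; apply/orP; left; apply/eqP; ring.
by nra.
Qed.

(** Read x1 and y^2 as modulus and nome before a Landen step, x and y as those
    after it: going back squares the factor by which the upper bound is
    violated. *)
Lemma landen_upper (x x1 y B : R) : 0 < x < 1 -> 0 < x1 < 1 -> 0 < y < 1 -> 1 <= B ->
  x ^+ 2 = 4 * x1 / (1 + x1) ^+ 2 ->
  B * nome_upper y < x -> B ^+ 2 * nome_upper (y ^+ 2) < x1.
Proof.
move=> /andP[x0 xlt1] /andP[x10 x11] y01 B1 xE Bx; have [y0 y1] := andP y01.
rewrite ltNge; apply/negP => x1le.
have key := landen_upper_key y01; have big := nome_upper_ge1 y01.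
have U0 := nome_upper_gt0 y0; have U10 := nome_upper_gt0 (exprn_gt0 2 y0).
move: (nome_upper y) (nome_upper (y ^+ 2)) key big U0 U10 Bx x1le.
move=> U U1 key big U0 U10 Bx x1le.
have B0 : 0 < B by rewrite (lt_le_trans ltr01).
have Bx2 : B ^+ 2 * U ^+ 2 < x ^+ 2.
  by rewrite -exprMn ltr_pXn2r// nnegrE ltW// mulr_gt0.
have B2 : 1 <= B ^+ 2 by rewrite exprn_ege1.
have s0 : 0 < (1 + x1) ^+ 2 by rewrite exprn_gt0// addr_gt0.
have xE2 : x ^+ 2 * (1 + x1) ^+ 2 = 4 * x1 by rewrite xE divfK// gt_eqF.
suff : 4 * x1 <= B ^+ 2 * U ^+ 2 * (1 + x1) ^+ 2.
  by rewrite -xE2 ler_pM2r// leNgt Bx2.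
case: (leP x1 U1) => h; last first.
  apply: (@le_trans _ _ (B ^+ 2 * (4 * U1))); first by lra.
  rewrite -mulrA ler_pM2l ?exprn_gt0// (le_trans key)// ler_pM2l ?exprn_gt0//.
  by rewrite ler_pXn2r ?nnegrE ?addr_ge0 ?ltW//; lra.
case: (leP U1 1) => h1; last first.
  by have := big h1; nra.
apply: (@le_trans _ _ (U ^+ 2 * (1 + x1) ^+ 2)); last first.
  by rewrite ler_pM2r// ler_peMl// ?exprn_ge0// ltW.
have t0 : 0 < (1 + U1) ^+ 2 by rewrite exprn_gt0// addr_gt0.
rewrite -(ler_pM2r t0).
apply: (@le_trans _ _ (4 * U1 * (1 + x1) ^+ 2)).
  rewrite -subr_ge0 (_ : _ - _ = 4 * ((U1 - x1) * (1 - x1 * U1))); last by ring.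
  by rewrite !mulr_ge0// subr_ge0// (mulr_ile1 (ltW x10) (ltW U10) (ltW x11)).
by rewrite [leRHS]mulrAC ler_pM2r.
Qed.

(** A violation of the lower bound is amplified in the same way. *)
Lemma landen_lower (x x1 y B : R) : 0 < x < 1 -> 0 < x1 < 1 -> 0 < y < 1 -> 1 <= B ->
  x ^+ 2 = 4 * x1 / (1 + x1) ^+ 2 ->
  B * x < nome_lower y -> B ^+ 2 * x1 < nome_lower (y ^+ 2).
Proof.
move=> /andP[x0 xlt1] /andP[x10 x11] y01 B1 xE Bx; have [y0 y1] := andP y01.
rewrite ltNge; apply/negP => x1ge.
have key := landen_lower_key y01.
have L0 := nome_lower_gt0 y0; have L10 := nome_lower_gt0 (exprn_gt0 2 y0).
move: (nome_lower y) (nome_lower (y ^+ 2)) key L0 L10 Bx x1ge.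
move=> L L1 key L0 L10 Bx x1ge.
have B0 : 0 < B by rewrite (lt_le_trans ltr01).
have Bx2 : B ^+ 2 * x ^+ 2 < L ^+ 2.
  by rewrite -exprMn ltr_pXn2r// nnegrE ltW// mulr_gt0.
have B2 : 1 <= B ^+ 2 by rewrite exprn_ege1.
have s0 : 0 < (1 + x1) ^+ 2 by rewrite exprn_gt0// addr_gt0.
have t0 : 0 < (1 + L1) ^+ 2 by rewrite exprn_gt0// addr_gt0.
have xE2 : x ^+ 2 * (1 + x1) ^+ 2 = 4 * x1 by rewrite xE divfK// gt_eqF.
suff : L ^+ 2 * (1 + x1) ^+ 2 <= B ^+ 2 * (4 * x1).
  by rewrite -xE2 mulrA ler_pM2r// leNgt Bx2.
case: (leP L1 x1) => h; last first.
  apply: (@le_trans _ _ (4 * L1)); last by lra.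
  rewrite (le_trans _ key)// ler_pM2l ?exprn_gt0//.
  by rewrite ler_pXn2r ?nnegrE ?addr_ge0 ?ltW//; lra.
apply: (@le_trans _ _ (4 * x1)); last by rewrite ler_peMl// mulr_ge0// ltW.
rewrite -(ler_pM2r t0).
apply: (@le_trans _ _ (4 * L1 * (1 + x1) ^+ 2)).
  by rewrite mulrAC ler_pM2r.
rewrite -subr_ge0 (_ : _ - _ = 4 * ((x1 - L1) * (1 - x1 * L1))); last by ring.
rewrite !mulr_ge0// subr_ge0// (mulr_ile1 (ltW x10) (ltW L10) (ltW x11))//.
exact: le_trans (ltW x11).
Qed.

Definition grotzsch_nome z : R := expR (- grotzsch_mu z).

Lemma grotzsch_mu_gt0 z : 0 < z < 1 -> 0 < grotzsch_mu z.
Proof.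
move=> z01; have [m01 _] := compl_modulus z01.
by rewrite /grotzsch_mu mulr_gt0 ?divr_gt0 ?pi_gt0// ellipticK_gt0.
Qed.

Lemma grotzsch_nome01 z : 0 < z < 1 -> 0 < grotzsch_nome z < 1.
Proof. by move=> /grotzsch_mu_gt0 mu0; rewrite expR_gt0 expR_lt1 oppr_lt0. Qed.

(** The map of quartic_step is two Landen steps, through the intermediate
    modulus w = 2 s / (1 + s^2), so a violation by a factor B becomes a
    violation by B^4. *)
Lemma quartic_bounds z : 0 < z < 1 -> exists z', [/\ 0 < z' < 1, z' <= z ^+ 4,
  grotzsch_mu z' = 4 * grotzsch_mu z,
  forall B, 1 <= B -> B * nome_upper (grotzsch_nome z) < z ->
    B ^+ 4 * nome_upper (grotzsch_nome z') < z' &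
  forall B, 1 <= B -> B * z < nome_lower (grotzsch_nome z) ->
    B ^+ 4 * z' < nome_lower (grotzsch_nome z')].
Proof.
move=> z01; have [s [s01 sz zE muE]] := quartic_step z01.
have [s0 s1] := andP s01; have [z0 z1] := andP z01.
have y01 := grotzsch_nome01 z01; have [y0 y1] := andP y01.
have y4 : grotzsch_nome (s ^+ 2) = (grotzsch_nome z ^+ 2) ^+ 2.
  by rewrite -exprM /grotzsch_nome muE -mulrN expRM_natl.
have y201 : 0 < grotzsch_nome z ^+ 2 < 1 by rewrite exprn_gt0//= expr_lt1// ltW.
have d0 : 0 < 1 + s ^+ 2 by rewrite addr_gt0// exprn_gt0.
pose w := 2 * s / (1 + s ^+ 2).
have w01 : 0 < w < 1.
  rewrite divr_gt0 ?mulr_gt0//= ltr_pdivrMr// mul1r.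
  by have : 0 < (1 - s) ^+ 2 by [rewrite exprn_gt0// subr_gt0]; clear; lra.
have s201 : 0 < s ^+ 2 < 1 by rewrite exprn_gt0//= expr_lt1// ltW.
have w1 : 1 + w != 0 by case/andP: w01 => w0 _; rewrite gt_eqF// addr_gt0.
have zw : z ^+ 2 = 4 * w / (1 + w) ^+ 2.
  have s1' : 0 < 1 + s by rewrite addr_gt0.
  have -> : 1 + w = (1 + s) ^+ 2 / (1 + s ^+ 2) by rewrite /w; field; rewrite gt_eqF.
  by rewrite zE /w; field; rewrite !gt_eqF.
have ws : w ^+ 2 = 4 * s ^+ 2 / (1 + s ^+ 2) ^+ 2.
  by rewrite /w; field; rewrite gt_eqF.
exists (s ^+ 2); split; [exact: s201| |exact: muE| |].
- have -> : z ^+ 4 = (z ^+ 2) ^+ 2 by rewrite -exprM.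
  by rewrite ler_pXn2r// nnegrE ?(ltW s0)// exprn_ge0// ltW.
- move=> B B1 Bz; have -> : B ^+ 4 = (B ^+ 2) ^+ 2 by rewrite -exprM.
  rewrite y4.
  apply: (landen_upper w01 s201 y201 _ ws); first by rewrite exprn_ege1.
  exact: (landen_upper z01 w01 y01 B1 zw).
- move=> B B1 Bz; have -> : B ^+ 4 = (B ^+ 2) ^+ 2 by rewrite -exprM.
  rewrite y4.
  apply: (landen_lower w01 s201 y201 _ ws); first by rewrite exprn_ege1.
  exact: (landen_lower z01 w01 y01 B1 zw).
Qed.

Lemma quartic_bounds_iter z n : 0 < z < 1 -> exists z', [/\ 0 < z' < 1, z' <= z ^+ (4 ^ n),
  grotzsch_mu z' = (4 ^ n)%:R * grotzsch_mu z,
  forall B, 1 <= B -> B * nome_upper (grotzsch_nome z) < z ->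
    B ^+ (4 ^ n) * nome_upper (grotzsch_nome z') < z' &
  forall B, 1 <= B -> B * z < nome_lower (grotzsch_nome z) ->
    B ^+ (4 ^ n) * z' < nome_lower (grotzsch_nome z')].
Proof.
move=> z01; have [z0 z1] := andP z01.
elim: n => [|n [w [w01 wz wmu wu wl]]].
  by exists z; split => //; rewrite ?mul1r.
have [v [v01 vw vmu vu vl]] := quartic_bounds w01.
exists v; split; first exact: v01.
- rewrite (le_trans vw)// expnSr exprM ler_pXn2r// nnegrE ?exprn_ge0 ?ltW//.
  by case/andP: w01.
- by rewrite vmu wmu expnS natrM mulrA.
- by move=> B B1 /(wu _ B1) /vu; rewrite expnSr exprM; apply; rewrite exprn_ege1.
- by move=> B B1 /(wl _ B1) /vl; rewrite expnSr exprM; apply; rewrite exprn_ege1.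
Qed.

(** As z^(4^n) tends to 0, the term 4^n b outweighs both the constant and the
    other multiple of 4^n. *)
Lemma quartic_limit z (A b D : R) : 0 < z < 1 -> 0 <= A -> 0 < b ->
  exists n, z ^+ (4 ^ n) < 4^-1 /\
    D + A * ((4 ^ n)%:R * z ^+ (4 ^ n)) < (4 ^ n)%:R * b.
Proof.
move=> /andP[z0 z1] A0 b0.
pose e := Num.min 4^-1 (b / (2 * (A + 1))).
have A1 : 0 < 2 * (A + 1) by rewrite mulr_gt0// ltr_wpDl.
have e0 : 0 < e by rewrite lt_min invr_gt0 ltr0n/= divr_gt0.
have [N _ HN] : \forall n \near \oo, z ^+ n < e.
  have zn : `|z| < 1 by rewrite gtr0_norm.
  have /cvgr_lt := cvg_expr zn; apply; exact: e0.
pose n := maxn N (Num.trunc (`|D| * 2 / b)).+1.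
have n4 : (n <= 4 ^ n)%N by rewrite ltnW// ltn_expl.
exists n.
have zn : z ^+ (4 ^ n) < e by apply: HN => /=; rewrite (leq_trans _ n4)// leq_maxl.
have [ze1 ze2] : z ^+ (4 ^ n) < 4^-1 /\ z ^+ (4 ^ n) < b / (2 * (A + 1)).
  by split; apply: (lt_le_trans zn); rewrite ge_min lexx ?orbT.
split => //.
have Dn : `|D| * 2 / b < (4 ^ n)%:R.
  by rewrite (lt_le_trans (truncnS_gt _))// ler_nat (leq_trans _ n4)// leq_maxr.
rewrite ltr_pdivrMr// in Dn; rewrite ltr_pdivlMr// in ze2.
have N0 : 0 < (4 ^ n)%:R :> R by rewrite ltr0n expn_gt0.
have zp : 0 < z ^+ (4 ^ n) by rewrite exprn_gt0.
have DD := ler_norm D.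
move: ((4 ^ n)%:R : R) (z ^+ (4 ^ n)) N0 zp Dn ze2 => m q m0 q0 h1 h2.
have h3 : m * (q * (2 * (A + 1))) < m * b by rewrite ltr_pM2l.
have h4 : 0 < m * q by rewrite mulr_gt0.
by nra.
Qed.

Lemma nome_le_upper y : 0 < y < 1 -> y <= nome_upper y.
Proof.
move=> /andP[y0 y1].
have d0 : 0 < 1 + y ^+ 2 by rewrite addr_gt0// exprn_gt0.
rewrite ler_pdivlMr ?exprn_gt0// mulrC ler_pM2r// (_ : 4 = 2 ^+ 2); last by ring.
rewrite ler_pXn2r// ?nnegrE ?(ltW d0)//.
by have : y ^+ 2 <= 1 by [rewrite expr_le1// ltW]; lra.
Qed.

Lemma nome_lower_le y : 0 < y < 1 -> nome_lower y <= 4 * y.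
Proof.
move=> /andP[y0 y1].
have d0 : 0 < 1 + y ^+ 2 by rewrite addr_gt0// exprn_gt0.
rewrite ler_pdivrMr ?exprn_gt0// ler_peMr ?mulr_ge0 ?(ltW y0)//.
by rewrite exprn_ege1// lerDl sqr_ge0.
Qed.

(** If z exceeded the bound by a factor B > 1, then at the n-th iterate w one
    would have ln w + mu(w) > 4^n ln B, whereas mu(w) + ln w stays below
    2 ln 2 + 2 w mu(w) by grotzsch_mu_le, and w mu(w) is negligible against
    4^n. *)
Lemma le_nome_upper z : 0 < z < 1 -> z <= nome_upper (grotzsch_nome z).
Proof.
move=> z01; rewrite leNgt; apply/negP => zU.
have [z0 z1] := andP z01; have [y0 y1] := andP (grotzsch_nome01 z01).
have U0 := nome_upper_gt0 y0.
(* Halfway between 1 and the actual factor, so that both inequalities are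
   strict. *)
pose B := (1 + z / nome_upper (grotzsch_nome z)) / 2.
have BU : B * nome_upper (grotzsch_nome z) < z.
  rewrite (_ : _ * _ = (nome_upper (grotzsch_nome z) + z) / 2); first by lra.
  by rewrite /B; field; rewrite gt_eqF.
have B1 : 1 < B.
  have : 1 < z / nome_upper (grotzsch_nome z) by rewrite ltr_pdivlMr// mul1r.
  by rewrite /B; lra.
have mu0 := grotzsch_mu_gt0 z01.
have [n [zn4 lim]] := quartic_limit (2 * ln 2) z01 (ltW (mulr_gt0 (ltr0n R 2) mu0)) (ln_gt0 B1).
have [w [w01 wz wmu wu _]] := quartic_bounds_iter n z01.
have [w0 w1] := andP w01.
have Bw := wu _ (ltW B1) BU.
have [v0 v1] := andP (grotzsch_nome01 w01).
have vU := nome_le_upper (grotzsch_nome01 w01).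
have B0 : 0 < B ^+ (4 ^ n) by rewrite exprn_gt0// (lt_trans ltr01).
have lw : (4 ^ n)%:R * ln B - (4 ^ n)%:R * grotzsch_mu z < ln w.
  have : B ^+ (4 ^ n) * grotzsch_nome w < w by rewrite (le_lt_trans _ Bw)// ler_pM2l.
  rewrite -ltr_ln ?posrE ?mulr_gt0// lnM ?posrE// lnXn ?(lt_trans ltr01)//.
  by rewrite /grotzsch_nome expRK wmu -[ln B *+ _]mulr_natl.
have w4 : 0 < w < 4^-1 by rewrite w0 (le_lt_trans wz).
have := grotzsch_mu_le w4; rewrite wmu.
have N0 : 0 < (4 ^ n)%:R :> R by rewrite ltr0n expn_gt0.
have h : (4 ^ n)%:R * grotzsch_mu z * w <= (4 ^ n)%:R * grotzsch_mu z * z ^+ (4 ^ n).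
  by rewrite ler_pM2l// mulr_gt0.
move: lim lw h; move: ((4 ^ n)%:R : R) (z ^+ (4 ^ n)) (grotzsch_mu z) (ln B) (ln w) => m q g b x.
by move=> h1 h2 h3 h4; clear -h1 h2 h3 h4; lra.
Qed.

(** As for the upper bound, but with the estimate of mu from below: a
    violation would force ln w + mu(w) < 2 ln 2 - 4^n ln B at the n-th
    iterate w. *)
Lemma ge_nome_lower z : 0 < z < 1 -> nome_lower (grotzsch_nome z) <= z.
Proof.
move=> z01; rewrite leNgt; apply/negP => zL.
have [z0 z1] := andP z01; have [y0 y1] := andP (grotzsch_nome01 z01).
have L0 := nome_lower_gt0 y0.
(* Halfway between 1 and the actual factor, so that both inequalities are
   strict. *)
pose B := (1 + nome_lower (grotzsch_nome z) / z) / 2.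
have BL : B * z < nome_lower (grotzsch_nome z).
  rewrite (_ : _ * _ = (nome_lower (grotzsch_nome z) + z) / 2); first by lra.
  by rewrite /B; field; rewrite gt_eqF.
have B1 : 1 < B.
  have : 1 < nome_lower (grotzsch_nome z) / z by rewrite ltr_pdivlMr// mul1r.
  by rewrite /B; lra.
have mu0 := grotzsch_mu_gt0 z01.
have lB := ln_gt0 B1.
have [n [zn4 lim]] := quartic_limit (2 * ln 2) z01 (ltW (addr_gt0 mu0 lB)) lB.
have [w [w01 wz wmu _ wl]] := quartic_bounds_iter n z01.
have [w0 w1] := andP w01.
have Bw := wl _ (ltW B1) BL.
have [v0 v1] := andP (grotzsch_nome01 w01).
have vL := nome_lower_le (grotzsch_nome01 w01).
have B0 : 0 < B ^+ (4 ^ n) by rewrite exprn_gt0// (lt_trans ltr01).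
have lw : (4 ^ n)%:R * ln B + ln w < 2 * ln 2 - (4 ^ n)%:R * grotzsch_mu z.
  have : B ^+ (4 ^ n) * w < 4 * grotzsch_nome w by rewrite (lt_le_trans Bw).
  rewrite -ltr_ln ?posrE ?mulr_gt0// lnM ?posrE// [ln (4 * _)]lnM ?posrE//.
  rewrite lnXn ?(lt_trans ltr01)// /grotzsch_nome expRK wmu.
  rewrite (_ : ln 4 = ln 2 *+ 2); last by rewrite -lnXn// -natrX.
  by rewrite -[ln B *+ _]mulr_natl -[ln 2 *+ 2]mulr_natl.
have := grotzsch_mu_ge w01; rewrite wmu.
have N0 : 0 < (4 ^ n)%:R :> R by rewrite ltr0n expn_gt0.
have h : (4 ^ n)%:R * (grotzsch_mu z + ln B) * w <= (4 ^ n)%:R * (grotzsch_mu z + ln B) * z ^+ (4 ^ n).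
  by rewrite ler_pM2l// mulr_gt0// addr_gt0.
have l2 : 0 <= w * ln 2 by rewrite mulr_ge0 ?ltW// ln_gt0// ltr1n.
move: lim lw h l2; move: ((4 ^ n)%:R : R) (z ^+ (4 ^ n)) (grotzsch_mu z) (ln B) (ln w) => m q g b x.
move=> h1 h2 h3 h4 h5.
have h6 : (m * b + m * g - 2 * ln 2) * (1 - w) < - x * (1 - w).
  by rewrite ltr_pM2r ?subr_gt0//; clear -h2; lra.
by clear -h1 h3 h4 h5 h6; lra.
Qed.

End nome.

(** * Optimality by alternation *)

Section alternation.
Context {R : realType}.

(** Each sign change yields a root, and these roots are distinct. *)
Lemma alternation_size (p : {poly R}) (n : nat) (s : nat -> R) :
  p != 0 ->
  (forall j, (j < n)%N -> s j < s j.+1) ->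
  (forall j, (j < n)%N -> p.[s j] * p.[s j.+1] < 0) -> (n < size p)%N.
Proof.
move=> p0 sinc alt.
have ex j : (j < n)%N -> exists x, (s j < x < s j.+1) && root p x.
  move=> jn; have sj := sinc _ jn; have aj := alt _ jn.
  have n0 : p.[s j] != 0 by apply: contraTneq aj => ->; rewrite mul0r ltxx.
  have n1 : p.[s j.+1] != 0 by apply: contraTneq aj => ->; rewrite mulr0 ltxx.
  have [x /andP[x1 x2] px] : exists2 x, s j <= x <= s j.+1 & root p x.
    case: (ltgtP 0 p.[s j]) aj n0 => // [pj|pj] aj _.
      have [|x xj] := @poly_ivt R (- p) (s j) (s j.+1) (ltW sj); last by rewrite rootN; exists x.
      rewrite pmulr_rlt0// in aj.
      by rewrite !hornerN oppr_le0 oppr_ge0 !ltW.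
    have [|x xj px] := @poly_ivt R p (s j) (s j.+1) (ltW sj); last by exists x.
    rewrite nmulr_rlt0// in aj.
    by rewrite !ltW.
  exists x; rewrite px andbT !lt_neqAle x1 x2 !andbT; apply/andP; split.
    by apply: contraNneq n0 => ->.
  by apply: contraNneq n1 => <-.
pose r j := if pselect (exists x, (s j < x < s j.+1) && root p x) is left e
            then sval (cid e) else 0.
have rP j : (j < n)%N -> (s j < r j < s j.+1) && root p (r j).
  by move=> /ex e; rewrite /r; case: pselect => // e'; case: cid.
have rinc i j : (i < j < n)%N -> r i < r j.
  elim: j => // j IH /andP[ij jn].
  have /andP[/andP[_ h1] _] := rP _ (ltnW jn).
  have /andP[/andP[h2 _] _] := rP _ jn.
  have jj := lt_trans h1 h2; move: ij; rewrite ltnS leq_eqVlt => /predU1P[->//|ij].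
  by rewrite (lt_trans (IH _))// ij ltnW.
have -> : n = size [seq r j | j <- iota 0 n] by rewrite size_map size_iota.
apply: max_poly_roots => //.
- by apply/allP => _ /mapP[j + ->]; rewrite mem_iota => /andP[_ /rP/andP[]].
- rewrite map_inj_in_uniq ?iota_uniq// => i j; rewrite !mem_iota !add0n => /andP[_ ni] /andP[_ nj] rij.
  by case: (ltngtP i j) => // ij; [have := @rinc i j|have := @rinc j i]; rewrite rij ltxx ij /= => h; have := h _; rewrite ?ni ?nj => /(_ isT).
Qed.

Variables (l : R) (k : nat) (c t : nat -> R) (M : R).
Hypothesis E : equioscillation l k c t M.
Local Notation P := (zeros_poly k c).
Local Notation Q := (poles_poly k c).
Let Z := M ^+ 2.

(** The decreasing list t_0, c_0, t_1, c_1, ..., c_(k-1), t_k. *)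
Let u (j : nat) : R := if odd j then c j./2 else t j./2.

Let u_decr j : (j < k + k)%N -> u j.+1 < u j.
Proof.
move=> jk; rewrite /u /=; have jk2 : (j./2 < k)%N by clear -jk; lia.
have /andP[h1 h2] := eqo_ct E jk2.
by rewrite uphalf_half; case: (odd j); rewrite /= ?add1n ?add0n.
Qed.

Let u_in j : (j <= k + k)%N -> l <= u j <= 1.
Proof.
move=> jk; rewrite /u; case: ifPn => oj.
  have jk2 : (j./2 < k)%N by clear -jk oj; lia.
  by have /andP[h1 h2] := zero_in E jk2; rewrite !ltW.
have jk2 : (j./2 <= k)%N by clear -jk; lia.
by rewrite (node_ge E jk2) (node_le1 E jk2).
Qed.

(** The increasing list of the opposites of the u j followed by the u j
    themselves. *)
Let s (j : nat) : R := if (j <= k + k)%N then - u j else u (k + k + k + k + 1 - j).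

Let s_incr j : (j < k + k + k + k + 1)%N -> s j < s j.+1.
Proof.
move=> jk; rewrite /s; have l0 := eqo_l E.
case: (ltngtP j (k + k)) => h.
- by rewrite ltrN2 u_decr.
- have -> : (k + k + k + k + 1 - j = (k + k + k + k + 1 - j.+1).+1)%N by clear -jk h; lia.
  by apply: u_decr; clear -jk h; lia.
- rewrite h (_ : (k + k + k + k + 1 - (k + k).+1 = k + k)%N); last by clear; lia.
  have /andP[h1 _] := u_in (leqnn (k + k)).
  have u0 : 0 < u (k + k) by exact: lt_le_trans h1.
  by rewrite (lt_trans _ u0)// oppr_lt0.
Qed.

(** A and B stand for the squared moduli of the numerator and denominator of a
    competitor, scaled so that its bounds on the two intervals are reciprocal.
    The fraction P / Q squared dominates or is dominated alternately at the
    nodes and zeros, so D has 4k + 1 sign changes although its degree is at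
    most 4k. *)
Lemma equioscillation_optimal (A B : {poly R}) (zeta : R) :
  (size A <= k + k + 1)%N -> (size B <= k + k + 1)%N ->
  (forall x, 0 <= A.[x]) -> (forall x, 0 <= B.[x]) -> (forall x, 0 < A.[x] + B.[x]) ->
  0 <= zeta < M ^+ 2 ->
  (forall x, l <= x <= 1 -> A.[- x] <= zeta * B.[- x]) ->
  (forall x, l <= x <= 1 -> B.[x] <= zeta * A.[x]) -> False.
Proof.
move=> sA sB A0 B0 AB /andP[z0 zZ] HE HF.
(* Mixing A and B with weight e makes every weak inequality strict, also at
   common zeros with P or Q; there is room because zeta < M^2. *)
pose e := (M ^+ 2 - zeta) / 2.
have e0 : 0 < e by rewrite divr_gt0// subr_gt0.
have eZ : zeta + e < Z by rewrite /e /Z; lra.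
have [M0 M1] := andP (eqo_M E).
have Z0 : 0 < Z by rewrite exprn_gt0.
pose D : {poly R} := (A + e *: B) * P ^+ 2 - Q ^+ 2 * (B + e *: A).
have DE x : D.[x] = (A.[x] + e * B.[x]) * P.[x] ^+ 2 - Q.[x] ^+ 2 * (B.[x] + e * A.[x]).
  by rewrite /D !hornerE.
have AeB x : 0 < A.[x] + e * B.[x].
  have := A0 x; have := B0 x; have := AB x; move: (A.[x]) (B.[x]) => a b; nra.
have BeA x : 0 < B.[x] + e * A.[x].
  have := A0 x; have := B0 x; have := AB x; move: (A.[x]) (B.[x]) => a b; nra.
have Q0 x : l <= x -> 0 < Q.[x] ^+ 2.
  move=> lx; rewrite exprn_gt0// (poles_gt0 E)// (le_trans _ lx)//.
  by rewrite lerNl (le_trans _ (ltW (eqo_l E)))// oppr_le0 ltW// (eqo_l E).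
have Pu j : (j <= k + k)%N -> odd j -> P.[u j] = 0.
  by move=> jk oj; rewrite /u oj zeros_poly_eq0//; clear -jk oj; lia.
have Dneg j : (j <= k + k)%N -> if odd j then 0 < D.[- u j] else D.[- u j] < 0.
  move=> jk; have uj := u_in jk; have [uj1 _] := andP uj; have q0 := Q0 _ uj1.
  rewrite DE; have -> : P.[- u j] = Q.[u j] by rewrite poles_polyE.
  have -> : Q.[- u j] = P.[u j] by rewrite poles_polyE opprK.
  case: ifPn => oj.
    rewrite (Pu j jk oj) expr0n mul0r subr0; exact: mulr_gt0 (AeB _) q0.
  rewrite (_ : P.[u j] ^+ 2 = Z * Q.[u j] ^+ 2); last first.
    by rewrite /u (negPf oj) (eqo_values E)//; clear -jk; lia.
  have := HE _ uj; have := A0 (- u j); have := B0 (- u j); have := AB (- u j).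
  move: (A.[_]) (B.[_]) => a b ab b0 a0 aE.
  have bp : 0 < b.
    rewrite lt_neqAle b0 andbT; apply/eqP => bE; move: aE ab; rewrite -bE mulr0 addr0.
    by move=> a1 a2; have := lt_le_trans a2 a1; rewrite ltxx.
  rewrite (_ : _ - _ = Q.[u j] ^+ 2 * ((a - zeta * b) + (zeta + e - Z) * b - Z * e * a)); last by ring.
  rewrite pmulr_rlt0//.
  have h1 : (zeta + e - Z) * b < 0 by rewrite pmulr_llt0// subr_lt0.
  have h2 : 0 <= Z * e * a := mulr_ge0 (ltW (mulr_gt0 Z0 e0)) a0.
  move: aE h1 h2; move: ((zeta + e - Z) * b) (Z * e * a) => v w aE h1 h2.
  by move: (zeta * b) aE => g aE; lra.
have Dpos j : (j <= k + k)%N -> if odd j then D.[u j] < 0 else 0 < D.[u j].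
  move=> jk; have uj := u_in jk; have [uj1 _] := andP uj; have q0 := Q0 _ uj1.
  rewrite DE; case: ifPn => oj.
    rewrite (Pu j jk oj) expr0n mulr0 sub0r oppr_lt0; exact: mulr_gt0 q0 (BeA _).
  rewrite (_ : P.[u j] ^+ 2 = Z * Q.[u j] ^+ 2); last first.
    by rewrite /u (negPf oj) (eqo_values E)//; clear -jk; lia.
  have := HF _ uj; have := A0 (u j); have := B0 (u j); have := AB (u j).
  move: (A.[_]) (B.[_]) => a b ab b0 a0 bE.
  have ap : 0 < a.
    rewrite lt_neqAle a0 andbT; apply/eqP => aE; move: bE ab; rewrite -aE mulr0 add0r.
    by move=> a1 a2; have := lt_le_trans a2 a1; rewrite ltxx.
  rewrite (_ : _ - _ = Q.[u j] ^+ 2 * ((zeta * a - b) + (Z - (zeta + e)) * a + Z * e * b)); last by ring.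
  rewrite pmulr_rgt0//.
  have h1 : 0 < (Z - (zeta + e)) * a by rewrite mulr_gt0// subr_gt0.
  have h2 : 0 <= Z * e * b := mulr_ge0 (ltW (mulr_gt0 Z0 e0)) b0.
  move: bE h1 h2; move: ((Z - (zeta + e)) * a) (Z * e * b) => v w bE h1 h2.
  by move: (zeta * a) bE => g bE; lra.
have D0 : D != 0.
  by apply: contraTneq (Dpos 0%N isT) => -> /=; rewrite horner0 ltxx.
have alt j : (j < k + k + k + k + 1)%N -> D.[s j] * D.[s j.+1] < 0.
  move=> jk; rewrite /s; case: (ltngtP j (k + k)) => h.
  - have := Dneg j (ltnW h); have := Dneg _ h; rewrite /=.
    by case: (odd j) => /= h1 h2; [rewrite pmulr_rlt0|rewrite nmulr_rlt0].
  - have -> : (k + k + k + k + 1 - j = (k + k + k + k + 1 - j.+1).+1)%N by clear -jk h; lia.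
    set i := (_ - j.+1)%N; have ik : (i < k + k)%N by rewrite /i; clear -jk h; lia.
    have := Dpos i (ltnW ik); have := Dpos _ ik; rewrite /=.
    by case: (odd i) => /= h1 h2; [rewrite pmulr_rlt0|rewrite nmulr_rlt0].
  - rewrite h (_ : (k + k + k + k + 1 - (k + k).+1 = k + k)%N); last by clear; lia.
    have := Dneg _ (leqnn (k + k)); have := Dpos _ (leqnn (k + k)).
    by rewrite addnn odd_double => h1 h2; rewrite nmulr_rlt0.
have := alternation_size D0 s_incr alt.
apply/negP; rewrite -leqNgt.
have szP : size P = k.+1 by exact: size_zeros_poly.
have szQ : size Q = k.+1 by exact: size_poles_poly.
have s1 : (size (A + e *: B)%R <= k + k + 1)%N.
  by rewrite (leq_trans (size_polyD _ _))// geq_max sA (leq_trans (size_scale_leq _ _)).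
have s2 : (size (B + e *: A)%R <= k + k + 1)%N.
  by rewrite (leq_trans (size_polyD _ _))// geq_max sB (leq_trans (size_scale_leq _ _)).
have s3 : (size (P ^+ 2)%R <= k + k + 1)%N.
  by rewrite (leq_trans (size_poly_exp_leq _ _))// szP; clear; lia.
have s4 : (size (Q ^+ 2)%R <= k + k + 1)%N.
  by rewrite (leq_trans (size_poly_exp_leq _ _))// szQ; clear; lia.
rewrite /D (leq_trans (size_polyD _ _))// geq_max size_polyN; apply/andP; split.
  rewrite (leq_trans (size_polyMleq _ _))//.
  by move: (size _) (size _) s1 s3 => m n; clear; lia.
rewrite (leq_trans (size_polyMleq _ _))//.
by move: (size _) (size _) s4 s2 => m n; clear; lia.
Qed.

End alternation.

(** * The value of the Zolotarev number *)

Section complex_modulus.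
Context {R : realType}.
Implicit Types (z w : R[i]) (x : R).
Local Notation "x %:C" := (real_complex R x) (format "x %:C").

Definition cabs z : R := complex.Re `|z|.

Lemma cabsE z : cabs z = Num.sqrt (complex.Re z ^+ 2 + complex.Im z ^+ 2).
Proof. by rewrite /cabs normc_def. Qed.

Lemma norm_cabs z : `|z| = (cabs z)%:C.
Proof. by rewrite /cabs normc_def. Qed.

Lemma cabs_ge0 z : 0 <= cabs z.
Proof. by rewrite cabsE sqrtr_ge0. Qed.

Lemma cabs_eq0 z : (cabs z == 0) = (z == 0).
Proof.
rewrite -[z == 0]normr_eq0 norm_cabs; apply/eqP/eqP => [->|]; first by rewrite rmorph0.
by move=> /(congr1 (@complex.Re R)).
Qed.

Lemma cabs_div z w : cabs (z / w) = cabs z / cabs w.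
Proof. by rewrite {1}/cabs normf_div !norm_cabs -fmorph_div. Qed.

Lemma cabs_real x : cabs x%:C = `|x|.
Proof. by rewrite cabsE /= expr0n addr0 sqrtr_sqr. Qed.

(** On the real line the squared modulus of a complex polynomial is a real
    polynomial; only through it do complex coefficients matter. *)
Definition absq (p : {poly R[i]}) : {poly R} :=
  (\poly_(i < size p) complex.Re p`_i) ^+ 2 + (\poly_(i < size p) complex.Im p`_i) ^+ 2.

Lemma horner_absq p x : (absq p).[x] = cabs p.[x%:C] ^+ 2.
Proof.
rewrite cabsE sqr_sqrtr ?addr_ge0 ?sqr_ge0//.
have -> : p.[x%:C] = Complex (\sum_(i < size p) complex.Re p`_i * x ^+ i)
                             (\sum_(i < size p) complex.Im p`_i * x ^+ i).
  rewrite horner_coef; elim/big_ind3 : _ => //=.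
  - by move=> u1 u2 u3 v1 v2 v3 -> ->.
  - move=> i _; rewrite -rmorphXn /=; case: (p`_i) => u v /=.
    by apply/eqP; rewrite eq_complex /= !mulr0 subr0 add0r !eqxx.
by rewrite /absq hornerD !horner_exp !horner_poly.
Qed.

Lemma size_absq (p : {poly R[i]}) k : (size p <= k.+1)%N -> (size (absq p) <= k + k + 1)%N.
Proof.
move=> sp; rewrite /absq (leq_trans (size_polyD _ _))// geq_max.
by apply/andP; split; rewrite (leq_trans (size_poly_exp_leq _ _))//;
  set q := \poly_(i < _) _; have : (size q <= k.+1)%N by [exact: leq_trans (size_poly _ _) sp];
  move: (size q) => m; clear; lia.
Qed.

End complex_modulus.

Section zolotarev_value.
Context {R : realType}.
Variables (l : R) (k : nat) (c t : nat -> R) (M b : R).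
Hypothesis E : equioscillation l k c t M.
Hypothesis b0 : 0 < b.
Local Notation "x %:C" := (real_complex R x) (format "x %:C").
Local Notation P := (zeros_poly k c).
Local Notation Q := (poles_poly k c).
Let l0 := eqo_l E.
Let M0 : 0 < M. Proof. by case/andP: (eqo_M E). Qed.
Let l1 : l < 1. Proof. by rewrite -(eqo_tk E) (node_lt1 E)// (eqo_k E) leqnn. Qed.

Lemma cintervalP (u v x : R) : u <= x <= v -> cinterval u v x%:C.
Proof. by move=> xuv; exists x => //=; rewrite in_itv. Qed.

Let scaled x : l <= x <= 1 -> b * l <= b * x <= b.
Proof. by move=> /andP[lx x1]; rewrite ler_pM2l// lx -[leRHS]mulr1 ler_pM2l. Qed.

(** A competitor with a smaller ratio, through its squared moduli, would
    contradict equioscillation_optimal. *)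
Lemma zolotarev_ge :
  ((M ^+ 2)%:E <= zolotarev k (cinterval (- b) (- (b * l))) (cinterval (b * l) b))%E.
Proof.
apply: le_ereal_inf_tmp => _ [p [q [[sp sq q0 pq] supE infF ->]]].
rewrite leNgt; apply/negP => small.
pose s := ratfun_sup p q (cinterval (- b) (- (b * l))).
pose d := ratfun_inf p q (cinterval (b * l) b).
rewrite -/s in supE small; rewrite -/d in infF small.
have onE x : l <= x <= 1 -> (ratfun_abs p q (- (b * x))%:C <= s)%E.
  move=> xl; apply: ereal_sup_ubound; exists (- (b * x))%:C => //; apply: cintervalP.
  by have /andP[h1 h2] := scaled xl; rewrite !lerN2 h1 h2.
have onF x : l <= x <= 1 -> (d <= ratfun_abs p q (b * x)%:C)%E.
  move=> xl; apply: ereal_inf_lbound; exists (b * x)%:C => //; apply: cintervalP.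
  exact: scaled.
have ll : l <= l <= 1 by rewrite lexx ltW.
have sval0 z : (0%:E <= ratfun_abs p q z)%E.
  by rewrite /ratfun_abs; case: ifP => _; [exact: leey|rewrite lee_fin cabs_ge0].
have [S sS S0] : exists2 S : R, s = S%:E & 0 <= S.
  have s0 : (0%:E <= s)%E by exact: le_trans (sval0 _) (onE _ ll).
  by case: (s) s0 supE => // r r0 _; exists r.
have [D D0 [Dd SD]] : exists2 D : R, 0 < D & (D%:E <= d)%E /\ S < M ^+ 2 * D.
  case: (d) infF small => [r|_|//].
    rewrite lte_fin => r0; rewrite sS inver gt_eqF// -EFinM lte_fin ltr_pdivrMr// => h.
    by exists r.
  move=> _; exists ((S + 1) / M ^+ 2); first by rewrite divr_gt0 ?exprn_gt0// ltr_wpDl.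
  by rewrite leey; split => //; rewrite mulrC divfK ?ltrDl// gt_eqF// exprn_gt0.
pose A := absq p \Po (b *: 'X).
pose B := absq q \Po (b *: 'X).
have AE x : A.[x] = cabs p.[(b * x)%:C] ^+ 2.
  by rewrite /A horner_comp hornerZ hornerX horner_absq.
have BE x : B.[x] = cabs q.[(b * x)%:C] ^+ 2.
  by rewrite /B horner_comp hornerZ hornerX horner_absq.
have bX : size (b *: 'X : {poly R}) = 2%N by rewrite size_scale ?size_polyX// gt_eqF.
have sA : (size A <= k + k + 1)%N by rewrite size_comp_poly2 ?size_absq.
have sB : (size B <= k + k + 1)%N by rewrite size_comp_poly2 ?size_absq.
have AB x : 0 < A.[x] + B.[x].
  rewrite AE BE lt_neqAle addr_ge0 ?sqr_ge0// andbT eq_sym paddr_eq0 ?sqr_ge0//.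
  rewrite !expf_eq0/= !cabs_eq0; apply/negP => /andP[pz qz].
  by have := coprimep_root pq pz; rewrite qz.
have M20 : 0 < M ^+ 2 by rewrite exprn_gt0.
(* S may be 0; S1 is positive and S1 / D is still below M^2. *)
pose S1 := (S + M ^+ 2 * D) / 2.
have S10 : 0 < S1 by rewrite divr_gt0// ltr_wpDl// mulr_gt0.
have SS1 : S <= S1 by rewrite /S1; lra.
have S1D : S1 / D < M ^+ 2 by rewrite ltr_pdivrMr// /S1; lra.
have Apos x : 0 <= A.[x] by rewrite AE sqr_ge0.
have Bpos x : 0 <= B.[x] by rewrite BE sqr_ge0.
have HE x : l <= x <= 1 -> A.[- x] <= S1 ^+ 2 * B.[- x].
  move=> xl; have := onE x xl; rewrite sS /ratfun_abs.
  rewrite AE BE mulrN; case: ifPn => // qz; rewrite lee_fin -[complex.Re _]/(cabs _) cabs_div.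
  have q1 : 0 < cabs q.[(- (b * x))%:C] by rewrite lt_neqAle cabs_ge0 eq_sym cabs_eq0 qz.
  rewrite ler_pdivrMr// => h.
  rewrite -exprMn ler_pXn2r ?nnegrE ?cabs_ge0//; first by rewrite (le_trans h)// ler_pM2r.
  exact: mulr_ge0 (ltW S10) (cabs_ge0 _).
have HF x : l <= x <= 1 -> D ^+ 2 * B.[x] <= A.[x].
  move=> xl; have := le_trans Dd (onF x xl); rewrite /ratfun_abs.
  rewrite AE BE; case: ifPn => [qz _|qz].
    move: qz; rewrite rootE -cabs_eq0 => /eqP ->.
    by rewrite expr0n mulr0 sqr_ge0.
  rewrite lee_fin -[complex.Re _]/(cabs _) cabs_div.
  have q1 : 0 < cabs q.[(b * x)%:C] by rewrite lt_neqAle cabs_ge0 eq_sym cabs_eq0 qz.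
  rewrite ler_pdivlMr// => h.
  by rewrite -exprMn ler_pXn2r ?nnegrE ?cabs_ge0 ?mulr_ge0 ?(ltW D0) ?(ltW q1).
(* The scaling makes the bounds on the two sets S1 / D and D / S1. *)
pose A1 := (S1 * D)^-1 *: A.
have SD0 : 0 < S1 * D by rewrite mulr_gt0.
have A1E x : A1.[x] = A.[x] / (S1 * D) by rewrite /A1 hornerZ mulrC.
apply: (@equioscillation_optimal R l k c t M E A1 B (S1 / D)).
- by rewrite (leq_trans (size_scale_leq _ _)).
- exact: sB.
- by move=> x; rewrite A1E divr_ge0// ltW.
- exact: Bpos.
- move=> x; have := AB x; have := Apos x; have := Bpos x.
  rewrite A1E le_eqVlt => /predU1P[<-|Bx] Ax.
    by rewrite !addr0 => ?; rewrite divr_gt0.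
  by move=> _; rewrite ltr_wpDl// divr_ge0// ltW.
- by rewrite S1D andbT divr_ge0 ?ltW.
- move=> x /HE h; rewrite A1E ler_pdivrMr// (le_trans h)//.
  by rewrite le_eqVlt; apply/orP; left; apply/eqP; field; rewrite gt_eqF.
- move=> x /HF h; rewrite A1E.
  rewrite (_ : S1 / D * _ = A.[x] / D ^+ 2); last by field; rewrite !gt_eqF.
  by rewrite ler_pdivlMr ?exprn_gt0// mulrC.
Qed.

Lemma extremal_bound x : l <= x <= 1 -> `|P.[x]| <= M * Q.[x].
Proof.
move=> xl; have := dev_ge0 E xl; rewrite horner_dev subr_ge0.
have q0 : 0 < Q.[x].
  case/andP: xl => lx _; rewrite (poles_gt0 E)// (le_trans _ lx)//.
  by rewrite lerNl (le_trans _ (ltW l0))// oppr_le0 ltW.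
rewrite -exprMn -(real_normK (num_real P.[x])) ler_pXn2r// nnegrE.
by rewrite mulr_ge0 ?ltW.
Qed.

(** The ratio is attained by the reciprocal of the extremal fraction, scaled
    by b. *)
Lemma zolotarev_le :
  (zolotarev k (cinterval (- b) (- (b * l))) (cinterval (b * l) b) <= (M ^+ 2)%:E)%E.
Proof.
pose bi : R := b^-1.
have bi0 : bi != 0 by rewrite invr_eq0 gt_eqF.
pose pr := Q \Po (bi *: 'X); pose qr := P \Po (bi *: 'X).
pose p := map_poly (real_complex R) pr; pose q := map_poly (real_complex R) qr.
have prE x : pr.[b * x] = Q.[x].
  by rewrite /pr horner_comp hornerZ hornerX mulrA mulVf ?mul1r// gt_eqF.
have qrE x : qr.[b * x] = P.[x].
  by rewrite /qr horner_comp hornerZ hornerX mulrA mulVf ?mul1r// gt_eqF.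
have bX : size (bi *: 'X : {poly R}) = 2%N by rewrite size_scale ?size_polyX.
have absE x : ratfun_abs p q (b * x)%:C = if P.[x] == 0 then +oo%E else (`|Q.[x]| / `|P.[x]|)%:E.
  rewrite /ratfun_abs rootE /p /q !horner_map prE qrE fmorph_eq0.
  case: ifP => // _; congr (_%:E).
  by rewrite -[complex.Re _]/(cabs _) cabs_div !cabs_real.
have kk : ratfun_kk k p q.
  split.
  - by rewrite size_map_poly size_comp_poly2// size_poles_poly.
  - by rewrite size_map_poly size_comp_poly2// size_zeros_poly.
  - by rewrite -size_poly_eq0 size_map_poly size_comp_poly2// size_zeros_poly.
  rewrite coprimep_map; apply: coprimep_comp_poly.
  rewrite /zeros_poly big_nat_cond; elim/big_rec : _ => [|j r /andP[/andP[_ jk] _] Qr]; first exact: coprimep1.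
  rewrite coprimepMr Qr andbT -opprB -scaleN1r coprimepZr ?oppr_eq0 ?oner_eq0//.
  rewrite coprimep_XsubC rootE gt_eqF// (poles_gt0 E)//.
  by rewrite (le_trans _ (ltW (zero_gt0 E jk)))// oppr_le0 ltW.
have unscale z u v : cinterval (b * u) (b * v) z -> exists2 x, u <= x <= v & z = (b * x)%:C.
  move=> [y /=]; rewrite in_itv/= => /andP[uy yv] <-; exists (y / b).
    by rewrite ler_pdivlMr// mulrC uy/= ler_pdivrMr// mulrC.
  by rewrite mulrC divfK// gt_eqF.
have bE : cinterval (- b) (- (b * l)) = cinterval (b * -1) (b * - l).
  by rewrite !mulrN mulr1.
have bF : cinterval (b * l) b = cinterval (b * l) (b * 1) by rewrite mulr1.
have supE : (ratfun_sup p q (cinterval (- b) (- (b * l))) <= M%:E)%E.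
  apply: ge_ereal_sup => _ [z + <-]; rewrite bE => /unscale[x /andP[x1 xl] ->].
  have xl' : l <= - x <= 1 by rewrite lerNr xl lerNl.
  rewrite absE; have P0 : 0 < P.[x].
    by rewrite (zeros_gt0 E)// (le_trans xl)// (le_trans _ (ltW l0))// oppr_le0 ltW.
  rewrite gt_eqF// lee_fin (gtr0_norm P0) ler_pdivrMr//.
  have := extremal_bound xl'.
  by rewrite -poles_polyE (poles_polyE k c (- x)) opprK.
have infF : ((M^-1)%:E <= ratfun_inf p q (cinterval (b * l) b))%E.
  apply: le_ereal_inf_tmp => _ [z + <-]; rewrite bF => /unscale[x xl ->].
  rewrite absE; case: ifPn => [_|P0]; first by rewrite leey.
  rewrite lee_fin ler_pdivlMr ?normr_gt0// mulrC ler_pdivrMr//.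
  rewrite (le_trans (extremal_bound xl))// mulrC ler_pM2r// ler_norm//.
apply: (@le_trans _ _ (ratfun_sup p q (cinterval (- b) (- (b * l))) / ratfun_inf p q (cinterval (b * l) b))%E).
  apply: ereal_inf_lbound; exists p, q; split => //.
  - exact: le_lt_trans supE (ltry _).
  - by apply: lt_le_trans infF; rewrite lte_fin invr_gt0.
have M2 : M ^+ 2 = M * M by [].
case: (ratfun_inf _ _ _) infF => [r| |]//; last first.
  by rewrite invey mule0 lee_fin exprn_ge0// ltW.
rewrite lee_fin => Mr; have r0 : 0 < r by rewrite (lt_le_trans _ Mr)// invr_gt0.
rewrite inver gt_eqF//.
apply: (@le_trans _ _ (M%:E * (r^-1)%:E)%E).
  by rewrite lee_pmul2r// lte_fin invr_gt0.
rewrite -EFinM lee_fin expr2 ler_pM2l//.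
by rewrite -[leRHS]invrK lef_pV2 ?posrE ?invr_gt0.
Qed.

End zolotarev_value.

Theorem corollary3p2 (R : realType) (k : nat) (a b : R)
    (hk : (1 <= k)%N) (ha : 0 < a) (hab : a < b) :
  let rho : R := expR (pi ^+ 2 / (2 * grotzsch_mu (a / b))) in
  let Zk : \bar R := zolotarev k (cinterval (- b) (- a)) (cinterval a b) in
  [/\ ((4 * rho ^- (2 * k) / (1 + rho ^- (4 * k)) ^+ 4)%:E <= Zk)%E,
      (Zk <= (4 * rho ^- (2 * k) / (1 + rho ^- (4 * k)) ^+ 2)%:E)%E &
      4 * rho ^- (2 * k) / (1 + rho ^- (4 * k)) ^+ 2 <= 4 * rho ^- (2 * k)].
Proof.
move=> rho Zk.
have b0 : 0 < b by exact: lt_trans hab.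
have l01 : 0 < a / b < 1 by rewrite divr_gt0// ltr_pdivrMr// mul1r.
have [c [t [M E]]] := equioscillation_nodes l01 hk.
have ba : b * (a / b) = a by rewrite mulrC divfK// gt_eqF.
have Zge := zolotarev_ge E b0; have Zle := zolotarev_le E b0.
rewrite ba -/Zk in Zge Zle.
have [M0 M1] := andP (eqo_M E).
have Z01 : 0 < M ^+ 2 < 1 by rewrite exprn_gt0//= expr_lt1// ltW.
have [m01 _] := compl_modulus l01.
have nomeE : grotzsch_nome (M ^+ 2) = rho ^- (2 * k).
  rewrite /rho -expRM_natl -expRN /grotzsch_nome; congr expR; congr (- _).
  rewrite /grotzsch_mu (ellipticK_transform E) natrM.
  move: (pi : R) (pi_gt0 R) => p p0.
  by field; rewrite !gt_eqF ?ellipticK_gt0.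
have nome2 : (rho ^- (2 * k)) ^+ 2 = rho ^- (4 * k).
  by rewrite exprVn -exprM mulnAC.
have upper := le_nome_upper Z01; have lower := ge_nome_lower Z01.
rewrite /nome_upper nomeE nome2 in upper; rewrite /nome_lower nomeE nome2 in lower.
split.
- by apply: le_trans Zge; rewrite lee_fin.
- by apply: (le_trans Zle); rewrite lee_fin.
have y0 : 0 < rho ^- (2 * k) by rewrite invr_gt0 exprn_gt0// expR_gt0.
have y0' : 0 < rho ^- (4 * k) by rewrite invr_gt0 exprn_gt0// expR_gt0.
rewrite ler_pdivrMr ?exprn_gt0 ?addr_gt0// ler_peMr ?mulr_ge0 ?(ltW y0)//.
by rewrite exprn_ege1// lerDl ltW.
Qed.
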